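(* Let $0<\mu\le1$ and let $0\ge V\in L^\infty(\mathbb{R}^N)$ satisfy the Arendt and Batty condition: $\int_GV\,dx=-\infty$ for all $G\in\mathcal{G}$. For $0<\theta<1$ define $$\Psi_{\theta,\mu,V}(x)=\int_0^{\theta/\|V\|_{L^\infty(\mathbb{R}^N)}}S_\mu(s)|V|(x)\,ds,\quad x\in\mathbb{R}^N.$$ Then for every $0<\theta<1$, $$0<\inf_{\mathbb{R}^N}\{\Psi_{\theta,\mu,V}\}\le\Psi_{\theta,\mu,V}(x)\le\theta<1,\quad x\in\mathbb{R}^N,$$ and $$\|S_{\mu,V}(t)\|_{\mathcal{L}(L^\infty(\mathbb{R}^N))}\le C_0e^{-\omega_0t},\quad t\ge0,$$ with $\omega_0=c\|V\|_{L^\infty(\mathbb{R}^N)}$, where $$c=-\frac1\theta\ln\Big(1-(1-\theta)\inf_{\mathbb{R}^N}\{\Psi_{\theta,\mu,V}\}\Big)>0,\qquad C_0=\frac1{1-(1-\theta)\inf_{\mathbb{R}^N}\{\Psi_{\theta,\mu,V}\}}>1.$$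
   Context: $\mathcal{G}$ is the class of all open subsets $G$ of $\mathbb{R}^N$ containing arbitrarily large balls, i.e. for every $r>0$ there is $x_0\in\mathbb{R}^N$ with $B(x_0,r)\subset G$. Fractional heat semigroup: $S_\mu(t)u_0(x)=\int_{\mathbb{R}^N}k_\mu(t,x-y)u_0(y)\,dy$, $k_\mu(t,x)=(2\pi)^{-N}\int_{\mathbb{R}^N}e^{ix\cdot\xi-t|\xi|^{2\mu}}\,d\xi$, $t>0$; $S_\mu(0)=I$. Perturbed semigroup in $L^\infty$ (for $u_t+(-\Delta)^\mu u=Vu$, $V\in L^\infty(\mathbb{R}^N)$): for $u_0\in L^\infty(\mathbb{R}^N)$, $u(t)=S_{\mu,V}(t)u_0$ is the unique $u\in C((0,\infty),L^\infty(\mathbb{R}^N))$, bounded on $(0,T]$ for each $T>0$, with $u(t)=S_\mu(t)u_0+\int_0^tS_\mu(t-s)Vu(s)\,ds$ for $t>0$; $S_{\mu,V}(0)=I$. *)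

(* Defs.v *)
From HB Require Import structures.
From mathcomp Require Import all_boot all_order all_algebra.
From mathcomp Require Import complex.
From mathcomp Require Import all_classical all_reals all_analysis.

Set Implicit Arguments.
Unset Strict Implicit.
Unset Printing Implicit Defensive.

Import Order.TTheory GRing.Theory Num.Theory.
Import numFieldNormedType.Exports.

Local Open Scope classical_set_scope.
Local Open Scope complex_scope.
Local Open Scope ring_scope.

Definition measure_rV_display : measure_display -> measure_display.
Proof. exact. Qed.

(* 'rV[R]_n carries the sigma-algebra generated by its coordinates, that is,
   the Borel sigma-algebra of R^n. *)
Section measurable_rV.
Context {R : realType} {n : nat}.

Let coors : 'I_n -> 'rV[R]_n -> R := fun i x => x ord0 i.

Let rV_set0 : g_sigma_preimage coors set0.
Proof. exact: sigma_algebra0. Qed.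

Let rV_setC A : g_sigma_preimage coors A -> g_sigma_preimage coors (~` A).
Proof. exact: sigma_algebraC. Qed.

Let rV_bigcup (F : _^nat) : (forall i, g_sigma_preimage coors (F i)) ->
  g_sigma_preimage coors (\bigcup_i (F i)).
Proof. exact: sigma_algebra_bigcup. Qed.

HB.instance Definition _ :=
  @isMeasurable.Build (measure_rV_display default_measure_display)
    'rV[R]_n (g_sigma_preimage coors) rV_set0 rV_setC rV_bigcup.

End measurable_rV.

Lemma measurable_rV_coord (R : realType) (n : nat) (i : 'I_n) :
  measurable_fun [set: 'rV[R]_n] (fun x : 'rV[R]_n => x ord0 i).
Proof.
move=> _ Y mY; rewrite setTI; apply: sub_sigma_algebra => /=.
rewrite -bigcup_seq/=; exists i => /=; first by rewrite mem_index_enum.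
by exists Y => //; rewrite setTI.
Qed.

Lemma measurable_fun_rV d (T : measurableType d) (R : realType) (n : nat)
    (f : T -> 'rV[R]_n) :
  (forall i, measurable_fun [set: T] (fun t => f t ord0 i)) ->
  measurable_fun [set: T] f.
Proof.
move=> mf _ Y; rewrite setTI.
pose G := [set A : set 'rV[R]_n | measurable (f @^-1` A)].
suff : @measurable _ 'rV[R]_n `<=` G by exact.
apply: smallest_sub.
  split => [|A mA|F mF]; rewrite /G/=.
  - by rewrite preimage_set0.
  - by rewrite setTD -preimage_setC; exact: measurableC.
  - by rewrite preimage_bigcup; exact: bigcupT_measurable.
rewrite -bigcup_seq/= => A [i _] [B mB <-].
rewrite /G/= setTI -comp_preimage.
by rewrite -[X in measurable X]setTI; exact: mf.
Qed.

Section lebesgue_rV_step.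
Context {R : realType} {n : nat}.

Definition rV_cons (p : measurableTypeR R * 'rV[R]_n) : 'rV[R]_n.+1 :=
  \row_i (if unlift ord0 i is Some j then p.2 ord0 j else p.1).

Definition rV_uncons (x : 'rV[R]_n.+1) : measurableTypeR R * 'rV[R]_n :=
  (x ord0 ord0, \row_j x ord0 (lift ord0 j)).

Lemma rV_consK : cancel rV_cons rV_uncons.
Proof.
move=> [a x]; rewrite /rV_uncons mxE unlift_none; congr (_, _).
by apply/rowP => j; rewrite !mxE liftK.
Qed.

Lemma rV_unconsK : cancel rV_uncons rV_cons.
Proof.
move=> x; apply/rowP => i; rewrite mxE.
by case: unliftP => [j ->|->]//=; rewrite mxE.
Qed.

Lemma measurable_rV_cons : measurable_fun [set: measurableTypeR R * 'rV[R]_n] rV_cons.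
Proof.
apply: measurable_fun_rV => i; case: (unliftP ord0 i) => [j|] ->.
- rewrite [X in measurable_fun _ X](_ : _ = (fun x : 'rV[R]_n => x ord0 j) \o snd).
    by apply: measurableT_comp => //; exact: measurable_rV_coord.
  by apply/funext => p; rewrite mxE liftK.
- rewrite [X in measurable_fun _ X](_ : _ = fst)//.
  by apply/funext => p; rewrite mxE unlift_none.
Qed.

Lemma measurable_rV_uncons : measurable_fun [set: 'rV[R]_n.+1] rV_uncons.
Proof.
apply/measurable_fun_pairP; split.
  exact: measurable_rV_coord.
apply: measurable_fun_rV => i.
rewrite [X in measurable_fun _ X](_ : _ = fun x : 'rV[R]_n.+1 => x ord0 (lift ord0 i)).
  exact: measurable_rV_coord.
by apply/funext => x /=; rewrite mxE.
Qed.

Variable m : {sigma_finite_measure set 'rV[R]_n -> \bar R}.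

Definition lebesgue_rV_step : set 'rV[R]_n.+1 -> \bar R :=
  pushforward (@lebesgue_measure R \x m)%E rV_cons.

Let step0 : lebesgue_rV_step set0 = 0%E.
Proof. by rewrite /lebesgue_rV_step /pushforward preimage_set0 measure0. Qed.

Let step_ge0 A : (0 <= lebesgue_rV_step A)%E.
Proof. by rewrite /lebesgue_rV_step /pushforward measure_ge0. Qed.

Let step_sigma_additive : semi_sigma_additive lebesgue_rV_step.
Proof.
have mcons A : measurable A -> measurable (rV_cons @^-1` A).
  by move=> mA; rewrite -[X in measurable X]setTI; exact: measurable_rV_cons.
move=> F mF tF mUF; rewrite /lebesgue_rV_step /pushforward preimage_bigcup.
apply: measure_semi_sigma_additive.
- by move=> k; exact: mcons.
- apply/trivIsetP => /= i j _ _ ij; rewrite -preimage_setI.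
  by move/trivIsetP : tF => /(_ _ _ _ _ ij) ->//; rewrite preimage_set0.
- by rewrite -preimage_bigcup; exact: mcons.
Qed.

HB.instance Definition _ :=
  isMeasure.Build _ _ _ lebesgue_rV_step step0 step_ge0 step_sigma_additive.

Let lebesgue_rV_step_sigma_finite : sigma_finite setT lebesgue_rV_step.
Proof.
have /sigma_finiteP[F [TF ndF Foo]] := sigma_finiteT (@lebesgue_measure R).
have /sigma_finiteP[G [TG ndG Goo]] := sigma_finiteT m.
exists (fun k => rV_uncons @^-1` (F k `*` G k)).
  apply/esym; rewrite -subTset => x _.
  have [i _ Fi] : (\bigcup_i F i) (rV_uncons x).1 by rewrite -TF.
  have [j _ Gj] : (\bigcup_j G j) (rV_uncons x).2 by rewrite -TG.
  exists (maxn i j) => //; split.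
  - by move: Fi; exact/subsetPset/ndF/leq_maxl.
  - by move: Gj; exact/subsetPset/ndG/leq_maxr.
move=> k; have [mF Fy] := Foo k; have [mG Gy] := Goo k; split.
  rewrite -[X in measurable X]setTI; apply: measurable_rV_uncons => //.
  exact: measurableX.
rewrite /lebesgue_rV_step /pushforward -comp_preimage.
rewrite (_ : rV_uncons \o rV_cons = id).
  by rewrite preimage_id product_measure1E// lte_mul_pinfty// ge0_fin_numE.
by apply/funext => p; exact: rV_consK.
Qed.

HB.instance Definition _ :=
  Measure_isSigmaFinite.Build _ _ _ lebesgue_rV_step
    lebesgue_rV_step_sigma_finite.

End lebesgue_rV_step.

(* Lebesgue measure on R^n, as the n-fold product of Lebesgue measure on R. *)
Fixpoint lebesgue_rV {R : realType} (n : nat) :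
    {sigma_finite_measure set 'rV[R]_n -> \bar R} :=
  if n is n'.+1 then lebesgue_rV_step (lebesgue_rV n')
  else @dirac _ 'rV[R]_0 0 R.

Lemma lebesgue_rV_box (R : realType) (n : nat) (A : 'I_n -> set R) :
  (forall i, measurable (A i)) ->
  lebesgue_rV n [set x : 'rV[R]_n | forall i, A i (x ord0 i)] =
  (\prod_(i < n) lebesgue_measure (A i))%E.
Proof.
elim: n A => [|n IHn] A mA.
  rewrite big_ord0 /= (_ : [set _ | _] = setT) ?diracT//.
  by apply/seteqP; split=> x // _ [].
rewrite big_ord_recl -IHn //= /lebesgue_rV_step /pushforward.
rewrite -product_measure1E//; last first.
  rewrite (_ : [set _ | _] = \bigcap_(i in [set: 'I_n])
      ((fun x : 'rV[R]_n => x ord0 i) @^-1` A (lift ord0 i))).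
    apply: fin_bigcap_measurable; first exact: finite_finset.
    move=> i _; rewrite -[X in measurable X]setTI.
    exact: measurable_rV_coord.
  by apply/seteqP; split=> x /= Ax i; [move=> _; exact: Ax|exact: (Ax i)].
  exact: (mA ord0).
congr (product_measure1 _ _ _).
apply/seteqP; split=> [[a x] /= Ax|[a x] /= [A0 Ax] i].
  split; first by have := Ax ord0; rewrite mxE unlift_none.
  by move=> i; have := Ax (lift ord0 i); rewrite mxE liftK.
by rewrite mxE; case: unliftP => [j|] ->.
Qed.

Section Rn.
Context {R : realType} {n : nat}.
Implicit Types (x y : 'rV[R]_n).

Definition dotp x y : R := \sum_(i < n) x ord0 i * y ord0 i.

(* The Euclidean norm: `|x| on 'rV[R]_n is the supremum norm. *)
Definition enorm x : R := Num.sqrt (dotp x x).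

Definition eball x (r : R) : set 'rV[R]_n := [set y | enorm (y - x) < r].

Definition large_open (G : set 'rV[R]_n) : Prop :=
  open G /\ forall r : R, 0 < r -> exists x, eball x r `<=` G.

End Rn.

Section complex_valued.
Context {R : realType}.

Definition cexp (z : R[i]) : R[i] :=
  (expR (complex.Re z) * cos (complex.Im z)) +i*
  (expR (complex.Re z) * sin (complex.Im z)).

Definition cintegral {n : nat} (f : 'rV[R]_n -> R[i]) : R[i] :=
  (\int[lebesgue_rV n]_x complex.Re (f x)) +i*
  (\int[lebesgue_rV n]_x complex.Im (f x)).

End complex_valued.

(* Elements are representatives of the classes of L^oo(R^n): almost-everywhere
   equal functions are not identified. *)
Definition Linfty (R : realType) (n : nat) :=
  LfunType (@lebesgue_rV R n) (leey 1).

Definition Linfty_norm {R : realType} {n : nat} (f : 'rV[R]_n -> R) : R :=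
  fine 'N[lebesgue_rV n]_+oo[EFin \o f]%E.

Definition Linfty_opnorm {R : realType} {n : nat}
    (T : Linfty R n -> Linfty R n) : \bar R :=
  ereal_sup [set (Linfty_norm (T f))%:E | f in [set f : Linfty R n | Linfty_norm f <= 1]].

Section heat_semigroup.
Context {R : realType} {n : nat}.
Variable mu : R.

Definition heat_kernelC (t : R) (x : 'rV[R]_n) : R[i] :=
  ((2 * pi) ^- n)%:C *
  cintegral (fun xi => cexp ((- (t * enorm xi `^ (2 * mu))) +i* dotp x xi)).

(* heat_kernelC is real-valued: xi |-> -xi conjugates its integrand. *)
Definition heat_kernel (t : R) (x : 'rV[R]_n) : R :=
  complex.Re (heat_kernelC t x).

Definition heat_sg (t : R) (u0 : 'rV[R]_n -> R) : 'rV[R]_n -> R :=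
  if t == 0 then u0
  else fun x => \int[lebesgue_rV n]_y (heat_kernel t (x - y) * u0 y).

(* The L^oo-valued integral is written pointwise: its integrand is continuous
   in s for the L^oo norm and consists of continuous functions of x. *)
Definition mild_solution (V u0 : Linfty R n) (u : R -> Linfty R n) : Prop :=
  [/\ forall t, 0 < t -> Linfty_norm (u s - u t) @[s --> t] --> 0,
      forall T, 0 < T ->
        exists M, forall t, 0 < t <= T -> Linfty_norm (u t) <= M &
      forall t, 0 < t -> \forall x \ae lebesgue_rV n,
        u t x = heat_sg t u0 x +
          \int[lebesgue_measure]_(s in `]0, t[)
            heat_sg (t - s) (V \* u s) x].

(* Mild solutions are unique up to almost-everywhere equality at each t > 0, so
   the choice made by xget is immaterial. *)
Definition perturbed_sg (V : Linfty R n) (t : R) (u0 : Linfty R n) :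
    Linfty R n :=
  if t == 0 then u0 else xget (fun=> u0) [set u | mild_solution V u0 u] t.

Definition Psi (theta : R) (V : Linfty R n) (x : 'rV[R]_n) : R :=
  \int[lebesgue_measure]_(s in `[0, theta / Linfty_norm V])
    heat_sg s (fun y => `|V y|) x.

End heat_semigroup.

Definition arendt_batty {R : realType} {n : nat} (V : 'rV[R]_n -> R) : Prop :=
  forall G : set 'rV[R]_n, large_open G ->
    (\int[lebesgue_rV n]_(x in G) (V x)%:E = -oo)%E.

(* Main.v *)
(** exp(-t l^mu) is a limit of finite sums of exponentials e^(-s l) with
    nonnegative weights, so inequalities satisfied by all Gaussian kernels pass
    to the kernel k_mu: it is nonnegative and bounded below by a positive
    constant on bounded sets.  Fourier inversion then gives mass 1 and the
    semigroup law.

    Let a be the norm of V and W = V + a >= 0.  The mild solution is the fixed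
    point of u = e^(-at) S(t) u0 + int_0^t e^(-a(t-s)) S(t-s) (W u(s)) ds, and
    the scheme shows |u(t)| <= |u0|_oo p(t), where p is the solution issued
    from 1, and p(s) >= e^(-as).  With tau = theta/a this gives p >= 1 - theta
    on ]0, tau[, hence p(tau) = 1 + int_0^tau S(tau-s) (V p(s)) ds is at most
    q = 1 - (1 - theta) inf Psi; iterating over steps of length tau yields the
    decay q^j for t > j tau.

    Finally inf Psi > 0: by the Arendt-Batty condition the integral of |V| over
    B(x,r) is at least some delta > 0 for some r and all x, since otherwise a
    union of balls of radii 1, 2, 3, ... would carry finite mass. *)

Require Import Defs.
From mathcomp Require Import all_boot all_order all_algebra.
From mathcomp Require Import complex.
From mathcomp Require Import all_classical all_reals all_analysis.
From mathcomp Require Import measurable_realfun ess_sup_inf.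
From mathcomp Require Import ring lra.

Set Implicit Arguments.
Unset Strict Implicit.
Unset Printing Implicit Defensive.

Import Order.TTheory GRing.Theory Num.Theory.
Import numFieldNormedType.Exports.

Local Open Scope classical_set_scope.
Local Open Scope ring_scope.

(** Nonnegativity of k_mu cannot be read off its oscillatory integral. For mu <= 1 the power series
    of 1 - (1 - z)^mu has nonnegative coefficients, which is what makes the approximating weights
    nonnegative without constructing a stable subordinator. A lower bound A e^(-l1 s) - B e^(-l2 s)
    of the Gaussian kernels survives the limit, because averaging e^(-ls) over the weights of an
    approximant is evaluating it at l.

    The shift by a makes the Duhamel operator order preserving, of norm at most 1 - e^(-at) < 1 up
    to time t, so the fixed point is global in time. The price is the return to the undamped
    equation, through resolvent identities.

    A mild solution is a curve in L^oo with no joint measurability, and [perturbed_sg] selects an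
    arbitrary one. The estimates are therefore proved for a fixed point defined and bounded
    everywhere, then transferred at each time by a separate uniqueness argument.

    The constant [C0] is the loss from rounding t / tau to an integer. The lower bound of Psi uses
    only the upper half of the time interval, since the kernel has no uniform lower bound on a ball
    as s tends to 0. *)

Notation integ m f := (m.-integrable [set: _] (EFin \o f)).

(** * Lebesgue integration *)

Section integ_lemmas.
Context d (T : measurableType d) (R : realType).
Variable m : {measure set T -> \bar R}.
Implicit Types (f g : T -> R).

Lemma integ_meas f : integ m f -> measurable_fun [set: T] f.
Proof. by move=> /measurable_int/measurable_EFinP. Qed.

Lemma eq_integ f g : f =1 g -> integ m f -> integ m g.
Proof. by move=> /funext ->. Qed.

Lemma integ_le g f : measurable_fun [set: T] f -> (forall x, `|f x| <= g x) ->
  integ m g -> integ m f.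
Proof.
move=> mf fg ig; apply: (le_integrable _ _ _ ig) => //.
  exact/measurable_EFinP.
by move=> x _ /=; rewrite lee_fin (le_trans (fg x))// ler_norm.
Qed.

Lemma integP f : measurable_fun [set: T] f -> (forall x, 0 <= f x) ->
  integ m f <-> (\int[m]_x (f x)%:E < +oo)%E.
Proof.
move=> mf f0; split.
  move=> /integrableP[_]; congr (_ < _)%E; apply: eq_integral => x _ /=.
  by rewrite ger0_norm.
move=> h; apply/integrableP; split; first exact/measurable_EFinP.
by under eq_integral do rewrite /= ger0_norm//.
Qed.

Lemma EFin_Rintegral f : integ m f -> (\int[m]_x f x)%:E = (\int[m]_x (f x)%:E)%E.
Proof. by move=> mf; rewrite /Rintegral fineK//; exact: integrable_fin_num. Qed.

Lemma integD f g : integ m f -> integ m g -> integ m (fun x => f x + g x).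
Proof. by move=> mf mg; exact: (integrableD measurableT mf mg). Qed.

Lemma integB f g : integ m f -> integ m g -> integ m (fun x => f x - g x).
Proof. by move=> mf mg; exact: (integrableB measurableT mf mg). Qed.

Lemma integZl (r : R) f : integ m f -> integ m (fun x => r * f x).
Proof. by move=> mf; exact: (integrableZl measurableT r mf). Qed.

Lemma integ0 : integ m (fun=> 0 : R).
Proof. exact: integrable0. Qed.

Lemma integ_norm f : integ m f -> integ m (fun x => `|f x|).
Proof. by move=> /integrable_norm. Qed.

Lemma integMr (C : R) f g : measurable_fun [set: T] g -> (forall x, `|g x| <= C) ->
  integ m f -> integ m (fun x => f x * g x).
Proof.
move=> mg gC mf; have C0 : forall x : T, 0 <= C by move=> x; apply: le_trans (gC x).
apply: (@integ_le (fun x => C * `|f x|)).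
- by apply: measurable_funM => //; exact: integ_meas.
- by move=> x; rewrite normrM mulrC ler_wpM2r.
- exact/integZl/integ_norm.
Qed.

Lemma ler_Rint f g : integ m f -> integ m g -> (forall x, f x <= g x) ->
  \int[m]_x f x <= \int[m]_x g x.
Proof. by move=> mf mg fg; apply: le_Rintegral. Qed.

Lemma norm_Rint_le f g : integ m f -> integ m g -> (forall x, `|f x| <= g x) ->
  `|\int[m]_x f x| <= \int[m]_x g x.
Proof.
move=> mf mg fg; apply: le_trans (le_normr_Rintegral measurableT mf) _.
by apply: ler_Rint => //; exact: integ_norm.
Qed.

Lemma Rint_ae_eq f g : measurable_fun [set: T] f -> measurable_fun [set: T] g ->
  (\forall x \ae m, f x = g x) -> \int[m]_x f x = \int[m]_x g x.
Proof.
move=> mf mg fg; rewrite /Rintegral; congr fine; apply: ae_eq_integral => //.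
- exact/measurable_EFinP.
- exact/measurable_EFinP.
- by apply: filterS fg => x /= -> _.
Qed.

Lemma Rint_dominated (f_ : nat -> T -> R) f g :
  (forall n, measurable_fun [set: T] (f_ n)) -> measurable_fun [set: T] f ->
  (\forall x \ae m, f_ n x @[n --> \oo] --> f x) ->
  integ m g -> (forall n x, `|f_ n x| <= g x) ->
  integ m f /\ \int[m]_x f_ n x @[n --> \oo] --> \int[m]_x f x.
Proof.
move=> mf_ mf f_f ig f_g.
have [] := @dominated_convergence _ _ _ m _ measurableT
  (fun n x => (f_ n x)%:E) (EFin \o f) (EFin \o g).
- by move=> n; exact/measurable_EFinP.
- exact/measurable_EFinP.
- by apply: filterS f_f => x fx _; apply: cvg_EFin => //; exact: nearW.
- exact: ig.
- by apply: aeW => x n _ /=; rewrite lee_fin.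
move=> iff _ h; split => //.
by apply: fine_cvg; rewrite fineK//; exact: integrable_fin_num.
Qed.

Lemma Rint_dominatedW (f_ : nat -> T -> R) f g :
  (forall n, measurable_fun [set: T] (f_ n)) -> measurable_fun [set: T] f ->
  (forall x, f_ n x @[n --> \oo] --> f x) ->
  integ m g -> (forall n x, `|f_ n x| <= g x) ->
  integ m f /\ \int[m]_x f_ n x @[n --> \oo] --> \int[m]_x f x.
Proof. by move=> mf_ mf f_f; apply: Rint_dominated => //; exact: aeW. Qed.

(** For limits with no dominating function at hand: the bound on the integrals also yields
    integrability of the limit. It serves for the stable kernel, whose decay at infinity is not
    known in advance. *)
Lemma Rint_fatou (f_ : nat -> T -> R) f (M : R) :
  (forall n, integ m (f_ n)) -> (forall n x, 0 <= f_ n x) ->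
  (forall x, f_ n x @[n --> \oo] --> f x) ->
  (forall n, \int[m]_x f_ n x <= M) ->
  integ m f /\ \int[m]_x f x <= M.
Proof.
move=> mf_ f0 f_f fM.
have mf : measurable_fun [set: T] f.
  by apply: (@measurable_fun_cvg _ _ _ _ f_) => // n; exact: integ_meas.
have fge0 x : 0 <= f x.
  by rewrite -(cvg_lim _ (f_f x))//; apply: limr_ge; [exact: cvgP (f_f x)|exact: nearW].
have key : (\int[m]_x (f x)%:E <= M%:E)%E.
  have := @fatou _ _ _ m _ measurableT (fun n x => (f_ n x)%:E).
  move=> /(_ _ _)/le_trans; have -> : (\int[m]_x (f x)%:E)%E =
     (\int[m]_x limn_einf (fun n => (f_ n x)%:E))%E.
    apply: eq_integral => x _; apply/esym.
    have : (fun n => (f_ n x)%:E) @ \oo --> (f x)%:E.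
      by apply: cvg_EFin; [exact: nearW|exact: f_f].
    by move/cvg_limn_einf_sup => -[].
  apply.
  - by move=> n; apply/measurable_EFinP/integ_meas.
  - by move=> n x _; rewrite lee_fin.
  - rewrite limn_einf_lim; apply: lime_le; first exact: is_cvg_einfs.
    apply: nearW => n; apply: (@le_trans _ _ (\int[m]_x (f_ n x)%:E)%E).
      by apply: ereal_inf_lbound; exists n => /=.
    by rewrite -EFin_Rintegral// lee_fin.
have iff : integ m f by apply/integP => //; apply: le_lt_trans key (ltry _).
by split => //; rewrite -lee_fin EFin_Rintegral.
Qed.

(* |f_n - f| = (f_n - f) + 2 (f - f_n)^+ , and the last term is dominated by f. *)
Lemma scheffe (f_ : nat -> T -> R) f :
  (forall n, integ m (f_ n)) -> integ m f ->
  (forall n x, 0 <= f_ n x) -> (forall x, 0 <= f x) ->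
  (\forall x \ae m, f_ n x @[n --> \oo] --> f x) ->
  \int[m]_x f_ n x @[n --> \oo] --> \int[m]_x f x ->
  \int[m]_x `|f_ n x - f x| @[n --> \oo] --> 0.
Proof.
move=> if_ iff f_0 f0 f_f If.
pose g n x := 2^-1 * (`|f x - f_ n x| + (f x - f_ n x)).
have mg n : measurable_fun [set: T] (g n).
  apply: measurable_funM => //; apply: measurable_funD.
    by apply: measurableT_comp => //; apply: measurable_funB; exact: integ_meas.
  by apply: measurable_funB; exact: integ_meas.
have gf n x : `|g n x| <= f x.
  rewrite /g; have := f_0 n x; have := f0 x.
  by case: (ger0P (f x - f_ n x)) => h1 h2 h3; rewrite ger0_norm; lra.
have g0 : \forall x \ae m, g n x @[n --> \oo] --> (0 : R).
  apply: filterS f_f => x fx; rewrite /g.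
  have h : f x - f_ n x @[n --> \oo] --> 0.
    by rewrite -(subrr (f x)); apply: cvgB => //; exact: cvg_cst.
  rewrite -[X in _ --> X](mulr0 2^-1); apply: cvgM; first exact: cvg_cst.
  rewrite -[X in _ --> X](addr0 0); apply: cvgD => //.
  by rewrite -[X in _ --> X](normr0 R); exact: cvg_norm.
have [_ Ig] := @Rint_dominated g (fun=> 0) f mg (@measurable_cst _ _ _ _ _ _) g0 iff gf.
rewrite -[X in _ --> X]addr0 -[X in _ --> X + _](subrr (\int[m]_x f x)).
have -> : (fun n => \int[m]_x `|f_ n x - f x|) =
  (fun n => (\int[m]_x f_ n x - \int[m]_x f x) + 2 * \int[m]_x g n x).
  apply/funext => n; have ign : integ m (g n) by apply: integ_le iff.
  rewrite -RintegralB// -RintegralZl// -RintegralD//; last 2 first.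
  - exact: integB.
  - exact: integZl.
  apply: eq_Rintegral => x _; rewrite /g.
  by rewrite distrC; case: (ger0P (f x - f_ n x)) => h; lra.
apply: cvgD; first by apply: cvgB => //; exact: cvg_cst.
rewrite -[X in _ --> X](mulr0 2); apply: cvgM; first exact: cvg_cst.
rewrite (_ : 0 = \int[m]_x (0 : R)); first exact: Ig.
by rewrite Rintegral_cst// mul0r.
Qed.

End integ_lemmas.

Section fubini_lemmas.
Context d1 d2 (T1 : measurableType d1) (T2 : measurableType d2) (R : realType).
Variable m1 : {sigma_finite_measure set T1 -> \bar R}.
Variable m2 : {sigma_finite_measure set T2 -> \bar R}.
Implicit Types f : T1 * T2 -> R.

(** No integrability is assumed: the integrals of the positive and negative parts are measurable in
    [x], and so is [fine] of their difference. *)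
Lemma measurable_Rint2 f : measurable_fun [set: T1 * T2] f ->
  measurable_fun [set: T1] (fun x => \int[m2]_y f (x, y)).
Proof.
move=> mf; have mF : measurable_fun [set: T1 * T2] (EFin \o f).
  exact/measurable_EFinP.
apply: measurableT_comp => //=.
rewrite (_ : (fun _ => _) =
 (fubini_F m2 (EFin \o f)^\+ \- fubini_F m2 (EFin \o f)^\-)%E); last first.
  apply/funext => x; rewrite [LHS]integralE /fubini_F /=.
  by congr (_ - _)%E; apply: eq_integral => y _; rewrite ?funeposE ?funenegE.
apply: emeasurable_funB; apply: measurable_fun_fubini_tonelli_F => //.
- exact: measurable_funepos.
- exact: measurable_funeneg.
Qed.

Lemma Rint_prod f : integ (m1 \x m2)%E f ->
  \int[m1]_x (\int[m2]_y f (x, y)) = \int[(m1 \x m2)%E]_z f z.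
Proof.
move=> mf; rewrite /Rintegral -(integral12_prod_meas1 mf); congr fine.
(* Sections are integrable for almost every [x] only; elsewhere [fine] may alter the inner
   integral. *)
have := ae_integrable1 mf => h.
apply: ae_eq_integral => //.
- by apply/measurable_EFinP; exact: (measurable_Rint2 (integ_meas mf)).
- exact: (measurable_fubini_F mf).
- by apply: filterS h => x /= /integrable_fin_num hx _; rewrite /fubini_F /= fineK// hx.
Qed.

Lemma integ_prod f (g : T1 -> R) : measurable_fun [set: T1 * T2] f ->
  (forall x, integ m2 (fun y => f (x, y))) ->
  (forall x, \int[m2]_y `|f (x, y)| <= g x) -> integ m1 g -> integ (m1 \x m2)%E f.
Proof.
move=> mf f2 fg ig; apply/integrable12ltyP; first exact/measurable_EFinP.
have mF : measurable_fun [set: T1] (fun x => \int[m2]_y `|f (x, y)|).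
  by apply: (@measurable_Rint2 (fun z => `|f z|)); exact: measurableT_comp.
have iF : integ m1 (fun x => \int[m2]_y `|f (x, y)|).
  by apply: (integ_le mF _ ig) => x; rewrite ger0_norm ?fg// Rintegral_ge0.
under eq_integral => x _ do rewrite -(@EFin_Rintegral _ _ _ m2 (fun y => `|f (x, y)|) (integ_norm (f2 x))).
move/integP : iF; apply => // x; exact: Rintegral_ge0.
Qed.

End fubini_lemmas.

Lemma Rint_fubini d1 d2 (T1 : measurableType d1) (T2 : measurableType d2) (R : realType)
    (m1 : {sigma_finite_measure set T1 -> \bar R})
    (m2 : {sigma_finite_measure set T2 -> \bar R}) (f : T1 -> T2 -> R) :
  integ (m1 \x m2)%E (fun z => f z.1 z.2) ->
  \int[m1]_x (\int[m2]_y f x y) = \int[m2]_y (\int[m1]_x f x y).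
Proof.
move=> mf; rewrite (Rint_prod mf) /Rintegral -(integral21_prod_meas1 mf); congr fine.
have h := ae_integrable2 mf.
apply: ae_eq_integral => //.
- exact: (measurable_fubini_G mf).
- apply/measurable_EFinP; apply: (@measurable_Rint2 _ _ _ _ _ m1 (fun z => f z.2 z.1)).
  exact: (measurableT_comp (integ_meas mf) (@measurable_swap _ _ _ _)).
- by apply: filterS h => x /= /integrable_fin_num hx _; rewrite /fubini_G /= fineK// hx.
Qed.

Lemma integ_tensor d1 d2 (T1 : measurableType d1) (T2 : measurableType d2) (R : realType)
    (m1 : {sigma_finite_measure set T1 -> \bar R})
    (m2 : {sigma_finite_measure set T2 -> \bar R}) (f : T1 -> R) (g : T2 -> R) :
  integ m1 f -> integ m2 g -> integ (m1 \x m2)%E (fun z => f z.1 * g z.2).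
Proof.
move=> mf mg; apply: (@integ_prod _ _ _ _ _ _ _ _ (fun x => `|f x| * \int[m2]_y `|g y|)).
- apply: measurable_funM; first exact: (measurableT_comp (integ_meas mf)).
  exact: (measurableT_comp (integ_meas mg)).
- by move=> x; exact: (integZl (f x) mg).
- move=> x; rewrite -RintegralZl//; last exact: integ_norm.
  by under eq_Rintegral do rewrite normrM.
- apply: eq_integ (integZl (\int[m2]_y `|g y|) (integ_norm mf)) => x.
  by rewrite mulrC.
Qed.

(** * Invariance of Lebesgue measure under reflections *)

Section reflection.
Context {R : realType}.
Local Notation leb := (@lebesgue_measure R).

Let mR := measurableTypeR R.

Lemma measurable_subr (c : R) :
  measurable_fun [set: mR] ((fun y : R => c - y) : mR -> mR).
Proof. by have : measurable_fun [set: R] (fun y : R => c - y) by apply: measurable_funB. Qed.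

Lemma lebesgue_measure_subr (c : R) (A : set R) : measurable A ->
  leb ((fun y => c - y) @^-1` A) = leb A.
Proof.
move=> mA; apply/esym; pose mf := measurable_subr c.
suff h X : ocitv X -> leb X = pushforward leb ((fun y : R => c - y) : mR -> mR) X.
  exact: (@lebesgue_measure_unique R
    (measure_function_pushforward__canonical__measure_function_Measure leb mf) h A mA).
move=> /ocitvP[->|[[a b] /= ab ->]].
  by rewrite /pushforward preimage_set0 !measure0.
rewrite /pushforward /= (_ : _ @^-1` _ = `[c - b, c - a[%classic).
  rewrite !lebesgue_measure_itv /= !lte_fin ab ltrD2l ltrN2 ab.
  by rewrite -!EFinB; congr (_%:E); lra.
by apply/seteqP; split=> x /=; rewrite !in_itv /= => /andP[? ?]; apply/andP; split; lra.
Qed.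

Lemma ge0_integral_subr (c : R) (f : R -> \bar R) : measurable_fun [set: R] f ->
  (forall x, 0 <= f x)%E -> (\int[leb]_y f (c - y)%R = \int[leb]_y f y)%E.
Proof.
move=> mf f0; pose mc := measurable_subr c.
rewrite [RHS](eq_measure_integral
  (measure_function_pushforward__canonical__measure_function_Measure leb mc)) => [|A mA _].
  by rewrite /= ge0_integral_pushforward.
by rewrite /= /pushforward lebesgue_measure_subr.
Qed.

End reflection.

Section rV_measurability.
Context d (T : measurableType d) {R : realType} {n : nat}.
Implicit Types f g : T -> 'rV[R]_n.

Lemma measurable_rV_entry f (i : 'I_n) : measurable_fun [set: T] f ->
  measurable_fun [set: T] (fun z => f z ord0 i).
Proof. by move=> mf; exact: (measurableT_comp (measurable_rV_coord i) mf). Qed.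

Lemma measurable_dotp f g : measurable_fun [set: T] f -> measurable_fun [set: T] g ->
  measurable_fun [set: T] (fun z => dotp (f z) (g z)).
Proof.
move=> mf mg; apply: measurable_sum => i.
by apply: measurable_funM; exact: measurable_rV_entry.
Qed.

Lemma measurable_rV_sub f g : measurable_fun [set: T] f -> measurable_fun [set: T] g ->
  measurable_fun [set: T] (fun z => f z - g z).
Proof.
move=> mf mg; apply: measurable_fun_rV => i; under eq_fun do rewrite !mxE.
by apply: measurable_funB; exact: measurable_rV_entry.
Qed.

End rV_measurability.

Section lebesgue_rV_integral.
Context {R : realType}.
Local Notation leb := (@lebesgue_measure R).

Lemma ge0_integral_rVS n (f : 'rV[R]_n.+1 -> \bar R) : measurable_fun setT f ->
  (forall x, 0 <= f x)%E ->
  (\int[lebesgue_rV n.+1]_x f x =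
   \int[leb]_a \int[lebesgue_rV n]_x f (rV_cons (a, x)))%E.
Proof.
move=> mf f0 /=; rewrite /lebesgue_rV_step.
rewrite (ge0_integral_pushforward (@measurable_rV_cons R n) _ measurableT)//.
rewrite preimage_setT (fubini_tonelli1 (f \o rV_cons))//.
  by apply: measurableT_comp => //; exact: measurable_rV_cons.
by move=> x /=; exact: f0.
Qed.

(** Induction on the dimension: the tail is reflected by the induction hypothesis, the first
    coordinate by the one-dimensional case. *)
Lemma ge0_integral_rV_sub n (c : 'rV[R]_n) (f : 'rV[R]_n -> \bar R) :
  measurable_fun setT f -> (forall x, 0 <= f x)%E ->
  (\int[lebesgue_rV n]_y f (c - y)%R = \int[lebesgue_rV n]_y f y)%E.
Proof.
elim: n c f => [|n IH] c f mf f0.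
  by apply: eq_integral => x _; congr f; apply/rowP => -[].
have mfc : measurable_fun setT (fun y : 'rV[R]_n.+1 => f (c - y)).
  by apply: (measurableT_comp mf); exact: measurable_rV_sub.
have mS : measurable_fun [set: measurableTypeR R * 'rV[R]_n] (f \o rV_cons).
  by apply: (measurableT_comp mf); exact: measurable_rV_cons.
rewrite !ge0_integral_rVS//.
have -> : (\int[leb]_a \int[lebesgue_rV n]_x f (c - rV_cons (a, x))%R =
  \int[leb]_a \int[lebesgue_rV n]_x f (rV_cons ((c ord0 ord0 - a)%R, x)))%E.
  apply: eq_integral => a _.
  rewrite -(IH (\row_j c ord0 (lift ord0 j))
    (fun x => f (rV_cons ((c ord0 ord0 - a)%R, x)))) => [|//|//]; last first.
    exact: (measurableT_comp mS (pair1_measurable _)).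
  apply: eq_integral => x _; congr f; apply/rowP => i; rewrite !mxE.
  by case: unliftP => [j ->|->] //=; rewrite !mxE.
rewrite (ge0_integral_subr _ (f := fun a => \int[lebesgue_rV n]_x f (rV_cons (a, x)))%E)//.
- exact: (measurable_fun_fubini_tonelli_F (m2 := lebesgue_rV n) (f \o rV_cons) mS (fun=> f0 _)).
- by move=> a; apply: integral_ge0.
Qed.

End lebesgue_rV_integral.

(** * Gaussian integrals *)

Section gauss.
Context {R : realType}.
Local Notation leb := (@lebesgue_measure R).
Variable s : R.
Hypothesis s0 : 0 < s.

Let gau (a : R) := expR (- (s * a ^+ 2)).

(** Reduces the Gaussian to the normal density of variance [(2 * s)^-1], whose integrability and
    mass are known. *)
Let gauE (a : R) : gau a = Num.sqrt (pi / s) * normal_pdf 0 (Num.sqrt (2 * s)^-1) a.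
Proof.
have s2 : 0 <= (2 * s)^-1 by rewrite invr_ge0 mulr_ge0// ltW.
have sg0 : Num.sqrt (2 * s)^-1 != 0 by rewrite gt_eqF// sqrtr_gt0 invr_gt0 mulr_gt0.
rewrite normal_pdfE// /normal_peak /normal_fun sqr_sqrtr// subr0.
have -> : (2 * s)^-1 *+ 2 = s^-1 by rewrite -mulr_natl invfM; field; rewrite gt_eqF.
have -> : (2 * s)^-1 * pi *+ 2 = pi / s by rewrite -mulr_natl invfM; field; rewrite gt_eqF.
rewrite mulrA mulfV ?mul1r; last by rewrite gt_eqF// sqrtr_gt0 divr_gt0// pi_gt0.
by rewrite /gau invrK mulNr mulrC.
Qed.

Lemma integ_gauss : integ leb (fun a => expR (- (s * a ^+ 2))).
Proof.
apply: (@eq_integ _ _ _ leb (fun a => Num.sqrt (pi / s) *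
  normal_pdf 0 (Num.sqrt (2 * s)^-1) a)) => [a|]; first by rewrite -gauE.
by apply: integZl; exact: integrable_normal_pdf.
Qed.

Lemma Rint_gauss : \int[leb]_a expR (- (s * a ^+ 2)) = Num.sqrt (pi / s).
Proof.
under eq_Rintegral => a _ do rewrite -/(gau a) gauE.
rewrite RintegralZl//; last exact: integrable_normal_pdf.
by rewrite /Rintegral integral_normal_pdf/= ?mulr1// gt_eqF// sqrtr_gt0 invr_gt0 mulr_gt0.
Qed.

End gauss.

(** * Fourier transform of the Gaussian on the line *)

Section gauss_fourier.
Context {R : realType}.
Local Notation leb := (@lebesgue_measure R).
Variable s : R.
Hypothesis s0 : 0 < s.

Let gau (a : R) := expR (- (s * a ^+ 2)).

Let mgau : measurable_fun [set: R] gau.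
Proof. by apply: measurableT_comp => //; apply: measurableT_comp => //; apply: measurable_funM. Qed.

Let igau : integ leb gau.
Proof. exact: integ_gauss. Qed.

(** This dominates the derivative in [x] of [gau a * cos (x * a)], for differentiation under the
    integral. Half of the exponent absorbs the factor [|a|]. *)
Let iagau : integ leb (fun a => `|a| * gau a).
Proof.
have bnd (a : R) : `| `|a| * gau a| <= (1 + 2 / s) * expR (- (s / 2 * a ^+ 2)).
  rewrite normrM normr_id (ger0_norm (expR_ge0 _)).
  have -> : expR (- (s * a ^+ 2)) = expR (- (s / 2 * a ^+ 2)) * expR (- (s / 2 * a ^+ 2)).
    by rewrite -expRD; congr expR; field.
  rewrite mulrA ler_wpM2r ?expR_ge0//.
  rewrite expRN -ler_pdivlMr ?invr_gt0 ?expR_gt0// invrK.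
  have h : 1 + s / 2 * a ^+ 2 <= expR (s / 2 * a ^+ 2) by exact: expR_ge1Dx.
  have h2 : `|a| <= 1 + a ^+ 2.
    by rewrite -real_normK ?num_real//; nra.
  have h3 : 1 + a ^+ 2 <= (1 + 2 / s) * (1 + s / 2 * a ^+ 2).
    have -> : (1 + 2 / s) * (1 + s / 2 * a ^+ 2) = 1 + s / 2 * a ^+ 2 + 2 / s + a ^+ 2.
      by field; rewrite gt_eqF.
    have : 0 <= s / 2 * a ^+ 2 by rewrite mulr_ge0 ?sqr_ge0// divr_ge0// ltW.
    have : 0 <= 2 / s by rewrite divr_ge0// ltW.
    lra.
  apply: le_trans h2 (le_trans h3 _); rewrite ler_wpM2l//.
  by rewrite addr_ge0// divr_ge0// ltW.
apply (@integ_le _ _ _ leb (fun a : R => (1 + 2 / s) * expR (- (s / 2 * a ^+ 2)))) => //.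
- by apply: measurable_funM => //; exact: measurableT_comp.
- by apply/integZl/integ_gauss; rewrite divr_gt0.
Qed.

(** Differentiation under the integral gives F' = - H, integration by parts gives x F = 2 s H, so F
    solves a linear first-order equation. *)
Let F x := \int[leb]_a (gau a * cos (x * a)).
Let H x := \int[leb]_a (gau a * (a * sin (x * a))).

Let mcosl x : measurable_fun [set: R] (fun a : R => cos (x * a)).
Proof. by apply: continuous_measurable_fun => a; apply: continuous_comp; [exact: mulrl_continuous|exact: continuous_cos]. Qed.

Let msinl x : measurable_fun [set: R] (fun a : R => sin (x * a)).
Proof. by apply: continuous_measurable_fun => a; apply: continuous_comp; [exact: mulrl_continuous|exact: continuous_sin]. Qed.

Let icos x : integ leb (fun a => gau a * cos (x * a)).
Proof.
apply (@integMr _ _ _ leb 1 gau (fun a => cos (x * a))); last exact: igau.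
- exact: mcosl.
- by move=> a; exact: cos_max.
Qed.

Let isin x : integ leb (fun a => gau a * (a * sin (x * a))).
Proof.
apply (@integ_le _ _ _ leb (fun a => `|a| * gau a)); last exact: iagau.
- apply: measurable_funM; first exact: mgau.
  by apply: measurable_funM; [exact: measurable_id|exact: msinl].
- move=> a; rewrite normrM (ger0_norm (expR_ge0 _)) mulrC ler_wpM2r ?expR_ge0//.
  by rewrite normrM ler_piMr// sin_max.
Qed.

Let dF x : is_derive x (1 : R) F (- H x).
Proof.
pose f x a := gau a * cos (x * a).
have df y a : is_derive y (1 : R) (f ^~ a) (gau a * (- sin (y * a) * a)).
  have d1 : is_derive y (1 : R) (fun z => z * a) a.
    have := is_deriveM (is_derive_id y (1:R)) (is_derive_cst a y (1 : R)).
    by rewrite scaler0 add0r => h; apply: is_derive_eq; rewrite /GRing.scale/= mulr1.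
  have d2 : is_derive y (1 : R) (fun z => cos (z * a)) (- sin (y * a) * a).
    exact: (@is_derive1_comp _ cos (fun z => z * a) y _ _ (is_derive_cos (y * a)) d1).
  exact: (is_deriveZ (gau a) d2).
have pf y a : partial1of2 f y a = - (gau a * (a * sin (y * a))).
  rewrite partial1of2E; have [_ ->] := df y a; ring.
have Ix : (`](x - 1), (x + 1)[%classic : set R) x by rewrite /= in_itv/=; apply/andP; split; lra.
have i1 y : (`](x - 1), (x + 1)[%classic : set R) y -> integ leb (f y) by move=> _; exact: icos.
have i2 y a : (`](x - 1), (x + 1)[%classic : set R) y -> [set: R] a -> derivable (f ^~ a) y 1.
  by move=> _ _; have [] := df y a.
have i3 y a : (`](x - 1), (x + 1)[%classic : set R) y -> [set: R] a -> `|partial1of2 f y a| <= `|a| * gau a.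
  move=> _ _; rewrite pf normrN normrM (ger0_norm (expR_ge0 _)) mulrC ler_wpM2r ?expR_ge0//.
  by rewrite normrM ler_piMr// sin_max.
have i4 a : 0 <= `|a| * gau a by rewrite mulr_ge0 ?expR_ge0.
have D1 := derivable_under_integral measurableT Ix i1 i2 i4 iagau i3.
have D2 := differentiation_under_integral measurableT Ix i1 i2 i4 iagau i3.
apply: DeriveDef; first exact: D1.
rewrite -derive1E D2; under eq_Rintegral do rewrite pf.
rewrite /H -mulN1r -RintegralZl//.
by apply: eq_Rintegral => a _; rewrite mulN1r.
Qed.

(* Integral over R of the derivative of the integrable function gau * sin. *)
Let HF x : x * F x = 2 * s * H x.
Proof.
pose g a := gau a * sin (x * a).
pose g' a := gau a * (x * cos (x * a)) - 2 * s * (gau a * (a * sin (x * a))).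
have dg a : is_derive a (1 : R) g (g' a).
  have d1 : is_derive a (1 : R) (fun z => x * z) x.
    by have := is_deriveZ x (is_derive_id a (1:R)); rewrite /GRing.scale/= mulr1.
  have d2 : is_derive a (1 : R) (fun z => sin (x * z)) (cos (x * a) * x).
    exact: (@is_derive1_comp _ sin (fun z => x * z) a _ _ (is_derive_sin (x * a)) d1).
  have d3 : is_derive a (1 : R) (fun z : R => - (s * z ^+ 2)) (- (s * (2 * a))).
    have := is_deriveN (is_deriveZ s (is_deriveX 2 (is_derive_id a (1:R)))).
    by rewrite /GRing.scale/= mulr1 expr1.
  have d4 : is_derive a (1 : R) gau (gau a * - (s * (2 * a))).
    exact: (@is_derive1_comp _ expR (fun z => - (s * z ^+ 2)) a _ _ (is_derive_expR _) d3).
  have := is_deriveM d4 d2; rewrite /GRing.scale/= => h.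
  by apply: (is_derive_eq h); rewrite /g'; ring.
have ig1 : integ leb (fun a => gau a * (x * cos (x * a))).
  have := integZl x (icos x).
  by apply: eq_integ => a; ring.
have ig' : integ leb g' by apply: integB => //; exact: integZl.
have cg' : continuous g'.
  move=> a; have cgau : {for a, continuous gau}.
    apply: continuous_comp; last exact: continuous_expR.
    by apply: cvgN; apply: cvgM; [exact: cvg_cst|exact: exprn_continuous].
  have cc : cos (x * z) @[z --> a] --> cos (x * a).
    by apply: continuous_comp; [exact: mulrl_continuous|exact: continuous_cos].
  have cs : sin (x * z) @[z --> a] --> sin (x * a).
    by apply: continuous_comp; [exact: mulrl_continuous|exact: continuous_sin].
  apply: cvgB; first by apply: cvgM => //; apply: cvgM => //; exact: cvg_cst.
  by apply: cvgM; [exact: cvg_cst|apply: cvgM => //; apply: cvgM].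
have mg' : measurable_fun [set: R] g' := continuous_measurable_fun cg'.
(* [g] is odd, so the two boundary terms add up. *)
have step n : \int[leb]_(a in `[- n.+1%:R, n.+1%:R]) g' a = 2 * g n.+1%:R.
  rewrite /Rintegral (@continuous_FTC2 _ g' g).
  - rewrite /= /g mulrN sinN /gau sqrrN; lra.
  - by rewrite -subr_gt0 opprK addr_gt0// ltr0n.
  - exact: continuous_subspaceT.
  - split.
    + by move=> y _; have [] := dg y.
    + apply: cvg_at_right_filter; have [h _] := dg (- n.+1%:R).
      by apply: differentiable_continuous; exact/derivable1_diffP.
    + apply: cvg_at_left_filter; have [h _] := dg n.+1%:R.
      by apply: differentiable_continuous; exact/derivable1_diffP.
  - by move=> y _; rewrite derive1E; have [_ ->] := dg y.
have L1 : (fun n => \int[leb]_(a in `[- n.+1%:R, n.+1%:R]) g' a) @ \oo --> \int[leb]_a g' a.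
  under eq_fun do rewrite Rintegral_mkcond.
  have [|||||] // := @Rint_dominated _ _ _ leb
    (fun n => g' \_ (`[- n.+1%:R, n.+1%:R]%classic : set R)) g' (fun a => `|g' a|).
  - move=> n; apply/(measurable_restrictT _ _).1 => //.
    exact: measurable_funTS.
  - apply: (@aeW _ (measurableTypeR R) R leb) => a; apply: cvg_near_cst.
    near=> n; rewrite patchE mem_set//= in_itv/= -ler_norml.
    rewrite (@le_trans _ _ n%:R) ?ler_nat//.
    by near: n; exact: nbhs_infty_ger.
  - exact: integ_norm.
  - move=> n a; rewrite patchE; case: ifP => // _; by rewrite normr0.
have L2 : (fun n => \int[leb]_(a in `[- n.+1%:R, n.+1%:R]) g' a) @ \oo --> (0 : R).
  under eq_fun do rewrite step.
  (* 2 |g(n+1)| <= 2 e^(-s (n+1)^2) <= (2 / s) / (n+1), from e^u >= u and (n+1)^2 >= n+1. *)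
  have h0 : (2 / s) * harmonic n @[n --> \oo] --> 0.
    by rewrite -[X in _ --> X](mulr0 (2 / s)); apply: cvgM; [exact: cvg_cst|exact: cvg_harmonic].
  apply: (@squeeze_cvgr _ _ _ _ (fun n => - ((2 / s) * harmonic n)) (fun n => (2 / s) * harmonic n)) => //.
    apply: nearW => n; rewrite -ler_norml normrM ger0_norm// -mulrA ler_pM2l//.
    rewrite normrM ger0_norm ?expR_ge0// (@le_trans _ _ (gau n.+1%:R))//.
      by rewrite ler_piMr ?expR_ge0// sin_max.
    rewrite /gau /harmonic /= expRN -invfM lef_pV2 ?posrE ?expR_gt0 ?mulr_gt0//.
    apply: le_trans (expR_ge1Dx _); rewrite ler_wpDl// ler_wpM2l ?(ltW s0)//.
    have : 1 <= n.+1%:R :> R by rewrite ler1n.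
    nra.
  by rewrite -[X in _ --> X]oppr0; exact: cvgN.
have : \int[leb]_a g' a = 0 by apply: (cvg_unique _ L1 L2).
rewrite RintegralB//; last exact: integZl.
rewrite RintegralZl// => /eqP; rewrite subr_eq0 => /eqP <-.
rewrite -RintegralZl//; by apply: eq_Rintegral => a _; ring.
Unshelve. all: by end_near. Qed.

(** By [dF] and [HF] the derivative of F(y) e^(y^2 / (4s)) vanishes; its value at 0 is the Gaussian
    integral. *)
Lemma gauss_fourier1 x : \int[leb]_a (expR (- (s * a ^+ 2)) * cos (x * a)) =
  Num.sqrt (pi / s) * expR (- (x ^+ 2 / (4 * s))).
Proof.
have s4 : 4 * s != 0 by rewrite mulf_neq0// gt_eqF.
pose h y := F y * expR (y ^+ 2 / (4 * s)).
have dh y : is_derive y (1 : R) h 0.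
  have d1 : is_derive y (1 : R) (fun z : R => (4 * s)^-1 * z ^+ 2) ((4 * s)^-1 * (2 * y)).
    have := is_deriveZ (4 * s)^-1 (is_deriveX 2 (is_derive_id y (1:R))).
    by rewrite /GRing.scale/= mulr1 expr1.
  have d2 := @is_derive1_comp _ expR (fun z => (4 * s)^-1 * z ^+ 2) y _ _ (is_derive_expR _) d1.
  have := is_deriveM (dF y) d2; rewrite /GRing.scale/= => h1.
  have -> : h = (F * (expR \o (fun z : R => (4 * s)^-1 * z ^+ 2)))%R.
    by apply/funext => z; rewrite /h /= mulrC [z ^+ 2 / _]mulrC mulrC.
  apply: (is_derive_eq h1).
  have := HF y.
  set E := expR _ => hH.
  have -> : F y * (E * ((4 * s)^-1 * (2 * y))) = E * (2 * s)^-1 * (y * F y).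
    by field; rewrite ?gt_eqF.
  by rewrite hH; field; rewrite gt_eqF.
have := @is_derive_0_is_cst _ h x 0 dh.
rewrite /h expr0n/= mul0r expR0 mulr1 => e.
have F0 : F 0 = Num.sqrt (pi / s).
  rewrite -Rint_gauss//; apply: eq_Rintegral => a _.
  by rewrite mul0r cos0 mulr1.
by rewrite -/(F x) -F0 -e -mulrA -expRD subrr expR0 mulr1.
Qed.

End gauss_fourier.

(** * Integrals and Gaussians on R^n *)

Section rV_integral.
Context {R : realType}.
Local Notation leb := (@lebesgue_measure R).

Lemma Rint_rVS n (f : 'rV[R]_n.+1 -> R) : integ (lebesgue_rV n.+1) f ->
  \int[lebesgue_rV n.+1]_x f x = \int[leb]_a (\int[lebesgue_rV n]_x f (rV_cons (a, x))).
Proof.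
move=> mf; have mc := @measurable_rV_cons R n.
have mF : measurable_fun setT (EFin \o f) by apply/measurable_EFinP; exact: (integ_meas mf).
have mg : integ (leb \x lebesgue_rV n)%E (f \o rV_cons).
  apply/integrableP; split; first exact: (measurableT_comp mF mc).
  case/integrableP : mf => _; rewrite /= /lebesgue_rV_step.
  rewrite (ge0_integral_pushforward mc _ measurableT)//.
  by apply/measurable_EFinP; apply: measurableT_comp => //; exact/measurable_EFinP.
rewrite (Rint_prod mg) /Rintegral /= /lebesgue_rV_step.
by rewrite (integral_pushforward mc)//.
Qed.

Lemma Rint_rV_sub n (c : 'rV[R]_n) (f : 'rV[R]_n -> R) : measurable_fun setT f ->
  \int[lebesgue_rV n]_y f (c - y) = \int[lebesgue_rV n]_y f y.
Proof.
move=> mf; have mF : measurable_fun setT (EFin \o f) by exact/measurable_EFinP.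
rewrite /Rintegral; congr fine; rewrite integralE [RHS]integralE.
rewrite -(ge0_integral_rV_sub c (measurable_funepos mF))//.
rewrite -(ge0_integral_rV_sub c (measurable_funeneg mF))//.
by congr (_ - _)%E; apply: eq_integral => y _; rewrite ?funeposE ?funenegE.
Qed.

Lemma integ_rV_sub n (c : 'rV[R]_n) (f : 'rV[R]_n -> R) :
  integ (lebesgue_rV n) f -> integ (lebesgue_rV n) (fun y => f (c - y)).
Proof.
move=> mf; have mF := integ_meas mf.
have ms : measurable_fun setT (fun y : 'rV[R]_n => c - y) by exact: measurable_rV_sub.
apply/integrableP; split; first by apply/measurable_EFinP; exact: (measurableT_comp mF ms).
case/integrableP : mf => _; congr (_ < _)%E; apply/esym.
rewrite (ge0_integral_rV_sub c (f := fun y => `|(f y)%:E|%E))//.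
by apply: measurableT_comp => //; exact/measurable_EFinP.
Qed.

Lemma integral_rV0 (f : 'rV[R]_0 -> \bar R) : measurable_fun setT f ->
  (\int[lebesgue_rV 0]_x f x = f 0%R)%E.
Proof.
move=> mf; have := @integral_dirac _ _ (0 : 'rV[R]_0) R setT measurableT f mf.
by rewrite diracT mul1e.
Qed.

(** Reduces integrability on R^n to the line, for Gaussians and, by comparison, for the symbol of
    the fractional semigroup. *)
Lemma integ_rV_prod n (phi : R -> R) : (forall a, 0 <= phi a) -> integ leb phi ->
  integ (lebesgue_rV n) (fun x => \prod_(i < n) phi (x ord0 i)).
Proof.
move=> phi0 iphi; have mphi : measurable_fun [set: R] phi := integ_meas iphi.
have mp k : measurable_fun [set: 'rV[R]_k] (fun x => \prod_(i < k) phi (x ord0 i)).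
  by apply: measurable_prod => i _; apply: (measurableT_comp mphi); exact: measurable_rV_coord.
elim: n => [|n IH]; apply/integP; try exact: mp; try by move=> x; apply: prodr_ge0.
  by rewrite integral_rV0 ?ltry//; apply/measurable_EFinP; exact: mp.
rewrite ge0_integral_rVS; last 2 first.
- by apply/measurable_EFinP; exact: mp.
- by move=> x; rewrite lee_fin prodr_ge0.
rewrite (_ : (fun a => \int[_]_x _)%E = (fun a =>
    ((\int[lebesgue_rV n]_x (\prod_(i < n) phi (x ord0 i)))%R * phi a)%:E)); last first.
  apply/funext => a; rewrite mulrC -RintegralZl// EFin_Rintegral; last exact: integZl.
  apply: eq_integral => x _; congr EFin; rewrite big_ord_recl mxE unlift_none.
  by congr (_ * _); apply: eq_bigr => i _; rewrite mxE liftK.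
rewrite -(@EFin_Rintegral _ _ _ leb (fun a => _ * phi a)) ?ltry//.
exact: (integZl _ iphi).
Qed.

Lemma dotp_cons n (a b : R) (x y : 'rV[R]_n) :
  dotp (rV_cons (a, x)) (rV_cons (b, y)) = a * b + dotp x y.
Proof.
rewrite /dotp big_ord_recl !mxE unlift_none; congr (_ + _).
by apply: eq_bigr => i _; rewrite !mxE liftK.
Qed.

Lemma measurable_sqdotp n : measurable_fun [set: 'rV[R]_n] (fun x => dotp x x).
Proof. exact: measurable_dotp. Qed.

Lemma dotp_ge0 n (x : 'rV[R]_n) : 0 <= dotp x x.
Proof. by apply: sumr_ge0 => i _; rewrite -expr2 sqr_ge0. Qed.

Lemma dotpNr n (x y : 'rV[R]_n) : dotp x (- y) = - dotp x y.
Proof. by rewrite /dotp -sumrN; apply: eq_bigr => i _; rewrite mxE mulrN. Qed.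

Lemma dotpC n (x y : 'rV[R]_n) : dotp x y = dotp y x.
Proof. by apply: eq_bigr => i _; rewrite mulrC. Qed.

Lemma dotpDl n (x y z : 'rV[R]_n) : dotp (x + y) z = dotp x z + dotp y z.
Proof. by rewrite /dotp -big_split; apply: eq_bigr => i _; rewrite mxE mulrDl. Qed.

Lemma dotpNl n (x y : 'rV[R]_n) : dotp (- x) y = - dotp x y.
Proof. by rewrite dotpC dotpNr dotpC. Qed.

Lemma dotp0l n (y : 'rV[R]_n) : dotp 0 y = 0.
Proof. by rewrite /dotp big1// => i _; rewrite mxE mul0r. Qed.

Lemma dotpBl n (x y z : 'rV[R]_n) : dotp (x - y) z = dotp x z - dotp y z.
Proof. by rewrite dotpDl dotpNl. Qed.

Section gauss_rV.
Variable s : R.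
Hypothesis s0 : 0 < s.

Lemma integ_gauss_rV n :
  integ (lebesgue_rV n) (fun x : 'rV[R]_n => expR (- (s * dotp x x))).
Proof.
apply: eq_integ (integ_rV_prod n (fun a => expR_ge0 _) (integ_gauss s0)) => x /=.
rewrite -expR_sum; congr expR; rewrite sumrN mulr_sumr; congr (- _).
Qed.

Lemma mcos_rV n (x : 'rV[R]_n) : measurable_fun setT (fun xi => cos (dotp x xi)).
Proof.
by apply: measurableT_comp; [exact: (continuous_measurable_fun (@continuous_cos R))|exact: measurable_dotp].
Qed.

Lemma msin_rV n (x : 'rV[R]_n) : measurable_fun setT (fun xi => sin (dotp x xi)).
Proof.
by apply: measurableT_comp; [exact: (continuous_measurable_fun (@continuous_sin R))|exact: measurable_dotp].
Qed.

Lemma integ_cos_rV n (f : 'rV[R]_n -> R) (x : 'rV[R]_n) : integ (lebesgue_rV n) f ->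
  integ (lebesgue_rV n) (fun xi => f xi * cos (dotp x xi)).
Proof. by apply: (integMr (C := 1)) => [|a]; [exact: mcos_rV|exact: cos_max]. Qed.

Lemma integ_sin_rV n (f : 'rV[R]_n -> R) (x : 'rV[R]_n) : integ (lebesgue_rV n) f ->
  integ (lebesgue_rV n) (fun xi => f xi * sin (dotp x xi)).
Proof. by apply: (integMr (C := 1)) => [|a]; [exact: msin_rV|exact: sin_max]. Qed.

(** The integrand is odd, so the reflection at 0 changes the sign of the integral. *)
Lemma gauss_sin_rV n (x : 'rV[R]_n) :
  \int[lebesgue_rV n]_xi (expR (- (s * dotp xi xi)) * sin (dotp x xi)) = 0.
Proof.
have ig := integ_sin_rV x (integ_gauss_rV n).
have := Rint_rV_sub 0 (integ_meas ig); set I := RHS.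
under eq_Rintegral => y _ do rewrite sub0r dotpNr dotpNl opprK dotpNr sinN mulrN -mulN1r.
by rewrite RintegralZl// -/I; lra.
Qed.

(** Induction on the dimension: the cosine of a sum splits into cos cos - sin sin, and the sine
    integral over the tail vanishes by [gauss_sin_rV]. *)
Lemma gauss_fourier_rV n (x : 'rV[R]_n) :
  \int[lebesgue_rV n]_xi (expR (- (s * dotp xi xi)) * cos (dotp x xi)) =
  Num.sqrt (pi / s) ^+ n * expR (- (dotp x x / (4 * s))).
Proof.
elim: n x => [|n IH] x.
  rewrite /Rintegral integral_rV0; last first.
    by apply/measurable_EFinP; exact: (integ_meas (integ_cos_rV x (integ_gauss_rV 0))).
  by rewrite /= /dotp !big_ord0 mulr0 mul0r oppr0 expR0 cos0 expr0.
rewrite -[x]rV_unconsK; case: (rV_uncons x) => b y.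
rewrite Rint_rVS; last exact: integ_cos_rV (integ_gauss_rV _).
pose G := Num.sqrt (pi / s) ^+ n * expR (- (dotp y y / (4 * s))).
have inner a : \int[lebesgue_rV n]_xi (expR (- (s * dotp (rV_cons (a, xi)) (rV_cons (a, xi)))) *
    cos (dotp (rV_cons (b, y)) (rV_cons (a, xi)))) =
  G * (expR (- (s * a ^+ 2)) * cos (b * a)).
  have i1 := integ_cos_rV y (integ_gauss_rV n).
  have i2 := integ_sin_rV y (integ_gauss_rV n).
  (* Subtracts a multiple of the vanishing sine integral, so that the addition formula applies under
     a single integral. *)
  rewrite /G -IH -[RHS]subr0 -(mulr0 (expR (- (s * a ^+ 2)) * sin (b * a))) -(gauss_sin_rV y).
  rewrite -RintegralZr// -RintegralZl// -RintegralB//; last 2 first.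
  - by apply: eq_integ (integZl (expR (- (s * a ^+ 2)) * cos (b * a)) i1) => xi; ring.
  - exact: integZl.
  by apply: eq_Rintegral => xi _; rewrite !dotp_cons cosD [s * (_ + _)]mulrDr opprD expRD expr2; ring.
under eq_Rintegral do rewrite inner.
have i3 : integ leb (fun a => expR (- (s * a ^+ 2)) * cos (b * a)).
  apply (@integMr _ _ _ leb 1 (fun a => expR (- (s * a ^+ 2))) (fun a => cos (b * a))).
  - apply: continuous_measurable_fun => a; apply: continuous_comp; [exact: mulrl_continuous|exact: continuous_cos].
  - by move=> a; exact: cos_max.
  - exact: integ_gauss.
rewrite (RintegralZl G measurableT i3).
by rewrite gauss_fourier1// dotp_cons /G [(_ + _) / (4 * s)]mulrDl opprD expRD [_ ^+ n.+1]exprS -expr2; ring.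
Qed.

End gauss_rV.
End rV_integral.

(** * Subordination *)

Section binomial_series.
Context {R : realType}.
Variable mu : R.
Hypotheses (mu0 : 0 < mu) (mu1 : mu <= 1).

Ltac mulra := move: (mu0) (mu1); lra.

(* (1 - z)^mu = 1 - sum_k bcoef k * z^(k+1) *)
Fixpoint bcoef (k : nat) : R :=
  if k is j.+1 then bcoef j * (j.+1%:R - mu) / j.+2%:R else mu.

Definition bpoly n (z : R) := \sum_(k < n) bcoef k * z ^+ k.+1.

Lemma bcoef_ge0 k : 0 <= bcoef k.
Proof.
elim: k => [|k IH] /=; first exact: ltW.
rewrite divr_ge0// mulr_ge0// subr_ge0 (@le_trans _ _ 1)//.
by rewrite ler1n.
Qed.

Lemma bcoefS k : k.+2%:R * bcoef k.+1 = bcoef k * (k.+1%:R - mu).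
Proof. by rewrite /= mulrC mulfVK// pnatr_eq0. Qed.

(** The product does not increase with [k]: by [bcoefS] the next one has the factor [k.+1%:R - mu]
    in place of [k.+1%:R]. *)
Lemma bcoef_le k : k.+1%:R * bcoef k <= mu.
Proof.
elim: k => [|k IH]; first by rewrite mul1r.
rewrite bcoefS (le_trans _ IH)// mulrC ler_wpM2r ?bcoef_ge0//.
by rewrite gerBl; mulra.
Qed.

Lemma bpolyS n z : bpoly n.+1 z = bpoly n z + bcoef n * z ^+ n.+1.
Proof. by rewrite /bpoly big_ord_recr. Qed.

Definition bpoly' n (z : R) := \sum_(k < n) bcoef k * (k.+1%:R * z ^+ k).

(** The function 1 - (1 - z)^mu satisfies this equation without the last term; truncating its series
    leaves a single monomial. *)
Lemma bpoly_ode n z : (1 - z) * bpoly' n z =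
  mu * (1 - bpoly n z) - n.+1%:R * bcoef n * z ^+ n.
Proof.
elim: n => [|n IH]; first by rewrite /bpoly' /bpoly !big_ord0 /= expr0; ring.
rewrite bpolyS /bpoly' big_ord_recr /= -/(bpoly' n z) mulrDr IH -/(bcoef n.+1) bcoefS exprS.
rewrite -[n.+1%:R]natr1; ring.
Qed.

Lemma is_derive_bpoly n (z : R) : is_derive z (1 : R) (bpoly n) (bpoly' n z).
Proof.
elim: n => [|n IH].
  rewrite /bpoly' big_ord0 (_ : bpoly 0 = cst 0); first exact: is_derive_cst.
  by apply/funext => y; rewrite /bpoly big_ord0.
rewrite /bpoly' big_ord_recr /=.
have -> : bpoly n.+1 = (bpoly n + (bcoef n *: (@id R) ^+ n.+1))%R.
  by apply/funext => y; rewrite bpolyS !fctE /GRing.scale /=.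
apply: is_deriveD.
have := is_deriveZ (bcoef n) (is_deriveX n.+1 (is_derive_id z (1 : R))).
by rewrite /GRing.scale /= mulr1.
Qed.

Lemma bpoly_mono n (y z : R) : 0 <= y -> y <= z -> bpoly n y <= bpoly n z.
Proof.
move=> y0 yz; apply: ler_sum => k _; rewrite ler_wpM2l ?bcoef_ge0//.
by apply: lerXn2r => //; rewrite nnegrE ?(le_trans y0).
Qed.

Lemma bpoly_ge0 n (z : R) : 0 <= z -> 0 <= bpoly n z.
Proof. by move=> z0; apply: sumr_ge0 => k _; rewrite mulr_ge0 ?bcoef_ge0 ?exprn_ge0. Qed.

(** Ratio of [1 - bpoly n z] to its expected limit (1 - z)^mu; only the monomial of [bpoly_ode]
    remains in its derivative. *)
Let h n (z : R) := (1 - bpoly n z) * (1 - z) `^ (- mu).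

Let dh n (z : R) : z < 1 -> is_derive z (1 : R) (h n)
  ((1 - z) `^ (- mu - 1) * (n.+1%:R * bcoef n * z ^+ n)).
Proof.
move=> z1; have z0 : 0 < 1 - z by mulra.
have d0 : is_derive z (1 : R) (fun y : R => 1 - y) (- 1).
  have := is_deriveB (is_derive_cst (1 : R) z (1 : R)) (is_derive_id z (1 : R)).
  by rewrite sub0r.
have d1 := @is_derive1_comp _ (fun y => y `^ (- mu)) (fun y => 1 - y) z _ _ (is_derive1_powR (- mu) z0) d0.
have d2 := is_deriveB (is_derive_cst (1 : R) z (1 : R)) (is_derive_bpoly n z).
have := is_deriveM d2 d1; rewrite /GRing.scale/= => d3.
apply: (is_derive_eq d3).
have e : (1 - z) `^ (- mu) = (1 - z) `^ (- mu - 1) * (1 - z).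
  rewrite -[X in _ * X]powRr1 ?(ltW z0)// -powRD; first by rewrite subrK.
  by rewrite (gt_eqF z0) implybT.
rewrite e.
have -> : n.+1%:R * bcoef n * z ^+ n =
  mu * (1 - bpoly n z) - (1 - z) * bpoly' n z by rewrite bpoly_ode; ring.
rewrite !fctE; ring.
Qed.

(** Mean value theorem for [h n] on [0, z], starting from [h n 0 = 1]: the sign of the derivative
    gives the first inequality, its size the second. *)
Lemma bpoly_bounds n (z : R) : 0 <= z < 1 ->
  bpoly n z <= 1 - (1 - z) `^ mu <= bpoly n z + mu * z ^+ n.+1 / (1 - z).
Proof.
move=> /andP[]; rewrite le_eqVlt => /predU1P[<- _|z0 z1].
  rewrite subr0 powR1 subrr exprS !mul0r mulr0 mul0r addr0.
  suff -> : bpoly n 0 = 0 by rewrite lexx.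
  by apply: big1 => k _; rewrite exprS mul0r mulr0.
have z1' : 0 < 1 - z by mulra.
have [||c] := @MVT _ (h n) (fun z => (1 - z) `^ (- mu - 1) * (n.+1%:R * bcoef n * z ^+ n)) 0 z z0.
- by move=> x; rewrite in_itv/= => /andP[_ xz]; apply: dh; mulra.
- apply: derivable_within_continuous => x; rewrite in_itv/= => /andP[_ xz].
  by have [] // := @dh n x; mulra.
rewrite in_itv/= => /andP[c0 cz]; rewrite subr0.
have -> : h n 0 = 1.
  rewrite /h subr0 powR1 mulr1.
  by rewrite /bpoly big1 ?subr0// => k _; rewrite exprS mul0r mulr0.
move=> hE.
have c1' : 0 < 1 - c by mulra.
set D := (1 - c) `^ (- mu - 1) * _ in hE.
have D0 : 0 <= D.
  by rewrite /D !mulr_ge0 ?powR_ge0 ?bcoef_ge0 ?exprn_ge0// ltW.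
have P0 : 0 <= (1 - z) `^ mu by exact: powR_ge0.
have hz : 1 - bpoly n z = h n z * (1 - z) `^ mu.
  by rewrite /h -mulrA powRN mulVf ?mulr1// gt_eqF// powR_gt0.
have hz' : h n z = 1 + D * z by mulra.
rewrite hz' mulrDl mul1r in hz.
have Dz : 0 <= D * z * (1 - z) `^ mu.
  by apply: mulr_ge0 => //; apply: mulr_ge0 => //; exact: ltW.
have : D * z * (1 - z) `^ mu <= mu * z ^+ n.+1 / (1 - z); last by mulra.
(* The mean value point [c] is below [z], which bounds each factor of [D]. *)
have DD : D <= ((1 - z) `^ mu)^-1 / (1 - z) * (mu * z ^+ n).
  apply: ler_pM.
  - exact: powR_ge0.
  - by rewrite !mulr_ge0 ?bcoef_ge0 ?exprn_ge0// ltW.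
  - rewrite -opprD powRN -invfM lef_pV2 ?posrE ?mulr_gt0 ?powR_gt0//.
    rewrite -[X in _ * X <= _]powRr1 ?(ltW z1')// -powRD; last by rewrite (gt_eqF z1') implybT.
    by apply: ge0_ler_powR; rewrite ?nnegrE; mulra.
  - apply: ler_pM; rewrite ?bcoef_le ?exprn_ge0 ?mulr_ge0 ?bcoef_ge0 ?(ltW c0)//.
    by apply: lerXn2r; rewrite ?nnegrE; mulra.
apply: le_trans (_ : ((1 - z) `^ mu)^-1 / (1 - z) * (mu * z ^+ n) * z * (1 - z) `^ mu <= _).
  by rewrite ler_wpM2r// ler_wpM2r// ltW.
rewrite le_eqVlt; apply/orP; left; apply/eqP; rewrite exprS; field.
by rewrite ?gt_eqF// powR_gt0.
Qed.

Let A (z : R) := 1 - (1 - z) `^ mu.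

Let A1 : A 1 = 1.
Proof. by rewrite /A subrr powR0 ?subr0// gt_eqF//; mulra. Qed.

(** The bound for [z < 1] passes to the endpoint, where [h] is singular, by continuity of the
    polynomial. *)
Lemma bpoly1_le1 n : bpoly n 1 <= 1.
Proof.
have c : {for 1, continuous (bpoly n)}.
  apply: differentiable_continuous; apply/derivable1_diffP.
  by have [] := is_derive_bpoly n 1.
have : (bpoly n \o (fun k => 1 - harmonic k)) @ \oo --> bpoly n 1.
  apply: continuous_cvg => //; rewrite -[X in _ --> X]subr0.
  by apply: cvgB; [exact: cvg_cst|exact: cvg_harmonic].
move/cvg_lim => <- //; apply: limr_le.
  apply/cvg_ex; exists (bpoly n 1); apply: continuous_cvg => //; rewrite -[X in _ --> X]subr0.
  by apply: cvgB; [exact: cvg_cst|exact: cvg_harmonic].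
apply: nearW => k /=.
have hk : 0 < harmonic k :> R by rewrite /harmonic /= invr_gt0.
have hk1 : harmonic k <= 1 :> R by rewrite /harmonic /= invf_le1// ler1n.
have /andP[le _] := @bpoly_bounds n (1 - harmonic k) ltac:(mulra).
by apply: le_trans le _; rewrite gerBl powR_ge0.
Qed.

Lemma bpoly_cvg (z : R) : 0 <= z < 1 -> bpoly n z @[n --> \oo] --> 1 - (1 - z) `^ mu.
Proof.
move=> z01; apply: (@squeeze_cvgr _ _ _ _
  (fun n => 1 - (1 - z) `^ mu - mu * z ^+ n.+1 / (1 - z)) (fun=> 1 - (1 - z) `^ mu)).
- by apply: nearW => n; have := bpoly_bounds n z01; mulra.
- rewrite -[X in _ --> X]subr0; apply: cvgB; first exact: cvg_cst.
  rewrite -[X in _ --> X](mul0r (1 - z)^-1); apply: cvgM; last exact: cvg_cst.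
  rewrite -[X in _ --> X](mulr0 mu); apply: cvgM; first exact: cvg_cst.
  rewrite (_ : (fun n => z ^+ n.+1) = (fun n => z ^+ (n + 1)%N)); last by apply/funext => n; rewrite addn1.
  by rewrite (cvg_shiftn 1 (fun n => z ^+ n)); apply: cvg_expr; rewrite ger0_norm; mulra.
- exact: cvg_cst.
Qed.

Lemma bpoly1_near (e : R) : 0 < e -> exists n, 1 - bpoly n 1 <= e.
Proof.
(* Solves (1 - z)^mu = e / 2, unless the solution is negative. The other half of [e] pays for the
   truncation at this [z], and [bpoly n] is monotone up to 1. *)
move=> e0; pose z : R := Num.max 0 (1 - (e / 2) `^ mu^-1).
have z0 : 0 <= z by rewrite le_max lexx.
have pe : 0 < (e / 2) `^ mu^-1 by rewrite powR_gt0// divr_gt0.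
have z1 : z < 1 by rewrite gt_max ltr01/=; mulra.
have ze : (1 - z) `^ mu <= e / 2.
  have -> : e / 2 = ((e / 2) `^ mu^-1) `^ mu.
    by rewrite -powRrM mulVf ?gt_eqF// powRr1// divr_ge0// ltW.
  apply: ge0_ler_powR; rewrite ?nnegrE; try mulra.
  have : 1 - (e / 2) `^ mu^-1 <= z by rewrite le_max lexx orbT.
  mulra.
have z01 : 0 <= z < 1 by rewrite z0.
have /cvgrPdist_le/(_ (e / 2)) := bpoly_cvg z01.
rewrite divr_gt0// => /(_ isT)[n _ /(_ n (leqnn n))] /= h'.
exists n; have := bpoly_mono n z0 (ltW z1).
have := ler_norm (1 - (1 - z) `^ mu - bpoly n z); mulra.
Qed.

(** The truncation error is a power series with nonnegative coefficients, hence largest at 1, where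
    the whole sum is at most 1. Longer partial sums stand for the series. *)
Lemma bpoly_unif n (z : R) : 0 <= z <= 1 ->
  `|1 - (1 - z) `^ mu - bpoly n z| <= 1 - bpoly n 1.
Proof.
move=> /andP[z0]; rewrite le_eqVlt => /predU1P[->|z1].
  by have := A1; rewrite /A => ->; rewrite ger0_norm// subr_ge0 bpoly1_le1.
have z01 : 0 <= z < 1 by rewrite z0.
have /andP[h1 _] := bpoly_bounds n z01.
rewrite ger0_norm ?subr_ge0// lerBlDr.
have cv := bpoly_cvg z01; rewrite -(cvg_lim _ cv)//.
apply: limr_le; first by apply/cvg_ex; eexists; exact: cv.
near=> m; have nm : (n <= m)%N by near: m; exact: nbhs_infty_ge.
have {}h1 := bpoly1_le1 m.
suff : bpoly m z - bpoly n z <= bpoly m 1 - bpoly n 1 by mulra.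
rewrite -(subnKC nm); elim: (m - n)%N => [|k IH]; first by rewrite addn0 !subrr.
rewrite addnS !bpolyS expr1n.
have : bcoef (n + k) * z ^+ (n + k).+1 <= bcoef (n + k) * 1.
  by rewrite ler_wpM2l ?bcoef_ge0// exprn_ile1// ltW.
mulra.
Unshelve. all: by end_near. Qed.

End binomial_series.

(** * Nonnegative sums of exponentials *)

Section exponential_sums.
Context {R : realType}.
Implicit Types (l : seq (R * R)) (phi psi : R -> R).

Definition expsum l (x : R) := \sum_(p <- l) p.1 * expR (- (p.2 * x)).

Definition nneg2 (p : R * R) := (0 <= p.1) && (0 <= p.2).

(** At [dotp xi xi] such a function is a nonnegative combination of Gaussian symbols. Closure under
    sums and products brings in the polynomials in e^(-hx) with nonnegative coefficients. *)
Definition is_expsum phi := exists2 l, all nneg2 l & phi =1 expsum l.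

Lemma is_expsumD phi psi : is_expsum phi -> is_expsum psi ->
  is_expsum (fun x => phi x + psi x).
Proof.
move=> [l nl el] [k nk ek]; exists (l ++ k); first by rewrite all_cat nl.
by move=> x; rewrite el ek /expsum big_cat.
Qed.

Lemma is_expsum_exp (a s : R) : 0 <= a -> 0 <= s -> is_expsum (fun x => a * expR (- (s * x))).
Proof.
move=> a0 s0; exists [:: (a, s)]; first by rewrite /= /nneg2 /= a0 s0.
by move=> x; rewrite /expsum big_seq1.
Qed.

Lemma is_expsum_cst (a : R) : 0 <= a -> is_expsum (fun=> a).
Proof.
move=> a0; have [l nl el] := is_expsum_exp a0 (lexx 0).
by exists l => // x; rewrite -el mul0r oppr0 expR0 mulr1.
Qed.

Lemma is_expsumM phi psi : is_expsum phi -> is_expsum psi ->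
  is_expsum (fun x => phi x * psi x).
Proof.
move=> [l nl el] [k nk ek]; exists [seq (p.1 * q.1, p.2 + q.2) | p <- l, q <- k].
  apply/allP => _ /allpairsP[[p q] /= [pl qk ->]].
  have /andP[p1 p2] := allP nl _ pl; have /andP[q1 q2] := allP nk _ qk.
  by rewrite /nneg2 /= mulr_ge0 ?addr_ge0.
move=> x; rewrite el ek /expsum big_allpairs_dep big_distrl; apply: eq_bigr => p _.
rewrite big_distrr; apply: eq_bigr => q _ /=.
by rewrite mulrDl opprD expRD; ring.
Qed.

Lemma is_expsumX phi n : is_expsum phi -> is_expsum (fun x => phi x ^+ n).
Proof.
move=> h; elim: n => [|n IH]; first by under eq_fun do rewrite expr0; exact: is_expsum_cst.
by under eq_fun do rewrite exprS; exact: is_expsumM.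
Qed.

Lemma is_expsum_sum (F : nat -> R -> R) n : (forall k, is_expsum (F k)) ->
  is_expsum (fun x => \sum_(k < n) F k x).
Proof.
move=> h; elim: n => [|n IH]; first by under eq_fun do rewrite big_ord0; exact: is_expsum_cst.
by under eq_fun do rewrite big_ord_recr; exact: is_expsumD.
Qed.

End exponential_sums.

(** * Approximation of exp(-t x^mu) by exponential sums *)

Section stable_approximation.
Context {R : realType}.

Lemma expRN_lip (x y : R) : 0 <= x -> 0 <= y -> `|expR (- x) - expR (- y)| <= `|x - y|.
Proof.
wlog xy : x y / x <= y => [h|] x0 y0.
  have [xy|/ltW xy] := leP x y; first exact: h.
  by rewrite distrC [leRHS]distrC h.
have e : expR (- y) = expR (- x) * expR (x - y) by rewrite -expRD; congr expR; ring.
have h1 : 1 + (x - y) <= expR (x - y) by exact: expR_ge1Dx.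
have h2 : expR (x - y) <= 1 by rewrite -expR0 ler_expR; lra.
have h3 : expR (- x) <= 1 by rewrite -expR0 ler_expR; lra.
have h4 := expR_ge0 (- x).
rewrite e ger0_norm; last by nra.
by rewrite ler0_norm; nra.
Qed.

Lemma expr_lip (a b : R) n : 0 <= a <= 1 -> 0 <= b <= 1 -> `|a ^+ n - b ^+ n| <= n%:R * `|a - b|.
Proof.
move=> /andP[a0 a1] /andP[b0 b1]; elim: n => [|n IH]; first by rewrite !expr0 subrr normr0 mul0r.
have -> : a ^+ n.+1 - b ^+ n.+1 = a * (a ^+ n - b ^+ n) + (a - b) * b ^+ n by rewrite !exprS; ring.
apply: le_trans (ler_normD _ _) _; rewrite -natr1 [leRHS]mulrDl mul1r lerD//.
  by rewrite normrM (le_trans _ IH)// ler_piMl// ger0_norm.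
by rewrite normrM ler_piMr// ger0_norm ?exprn_ge0// exprn_ile1.
Qed.

(** Write e^(-y) as the power n+1 of e^(-u), u = y / (n+1). The bases differ by at most u^2, and the
    power is Lipschitz on [0, 1] with constant n+1. *)
Lemma exp_compound (A y : R) n : 0 <= y -> y <= A -> A <= n.+1%:R ->
  `|(1 - y / n.+1%:R) ^+ n.+1 - expR (- y)| <= A ^+ 2 / n.+1%:R.
Proof.
move=> y0 yA An; have n0 : 0 < n.+1%:R :> R by rewrite ltr0n.
pose u := y / n.+1%:R.
have u0 : 0 <= u by rewrite divr_ge0// ltW.
have u1 : u <= 1 by rewrite ler_pdivrMr// mul1r; lra.
have -> : expR (- y) = expR (- u) ^+ n.+1.
  by rewrite -expRM_natl; congr expR; rewrite /u; field; rewrite gt_eqF.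
have e0 : 0 <= expR (- u) <= 1.
  by rewrite expR_ge0/= -[X in _ <= X]expR0 ler_expR; lra.
have := @expr_lip (1 - u) (expR (- u)) n.+1 _ e0.
move=> /(_ ltac:(lra))/le_trans; apply.
have h1 : 1 - u <= expR (- u) by exact: expR_ge1Dx.
(* From e^(-u) <= 1 / (1 + u). *)
have h2 : expR (- u) <= 1 - u + u ^+ 2.
  have h3 : 1 + u <= expR u by exact: expR_ge1Dx.
  have h4 : expR (- u) * expR u = 1 by rewrite -expRD addNr expR0.
  have h5 := expR_ge0 (- u).
  nra.
rewrite ler0_norm; last by lra.
apply: le_trans (_ : n.+1%:R * u ^+ 2 <= _); first by rewrite ler_wpM2l ?(ltW n0)//; lra.
have -> : n.+1%:R * u ^+ 2 = y ^+ 2 / n.+1%:R by rewrite /u; field; rewrite gt_eqF.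
by rewrite ler_wpM2r ?invr_ge0 ?(ltW n0)//; apply: lerXn2r; rewrite ?nnegrE; lra.
Qed.

Lemma diffq_bounds (h x : R) : 0 < h -> 0 <= x ->
  x - h * x ^+ 2 <= (1 - expR (- (h * x))) / h <= x.
Proof.
move=> h0 x0; have hx : 0 <= h * x by rewrite mulr_ge0// ltW.
have h1 : 1 - h * x <= expR (- (h * x)) by exact: expR_ge1Dx.
have h2 : 1 + h * x <= expR (h * x) by exact: expR_ge1Dx.
have h3 : expR (- (h * x)) * expR (h * x) = 1 by rewrite -expRD addNr expR0.
have h5 := expR_ge0 (- (h * x)).
have h6 : expR (- (h * x)) <= 1 - h * x + (h * x) ^+ 2 by nra.
rewrite ler_pdivlMr// ler_pdivrMr//; apply/andP; split; last by rewrite [x * h]mulrC; lra.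
have -> : (x - h * x ^+ 2) * h = h * x - (h * x) ^+ 2 by ring.
by lra.
Qed.

Variables (mu t : R).
Hypotheses (mu0 : 0 < mu) (mu1 : mu <= 1) (t0 : 0 < t).

(* With z = e^(-hx), ((1 - z)/h)^mu = h^(-mu) (1 - sum_k bcoef k * z^(k+1));
   truncate the series and replace e^(-y) by (1 - y/(n+1))^(n+1), which is a
   polynomial in z with nonnegative coefficients. *)
Let approx1 (h e : R) : 0 < h -> 0 < e -> exists phi : R -> R,
  [/\ is_expsum phi, forall x, 0 <= x -> 0 <= phi x <= 1 &
  forall x, 0 <= x -> `|phi x - expR (- (t * ((1 - expR (- (h * x))) / h) `^ mu))| <= e].
Proof.
move=> h0 e0; pose A := t * h^-1 `^ mu.
have A0 : 0 < A by rewrite mulr_gt0// powR_gt0// invr_gt0.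
have [l hl] := @bpoly1_near _ _ mu0 mu1 (e / 2 / A) (divr_gt0 (divr_gt0 e0 (ltr0n _ 2)) A0).
(* Two demands on n+1: at least [A], so that the base below lies in [0, 1], and at least A^2 / (e /
   2), to make the error of [exp_compound] at most e / 2. *)
pose B := A + A ^+ 2 / (e / 2).
have [n hn] : exists n, B <= n.+1%:R.
  exists (Num.bound B); apply: ltW; apply: lt_le_trans (_ : (Num.bound B)%:R <= _).
    by apply: archi_boundP; rewrite addr_ge0 ?divr_ge0 ?sqr_ge0// ltW// divr_gt0.
  by rewrite ler_nat.
have n0 : 0 < n.+1%:R :> R by rewrite ltr0n.
have e2 : 0 < e / 2 by rewrite divr_gt0.
have An : A <= n.+1%:R.
  by apply: le_trans hn; rewrite /B lerDl divr_ge0 ?sqr_ge0// ltW.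
pose P x := bpoly mu l (expR (- (h * x))).
have z01 x : 0 <= x -> 0 <= expR (- (h * x)) <= 1.
  by move=> x0; rewrite expR_ge0 -expR0 ler_expR oppr_le0 mulr_ge0// ltW.
have P01 x : 0 <= x -> 0 <= P x <= 1.
  move=> x0; have /andP[h1 h2] := z01 x x0; rewrite bpoly_ge0//=.
  by apply: le_trans (bpoly1_le1 mu0 mu1 l); exact: bpoly_mono.
(* This is (1 - y / (n+1))^(n+1) with y = A (1 - P x), ordered so that the coefficients of [P x] are
   visibly nonnegative. *)
exists (fun x => (1 - A / n.+1%:R + A / n.+1%:R * P x) ^+ n.+1).
have An0 : 0 <= A / n.+1%:R by rewrite divr_ge0// ltW.
have An1 : A / n.+1%:R <= 1 by rewrite ler_pdivrMr// mul1r.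
split.
- apply/is_expsumX/is_expsumD; first by apply: is_expsum_cst; rewrite subr_ge0.
  apply: is_expsumM; first exact: is_expsum_cst.
  apply: (is_expsum_sum (F := fun k x => bcoef mu k * expR (- (h * x)) ^+ k.+1)) => k.
  apply: is_expsumM; first by apply: is_expsum_cst; exact: bcoef_ge0.
  apply/is_expsumX; have [j nj ej] := is_expsum_exp ler01 (ltW h0).
  by exists j => // x; rewrite -ej mul1r.
- move=> x x0; have /andP[p0 p1] := P01 x x0.
  have c0 : 0 <= A / n.+1%:R * P x by rewrite mulr_ge0.
  have c1 : A / n.+1%:R * P x <= A / n.+1%:R by rewrite ler_piMr.
  move: (A / n.+1%:R) (P x) An0 An1 c0 c1 => k p k0 k1 kp0 kp1.
  by apply/andP; split; [apply: exprn_ge0|apply: exprn_ile1]; lra.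
move=> x x0; have /andP[p0 p1] := P01 x x0; have /andP[z0 z1] := z01 x x0.
set w := expR (- (h * x)) in z0 z1 *.
have wmu : t * ((1 - w) / h) `^ mu = A * (1 - w) `^ mu.
  by rewrite powRM ?subr_ge0// ?invr_ge0 ?(ltW h0)// /A; ring.
have -> : 1 - A / n.+1%:R + A / n.+1%:R * P x = 1 - (A * (1 - P x)) / n.+1%:R by ring.
have y0 : 0 <= A * (1 - P x) by rewrite mulr_ge0 ?(ltW A0)// subr_ge0.
have yA : A * (1 - P x) <= A by rewrite ler_piMr ?(ltW A0)//; lra.
have c1 := exp_compound y0 yA An.
have c2 : A ^+ 2 / n.+1%:R <= e / 2.
  rewrite ler_pdivrMr// mulrC -ler_pdivrMr//; apply: le_trans hn.
  by rewrite /B lerDr ltW.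
have c3 := expRN_lip y0 (mulr_ge0 (ltW A0) (powR_ge0 (1 - w) mu)).
have c4 := @bpoly_unif _ _ mu0 mu1 l w ltac:(by rewrite z0).
rewrite wmu.
have c5 : `|A * (1 - P x) - A * (1 - w) `^ mu| <= e / 2.
  rewrite -mulrBr normrM (gtr0_norm A0) mulrC -ler_pdivlMr//.
  apply: le_trans (le_trans c4 hl); rewrite /P -/w.
  by rewrite (_ : 1 - _ - _ = 1 - (1 - w) `^ mu - bpoly mu l w); last ring.
have -> : e = e / 2 + e / 2 by lra.
apply: le_trans (ler_distD (expR (- (A * (1 - P x)))) _ _) _.
by apply: lerD; [exact: le_trans c1 c2|exact: le_trans c3 c5].
Qed.

Let diffq (x : R) : 0 <= x ->
  (fun m => (1 - expR (- (harmonic m * x))) / harmonic m) @ \oo --> x.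
Proof.
move=> x0; apply: (@squeeze_cvgr _ _ _ _ (fun m => x - harmonic m * x ^+ 2) (fun=> x)).
- by apply: nearW => m; apply: diffq_bounds => //; rewrite /harmonic /= invr_gt0.
- rewrite -[X in _ --> X]subr0; apply: cvgB; first exact: cvg_cst.
  rewrite -[X in _ --> X](mul0r (x ^+ 2)); apply: cvgM; last exact: cvg_cst.
  exact: cvg_harmonic.
- exact: cvg_cst.
Qed.

(** Step size and tolerance tend to 0 together, both being [harmonic m]. The bound by 1 provides the
    domination when the limit is taken under Fourier integrals. *)
Lemma stable_expsum_approx : exists Q : nat -> R -> R,
  [/\ forall m, is_expsum (Q m), forall m x, 0 <= x -> 0 <= Q m x <= 1 &
  forall x, 0 <= x -> Q m x @[m --> \oo] --> expR (- (t * x `^ mu))].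
Proof.
have hm0 (m : nat) : 0 < harmonic m :> R by rewrite /harmonic /= invr_gt0.
have /choice[Q hQ] : forall m, exists phi : R -> R,
  [/\ is_expsum phi, forall x, 0 <= x -> 0 <= phi x <= 1 &
  forall x, 0 <= x -> `|phi x - expR (- (t * ((1 - expR (- (harmonic m * x))) / harmonic m) `^ mu))| <= harmonic m].
  by move=> m; exact: approx1.
exists Q; split => [m|m x x0|x x0]; [by case: (hQ m)|by case: (hQ m) => _ + _; exact|].
pose q m := expR (- (t * ((1 - expR (- (harmonic m * x))) / harmonic m) `^ mu)).
have Qq : (Q m x - q m) @[m --> \oo] --> 0.
  apply: (@squeeze_cvgr _ _ _ _ (fun m => - harmonic m) harmonic).
  - by apply: nearW => m; rewrite -ler_norml; case: (hQ m) => _ _; exact.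
  - by rewrite -[X in _ --> X]oppr0; apply: cvgN; exact: cvg_harmonic.
  - exact: cvg_harmonic.
suff qq : q m @[m --> \oo] --> expR (- (t * x `^ mu)).
  rewrite -[X in _ --> X]add0r.
  by rewrite (_ : (fun m => Q m x) = (fun m => (Q m x - q m) + q m)); [exact: cvgD|apply/funext => m; rewrite subrK].
(* Continuity of [powR] is taken from its derivative at positive points; at 0 the sequence is
   constant. *)
move: x0; rewrite le_eqVlt => /predU1P[x0|x0].
  rewrite (_ : q = fun=> expR (- (t * x `^ mu))); first exact: cvg_cst.
  by apply/funext => m; rewrite /q -x0 mulr0 oppr0 expR0 subrr mul0r.
rewrite /q; apply: continuous_cvg; first exact: continuous_expR.
apply: cvgN; apply: cvgM; first exact: cvg_cst.
apply: (@cvg_comp _ _ _ (fun m => (1 - expR (- (harmonic m * x))) / harmonic m)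
  (fun y => y `^ mu)); first exact/diffq/ltW.
suff : {for x, continuous (fun y => y `^ mu)} by [].
apply: differentiable_continuous; apply/derivable1_diffP.
by have [] := is_derive1_powR mu x0.
Qed.

End stable_approximation.

(** * The kernel of the fractional heat semigroup *)

Section stable_symbol.
Context {R : realType}.
Local Notation leb := (@lebesgue_measure R).

(** With y = (a^2)^mu and an integer m >= 1/mu one has a^2 <= 1 + y^m, and y^m <= (m/c)^m e^(cy)
    because e^u >= u at u = cy/m. *)
Lemma powR_expR_bound (mu c : R) : 0 < mu -> 0 < c ->
  exists2 C, 0 <= C & forall a : R, expR (- (c * (a ^+ 2) `^ mu)) <= C * (oneDsqr a)^-1.
Proof.
move=> mu0 c0; pose m := (Num.bound mu^-1).+1.
have mm : mu^-1 <= m%:R.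
  apply: ltW; apply: lt_le_trans (archi_boundP _) _; first by rewrite invr_ge0 ltW.
  by rewrite ler_nat.
have m0 : 0 < m%:R :> R by rewrite ltr0n.
exists (2 + (m%:R / c) ^+ m).
  by rewrite addr_ge0// exprn_ge0// divr_ge0// ltW.
move=> a; rewrite ler_pdivlMr; last by rewrite (lt_le_trans ltr01)// oneDsqr_ge1.
rewrite mulrC expRN ler_pdivrMr ?expR_gt0//.
set y := (a ^+ 2) `^ mu; have y0 : 0 <= y by exact: powR_ge0.
have cy0 : 0 <= c * y by rewrite mulr_ge0// ltW.
have a2 : a ^+ 2 <= 1 + y ^+ m.
  have [h|h] := leP (a ^+ 2) 1; first by rewrite ler_wpDr// exprn_ge0.
  rewrite ler_wpDl// -[_ ^+ m]powR_mulrn// /y -powRrM -[leLHS]powRr1 ?sqr_ge0//.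
  by apply: ler_powR; [exact: ltW|rewrite mulrC -ler_pdivrMr// div1r].
have yE : y ^+ m <= (m%:R / c) ^+ m * expR (c * y).
  have -> : y = (m%:R / c) * (c * y / m%:R) by field; rewrite !gt_eqF.
  rewrite exprMn; apply: ler_pM.
  - by rewrite exprn_ge0// divr_ge0// ltW.
  - by rewrite exprn_ge0// divr_ge0// ltW.
  - by [].
  have -> : c * (m%:R / c * (c * y / m%:R)) = m%:R * (c * y / m%:R) by field; rewrite !gt_eqF.
  rewrite expRM_natl; apply: lerXn2r; rewrite ?nnegrE ?expR_ge0 ?divr_ge0 ?(ltW m0)//.
  by apply: le_trans (expR_ge1Dx _); rewrite lerDr.
have e1 : 1 <= expR (c * y) by rewrite -expR0 ler_expR.
rewrite /oneDsqr mulrDl; lra.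
Qed.

Lemma integ_oneDsqrV : integ leb (fun a : R => (oneDsqr a)^-1).
Proof.
have m1 : measurable_fun [set: R] (fun a : R => (oneDsqr a)^-1).
  exact: (continuous_measurable_fun continuous_oneDsqrV).
have h0 (a : R) : 0 <= (oneDsqr a)^-1.
  by rewrite invr_ge0 (le_trans ler01)// oneDsqr_ge1.
apply: (@integP _ _ _ leb _ m1 h0).2.
rewrite ge0_symfun_integralT//; last 2 first.
- exact: continuous_oneDsqrV.
- by move=> a /=; rewrite /oneDsqr sqrrN.
rewrite (_ : [set x | _] = `[0, +oo[%classic); last first.
  by apply/seteqP; split => x/=; rewrite in_itv/= andbT.
by rewrite integral0y_oneDsqr -EFinM ltry.
Qed.

Lemma integ_expN_powR (mu c : R) : 0 < mu -> 0 < c ->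
  integ leb (fun a : R => expR (- (c * (a ^+ 2) `^ mu))).
Proof.
move=> mu0 c0; have [C C0 hC] := powR_expR_bound mu0 c0.
have mf : measurable_fun [set: R] (fun a : R => expR (- (c * (a ^+ 2) `^ mu))).
  apply: measurableT_comp => //; apply: measurableT_comp => //; apply: measurable_funM => //.
  apply: (measurableT_comp (measurable_powR mu)); exact: measurable_funX.
have hC' (a : R) : `|expR (- (c * (a ^+ 2) `^ mu))| <= C * (oneDsqr a)^-1.
  by rewrite ger0_norm ?expR_ge0.
apply (@integ_le _ _ _ leb (fun a : R => C * (oneDsqr a)^-1)) => //.
exact: (integZl C integ_oneDsqrV).
Qed.

Variables (mu : R) (n : nat).
Hypotheses (mu0 : 0 < mu) (mu1 : mu <= 1).

Definition stable_symbol (t : R) (xi : 'rV[R]_n) := expR (- (t * dotp xi xi `^ mu)).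

Lemma measurable_stable_symbol t : measurable_fun setT (stable_symbol t).
Proof.
apply: measurableT_comp => //; apply: measurableT_comp => //; apply: measurable_funM => //.
by apply: (measurableT_comp (measurable_powR mu)); exact: measurable_sqdotp.
Qed.

(** Since |xi| dominates each |xi_i|, t |xi|^(2 mu) is at least t/(n+1) times the sum of the
    |xi_i|^(2 mu), so a tensor product dominates. The divisor n+1 is safe in dimension 0. *)
Lemma integ_stable_symbol t : 0 < t -> integ (lebesgue_rV n) (stable_symbol t).
Proof.
move=> t0; have c0 : 0 < t / n.+1%:R by rewrite divr_gt0.
apply: (integ_le (measurable_stable_symbol t)) (integ_rV_prod n _ (integ_expN_powR mu0 c0)).
  move=> xi; rewrite ger0_norm ?expR_ge0// -expR_sum ler_expR sumrN lerN2 -mulr_sumr.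
  rewrite -mulrA ler_pM2l// ler_pdivrMl//.
  apply: le_trans (_ : n%:R * dotp xi xi `^ mu <= _); last first.
    by rewrite ler_wpM2r ?powR_ge0// ler_nat.
  rewrite -[X in _ <= X%:R * _]card_ord -sumr_const mulr_suml; apply: ler_sum => i _.
  rewrite mul1r; apply: ge0_ler_powR; rewrite ?nnegrE ?sqr_ge0 ?dotp_ge0//; first exact: ltW.
  rewrite /dotp (bigD1 i)//= expr2 lerDl; apply: sumr_ge0 => j _.
  by rewrite -expr2 sqr_ge0.
by move=> a; exact: expR_ge0.
Qed.

End stable_symbol.

(** * The Gaussian kernel *)

Section gauss_kernel.
Context {R : realType} {n : nat}.

(** The heat kernel (4 pi s)^(-n/2) e^(-|x|^2 / (4s)), normalised as the Fourier integral delivers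
    it. *)
Definition gauss_kernel (s : R) (x : 'rV[R]_n) : R :=
  (2 * pi) ^- n * (Num.sqrt (pi / s) ^+ n * expR (- (dotp x x / (4 * s)))).

Lemma gauss_kernelE (s : R) (x : 'rV[R]_n) : 0 < s -> (2 * pi) ^- n *
  \int[lebesgue_rV n]_xi (expR (- (s * dotp xi xi)) * cos (dotp x xi)) = gauss_kernel s x.
Proof. by move=> s0; rewrite gauss_fourier_rV. Qed.

Let c0 : 0 < (2 * pi) ^- n :> R.
Proof. by rewrite invr_gt0 exprn_gt0// mulr_gt0// pi_gt0. Qed.

Lemma gauss_kernel_gt0 (s : R) x : 0 < s -> 0 < gauss_kernel s x.
Proof.
move=> s0; rewrite /gauss_kernel mulr_gt0// mulr_gt0 ?expR_gt0// exprn_gt0//.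
by rewrite sqrtr_gt0 divr_gt0// pi_gt0.
Qed.

Lemma gauss_kernel_integ (s : R) : 0 < s ->
  integ (lebesgue_rV n) (gauss_kernel s) /\ \int[lebesgue_rV n]_x gauss_kernel s x = 1.
Proof.
move=> s0; have s4 : 0 < (4 * s)^-1 by rewrite invr_gt0 mulr_gt0.
have ig := integ_gauss_rV s4 n.
have e x : gauss_kernel s x = (2 * pi) ^- n * Num.sqrt (pi / s) ^+ n * expR (- ((4 * s)^-1 * dotp x x)).
  by rewrite /gauss_kernel mulrA [_ / (4 * s)]mulrC.
split; first by apply: (@eq_integ _ _ _ _ _ _ (fun x => esym (e x))); exact: integZl.
under eq_Rintegral do rewrite e.
rewrite RintegralZl//.
have := gauss_fourier_rV s4 (0 : 'rV[R]_n).
under eq_Rintegral => xi _ do rewrite dotp0l cos0 mulr1.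
rewrite dotp0l mul0r oppr0 expR0 mulr1 => ->.
rewrite -exprVn -!exprMn -mulrA -sqrtrM; last by rewrite divr_ge0 ?pi_ge0// ltW.
have -> : pi / s * (pi / (4 * s)^-1) = (2 * pi) ^+ 2 :> R by field; rewrite gt_eqF.
rewrite sqrtr_sqr ger0_norm ?mulr_ge0 ?pi_ge0// mulVf ?expr1n//.
by rewrite mulf_neq0// gt_eqF// pi_gt0.
Qed.

(** Outside the ball half of the exponent is traded for 8s/rho, by e^(-u) <= 1/u; the other half is
    the exponent at time 2s. The power of sqrt 2 is the ratio of the normalisations. *)
Lemma gauss_kernel_tail (s rho : R) x : 0 < s -> 0 < rho -> rho <= dotp x x ->
  gauss_kernel s x <= Num.sqrt 2 ^+ n * (8 * s / rho) * gauss_kernel (2 * s) x.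
Proof.
move=> s0 rho0 hx; rewrite /gauss_kernel.
have -> : pi / s = 2 * (pi / (2 * s)) by field; rewrite gt_eqF.
rewrite sqrtrM// [(Num.sqrt 2 * _) ^+ n]exprMn.
have -> : dotp x x / (4 * s) = dotp x x / (4 * (2 * s)) + dotp x x / (8 * s) by field; rewrite gt_eqF.
rewrite opprD expRD.
have h : expR (- (dotp x x / (8 * s))) <= 8 * s / rho.
  have y0 : 0 < rho / (8 * s) by rewrite divr_gt0// mulr_gt0.
  have -> : 8 * s / rho = (rho / (8 * s))^-1 by rewrite invf_div.
  rewrite expRN lef_pV2 ?posrE ?expR_gt0//.
  apply: le_trans (_ : dotp x x / (8 * s) <= _); first by rewrite ler_pM2r// invr_gt0 mulr_gt0.
  by apply: le_trans (expR_ge1Dx _); rewrite lerDr.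
set a := (2 * pi) ^- n; set b := Num.sqrt 2 ^+ n; set e := expR (- (dotp x x / (4 * _))).
set q := Num.sqrt (pi / (2 * s)) ^+ n; set f := expR _ in h *.
have -> : a * (b * q * (e * f)) = (a * b * q * e) * f by ring.
have -> : b * (8 * s / rho) * (a * (q * e)) = (a * b * q * e) * (8 * s / rho) by ring.
rewrite ler_wpM2l// !mulr_ge0 ?expR_ge0 ?exprn_ge0 ?sqrtr_ge0//.
exact: ltW.
Qed.

End gauss_kernel.

(** * The stable kernel and its lower bounds inherited from Gaussians *)

Section stable_kernel.
Context {R : realType} {n : nat}.
Variable mu : R.
Hypotheses (mu0 : 0 < mu) (mu1 : mu <= 1).
Local Notation m := (lebesgue_rV n).

Definition stable_kernel (t : R) (x : 'rV[R]_n) : R :=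
  (2 * pi) ^- n * \int[m]_xi (stable_symbol mu t xi * cos (dotp x xi)).

Let c0 : 0 < (2 * pi) ^- n :> R.
Proof. by rewrite invr_gt0 exprn_gt0// mulr_gt0// pi_gt0. Qed.

Section lower_bound.
Variables (A B l1 l2 rho : R).
Hypotheses (l10 : 0 <= l1) (l20 : 0 <= l2).
Hypothesis AB : forall s (x : 'rV[R]_n), 0 < s -> dotp x x <= rho ->
  A * expR (- (l1 * s)) - B * expR (- (l2 * s)) <= gauss_kernel s x.

(** The damping [d] keeps every Gaussian time [d + p.2] positive, as a rate [p.2] may be 0. On the
    left, the weighted values of e^(-l1 s) at these times recombine into [expsum l l1]. *)
Let lower_expsum (l : seq (R * R)) (d : R) (x : 'rV[R]_n) : all nneg2 l -> 0 < d -> dotp x x <= rho ->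
  integ m (fun xi => expR (- (d * dotp xi xi)) * expsum l (dotp xi xi) * cos (dotp x xi)) /\
  A * (expR (- (l1 * d)) * expsum l l1) - B * (expR (- (l2 * d)) * expsum l l2) <=
  (2 * pi) ^- n * \int[m]_xi (expR (- (d * dotp xi xi)) * expsum l (dotp xi xi) * cos (dotp x xi)).
Proof.
move=> + d0 hx; elim: l => [_|p l IH /= /andP[/andP[p1 p2] nl]].
  split; first by apply: eq_integ (integ0 m) => xi; rewrite /expsum big_nil mulr0 mul0r.
  under eq_Rintegral => xi _ do rewrite /expsum big_nil mulr0 mul0r.
  by rewrite Rintegral_cst// /expsum !big_nil !mulr0 mul0r mulr0 subrr.
have [il hl] := IH nl.
have dp : 0 < d + p.2 by rewrite ltr_wpDr.
have ip := integZl p.1 (integ_cos_rV x (integ_gauss_rV dp n)).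
have e xi : expR (- (d * dotp xi xi)) * expsum (p :: l) (dotp xi xi) * cos (dotp x xi) =
  p.1 * (expR (- ((d + p.2) * dotp xi xi)) * cos (dotp x xi)) +
  expR (- (d * dotp xi xi)) * expsum l (dotp xi xi) * cos (dotp x xi).
  by rewrite /expsum big_cons mulrDl opprD expRD; ring.
split; first by apply: (@eq_integ _ _ _ _ _ _ (fun x => esym (e x))); exact: integD.
under eq_Rintegral do rewrite e.
rewrite RintegralD// RintegralZl//; last exact: integ_cos_rV (integ_gauss_rV dp n).
rewrite mulrDr [X in _ <= X + _]mulrCA gauss_kernelE//.
have := ler_wpM2l p1 (AB dp hx); rewrite /expsum !big_cons -!/(expsum l _).
rewrite ![_ * (d + p.2)]mulrDr !opprD !expRD ![p.2 * _]mulrC.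
move=> h; apply: le_trans (lerD h hl).
by rewrite le_eqVlt; apply/orP; left; apply/eqP; ring.
Qed.

(** The Gaussian factor dominates all approximants of the symbol at once. *)
Let lower_damped (t d : R) (x : 'rV[R]_n) : 0 < t -> 0 < d -> dotp x x <= rho ->
  A * (expR (- (l1 * d)) * expR (- (t * l1 `^ mu))) - B * (expR (- (l2 * d)) * expR (- (t * l2 `^ mu))) <=
  (2 * pi) ^- n * \int[m]_xi (expR (- (d * dotp xi xi)) * stable_symbol mu t xi * cos (dotp x xi)).
Proof.
move=> t0 d0 hx; have [Q [Qe Q01 Qcv]] := stable_expsum_approx mu0 mu1 t0.
have Qb k : integ m (fun xi => expR (- (d * dotp xi xi)) * Q k (dotp xi xi) * cos (dotp x xi)) /\
  A * (expR (- (l1 * d)) * Q k l1) - B * (expR (- (l2 * d)) * Q k l2) <=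
  (2 * pi) ^- n * \int[m]_xi (expR (- (d * dotp xi xi)) * Q k (dotp xi xi) * cos (dotp x xi)).
  have [l nl /funext ->] := Qe k; exact: lower_expsum.
have ms := measurable_stable_symbol mu t (n := n).
have [|||||_ cv] := @Rint_dominatedW _ _ _ m
  (fun k xi => expR (- (d * dotp xi xi)) * Q k (dotp xi xi) * cos (dotp x xi))
  (fun xi => expR (- (d * dotp xi xi)) * stable_symbol mu t xi * cos (dotp x xi))
  (fun xi => expR (- (d * dotp xi xi))).
- by move=> k; have [/integ_meas] := Qb k.
- apply: measurable_funM; last exact: mcos_rV.
  by apply: measurable_funM => //; exact: (integ_meas (integ_gauss_rV d0 n)).
- move=> xi; apply: cvgM; last exact: cvg_cst.
  by apply: cvgM; [exact: cvg_cst|apply: Qcv; exact: dotp_ge0].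
- exact: integ_gauss_rV.
- move=> k xi; have /andP[q0 q1] := Q01 k _ (dotp_ge0 xi).
  rewrite !normrM (ger0_norm (expR_ge0 _)) (ger0_norm q0) -mulrA ler_piMr ?expR_ge0//.
  by rewrite mulr_ile1// cos_max.
have cvl : A * (expR (- (l1 * d)) * Q k l1) - B * (expR (- (l2 * d)) * Q k l2) @[k --> \oo] -->
  A * (expR (- (l1 * d)) * expR (- (t * l1 `^ mu))) - B * (expR (- (l2 * d)) * expR (- (t * l2 `^ mu))).
  by apply: cvgB; apply: cvgM; (try exact: cvg_cst); apply: cvgM; (try exact: cvg_cst); exact: Qcv.
have cvr : (fun k => (2 * pi) ^- n * \int[m]_xi
    (expR (- (d * dotp xi xi)) * Q k (dotp xi xi) * cos (dotp x xi))) @ \oo -->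
  (2 * pi) ^- n * \int[m]_xi (expR (- (d * dotp xi xi)) * stable_symbol mu t xi * cos (dotp x xi)).
  by apply: cvgM => //; exact: cvg_cst.
by apply: (ler_cvg_to cvl cvr); apply: nearW => k; have [] := Qb k.
Qed.

(** The damping is removed along [d = harmonic k], with the integrable symbol itself as dominating
    function. *)
Lemma stable_kernel_lower (t : R) (x : 'rV[R]_n) : 0 < t -> dotp x x <= rho ->
  A * expR (- (t * l1 `^ mu)) - B * expR (- (t * l2 `^ mu)) <= stable_kernel t x.
Proof.
move=> t0 hx; have is_ := integ_stable_symbol n mu0 t0.
have hd k : 0 < harmonic k :> R by rewrite /harmonic /= invr_gt0.
have eh (y : R) : expR (- (harmonic k * y)) @[k --> \oo] --> (1 : R).
  rewrite -expR0; apply: continuous_cvg; first exact: continuous_expR.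
  rewrite -oppr0 -[X in _ --> - X](mul0r y); apply: cvgN; apply: cvgM; last exact: cvg_cst.
  exact: cvg_harmonic.
have [|||||_ cv] := @Rint_dominatedW _ _ _ m
  (fun k xi => expR (- (harmonic k * dotp xi xi)) * stable_symbol mu t xi * cos (dotp x xi))
  (fun xi => stable_symbol mu t xi * cos (dotp x xi)) (stable_symbol mu t).
- move=> k; apply: measurable_funM; last exact: mcos_rV.
  apply: measurable_funM; last exact: measurable_stable_symbol.
  exact: (integ_meas (integ_gauss_rV (hd k) n)).
- exact: (integ_meas (integ_cos_rV x is_)).
- move=> xi; apply: cvgM; last exact: cvg_cst.
  rewrite -[X in _ --> X]mul1r.
  by apply: cvgM; [exact: eh|exact: cvg_cst].
- by [].
- move=> k xi; rewrite !normrM (ger0_norm (expR_ge0 _)) (ger0_norm (expR_ge0 (- (t * _)))).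
  rewrite mulrAC ler_piMl ?expR_ge0// mulr_ile1 ?expR_ge0 ?cos_max//.
  by rewrite -expR0 ler_expR oppr_le0 mulr_ge0 ?dotp_ge0// ltW.
have cvl : A * (expR (- (l1 * harmonic k)) * expR (- (t * l1 `^ mu))) -
    B * (expR (- (l2 * harmonic k)) * expR (- (t * l2 `^ mu))) @[k --> \oo] -->
  A * expR (- (t * l1 `^ mu)) - B * expR (- (t * l2 `^ mu)).
  apply: cvgB; apply: cvgM; (try exact: cvg_cst).
    rewrite -[X in _ --> X]mul1r; apply: cvgM; last exact: cvg_cst.
    by under eq_fun do rewrite mulrC; exact: eh.
  rewrite -[X in _ --> X]mul1r; apply: cvgM; last exact: cvg_cst.
  by under eq_fun do rewrite mulrC; exact: eh.
have cvr : (fun k => (2 * pi) ^- n * \int[m]_xi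
    (expR (- (harmonic k * dotp xi xi)) * stable_symbol mu t xi * cos (dotp x xi))) @ \oo --> stable_kernel t x.
  by apply: cvgM => //; exact: cvg_cst.
by apply: (ler_cvg_to cvl cvr); apply: nearW => k; exact: lower_damped.
Qed.

End lower_bound.

(** The case A = B = 0, where the hypothesis on Gaussians is their positivity. *)
Lemma stable_kernel_ge0 (t : R) (x : 'rV[R]_n) : 0 < t -> 0 <= stable_kernel t x.
Proof.
move=> t0; have := @stable_kernel_lower 0 0 0 0 (dotp x x) (lexx 0) (lexx 0) _ t x t0 (lexx _).
rewrite !mul0r subrr; apply => s y s0 _.
by rewrite !mul0r subrr ltW// gauss_kernel_gt0.
Qed.

End stable_kernel.

(** * Strict positivity of the kernel on bounded sets *)

Section kernel_positivity.
Context {R : realType} {n : nat}.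

(** Replaces the power of [s] by an exponential, the shape that [stable_kernel_lower] transfers:
    sqrt(pi/s) >= 1/(1+s) and e^(s/(n+1)) >= (1+s)/(n+1). *)
Lemma gauss_kernel_lower (s b rho : R) (x : 'rV[R]_n) : 0 < b -> b <= s -> dotp x x <= rho ->
  (2 * pi) ^- n * expR (- (rho / (4 * b))) * n.+1%:R ^- n * expR (- s) <= gauss_kernel s x.
Proof.
move=> b0 bs hx; have s0 : 0 < s by lra.
have pi1 : 1 <= pi :> R by rewrite (le_trans _ (@pi_ge2 R))// ler1n.
rewrite /gauss_kernel -!mulrA ler_pM2l ?invr_gt0 ?exprn_gt0 ?mulr_gt0 ?pi_gt0//.
rewrite [leRHS]mulrC; apply: ler_pM; rewrite ?expR_ge0 ?mulr_ge0 ?expR_ge0 ?invr_ge0 ?exprn_ge0//.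
  rewrite ler_expR lerN2; apply: ler_pM; rewrite ?dotp_ge0 ?invr_ge0 ?mulr_ge0 ?(ltW s0)//.
  by rewrite lef_pV2 ?posrE ?mulr_gt0// ler_pM2l.
rewrite expRN ler_pdivrMr ?expR_gt0//.
apply: le_trans (_ : Num.sqrt (pi / s) ^+ n * expR (s / n.+1%:R) ^+ n <= _); last first.
  rewrite ler_wpM2l ?exprn_ge0 ?sqrtr_ge0// -expRM_natl ler_expR mulrA ler_pdivrMr//.
  by rewrite mulrC ler_wpM2l ?(ltW s0)// ler_nat.
rewrite -exprMn -exprVn; apply: lerXn2r; rewrite ?nnegrE ?invr_ge0 ?mulr_ge0 ?sqrtr_ge0 ?expR_ge0//.
have h1 : (1 + s) / n.+1%:R <= expR (s / n.+1%:R).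
  apply: le_trans (expR_ge1Dx _); rewrite mulrDl mul1r lerD2r invf_le1// ler1n.
  by [].
have h2 : (1 + s)^-1 <= Num.sqrt (pi / s).
  have h3 : 0 <= (1 + s)^-1 by rewrite invr_ge0; lra.
  rewrite -(ger0_norm h3) -sqrtr_sqr ler_wsqrtr// ler_pdivlMr// exprVn ler_pdivrMl ?exprn_gt0; [|lra..].
  nra.
apply: le_trans (_ : (1 + s)^-1 * ((1 + s) / n.+1%:R) <= _).
  by rewrite mulrA mulVf ?mul1r// gt_eqF//; lra.
by apply: ler_pM => //; rewrite ?divr_ge0 ?invr_ge0//; lra.
Qed.

Variable mu : R.
Hypotheses (mu0 : 0 < mu) (mu1 : mu <= 1).

(* The function A (e^-s - beta e^-2s), beta > 1, lies below the Gaussian kernel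
   in s, and its image A (e^-t - beta e^(-t 2^mu)) under subordination is
   positive when beta is close to 1. *)
Lemma stable_kernel_locally_gt0 (rho s1 s2 : R) : 0 < s1 ->
  (* The exponent [b] chosen below is that of beta = e^b: for t >= s1 one has t (2^mu - 1) >= 2b,
     which leaves the margin 1 - e^(-b) found in [kappa]. *)
  exists2 kappa, 0 < kappa & forall t (x : 'rV[R]_n),
    s1 <= t <= s2 -> dotp x x <= rho -> kappa <= stable_kernel mu t x.
Proof.
move=> s10; pose b := s1 * (2 `^ mu - 1) / 2.
have p2 : 1 < 2 `^ mu :> R.
  by rewrite /powR pnatr_eq0 /= -[X in X < _]expR0 ltr_expR mulr_gt0// ln_gt0// ltr1n.
have b0 : 0 < b by rewrite divr_gt0// mulr_gt0// subr_gt0.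
pose A : R := (2 * pi) ^- n * expR (- (rho / (4 * b))) * n.+1%:R ^- n.
have A0 : 0 < A.
  by rewrite !mulr_gt0 ?expR_gt0 ?invr_gt0 ?exprn_gt0 ?mulr_gt0 ?pi_gt0.
have eb1 : expR (- b) < 1 by rewrite -expR0 ltr_expR oppr_lt0.
exists (A * (expR (- s2) * (1 - expR (- b)))).
  by apply: mulr_gt0 => //; apply: mulr_gt0; rewrite ?expR_gt0 ?subr_gt0.
move=> t x /andP[s1t ts2] hx; have t0 : 0 < t by lra.
have key s (y : 'rV[R]_n) : 0 < s -> dotp y y <= rho ->
    A * expR (- (1 * s)) - A * expR b * expR (- (2 * s)) <= gauss_kernel s y.
  move=> s0 hy; have -> : A * expR (- (1 * s)) - A * expR b * expR (- (2 * s)) =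
      A * expR (- s) * (1 - expR (b - s)).
    have -> : expR (- (2 * s)) = expR (- s) * expR (- s) by rewrite -expRD; congr expR; ring.
    by rewrite expRD mul1r; ring.
  (* From [b] on, the factor 1 - e^(b-s) is at most 1 and is dropped; below [b] the left-hand side
     is nonpositive. *)
  have [bs|sb] := leP b s.
    apply: le_trans (gauss_kernel_lower b0 bs hy); rewrite -/A; apply: ler_piMr.
      by apply: mulr_ge0; [exact: ltW|exact: expR_ge0].
    by rewrite gerBl expR_ge0.
  apply: le_trans (ltW (gauss_kernel_gt0 y s0)).
  apply: mulr_ge0_le0; first by apply: mulr_ge0; [exact: ltW|exact: expR_ge0].
  by rewrite subr_le0 -expR0 ler_expR; lra.
apply: le_trans (stable_kernel_lower mu0 mu1 (ler0n _ 1) (ler0n _ 2) key t0 hx).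
rewrite powR1 mulr1.
have -> : A * expR (- t) - A * expR b * expR (- (t * 2 `^ mu)) =
    A * (expR (- t) * (1 - expR (b - t * (2 `^ mu - 1)))).
  have -> : expR (- (t * 2 `^ mu)) = expR (- t) * expR (- (t * (2 `^ mu - 1))).
    by rewrite -expRD; congr expR; ring.
  by rewrite expRD; ring.
rewrite ler_pM2l//; apply: ler_pM; rewrite ?expR_ge0 ?subr_ge0 ?(ltW eb1)//.
  by rewrite ler_expR lerN2.
rewrite lerD2l lerN2 ler_expR.
have h : s1 * (2 `^ mu - 1) <= t * (2 `^ mu - 1) by rewrite ler_wpM2r// subr_ge0 ltW.
have e : s1 * (2 `^ mu - 1) = 2 * b by rewrite /b; field.
by rewrite e in h; lra.
Qed.

End kernel_positivity.

(** * Hoelder continuity of the symbol *)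

Section fractional_power.
Context {R : realType}.
Variable mu : R.
Hypotheses (mu0 : 0 < mu) (mu1 : mu <= 1).

Lemma powR_ge_id (x : R) : 0 <= x <= 1 -> x <= x `^ mu.
Proof.
case/andP; rewrite le_eqVlt => /predU1P[<- _|x0 x1]; first exact: powR_ge0.
rewrite -[leLHS]powRr1 ?(ltW x0)//; apply: ger_powR => //.
by rewrite x0.
Qed.

(** After division by a^mu this is 1 <= x^mu + (1 - x)^mu on [0, 1], which follows from x <=
    x^mu. *)
Lemma powR_holder (a b : R) : 0 <= a -> 0 <= b -> `|a `^ mu - b `^ mu| <= `|a - b| `^ mu.
Proof.
wlog ba : a b / b <= a => [h|] a0 b0.
  have [ab|/ltW ab] := leP b a; first exact: h.
  by rewrite distrC [X in _ <= X `^ _]distrC; exact: h.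
move: a0; rewrite le_eqVlt => /predU1P[a0|a0].
  have -> : b = a by lra.
  by rewrite !subrr normr0 powR_ge0.
have m_le : b `^ mu <= a `^ mu by apply: ge0_ler_powR; rewrite ?nnegrE// ltW.
rewrite !ger0_norm ?subr_ge0// lerBlDr.
have xa : 0 <= b / a <= 1 by rewrite divr_ge0 ?(ltW a0)//= ler_pdivrMr// mul1r.
have ya : 0 <= (a - b) / a <= 1.
  by rewrite divr_ge0 ?subr_ge0 ?(ltW a0)//= ler_pdivrMr// mul1r gerBl.
have e1 : b `^ mu = a `^ mu * (b / a) `^ mu.
  rewrite -powRM ?(ltW a0)//; last by case/andP: xa.
  by congr (_ `^ _); field; rewrite gt_eqF.
have e2 : (a - b) `^ mu = a `^ mu * ((a - b) / a) `^ mu.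
  rewrite -powRM ?(ltW a0)//; last by case/andP: ya.
  by congr (_ `^ _); field; rewrite gt_eqF.
rewrite e1 e2 -mulrDr ler_peMr ?powR_ge0//.
have := powR_ge_id xa; have := powR_ge_id ya.
have : (a - b) / a + b / a = 1 by field; rewrite gt_eqF.
lra.
Qed.

Lemma stable_symbol_continuous n (t kappa : R) (eta : 'rV[R]_n) : 0 < t -> 0 < kappa ->
  exists2 rho, 0 < rho & forall z, dotp z z <= rho ->
    `|stable_symbol mu t (eta - z) - stable_symbol mu t eta| <= kappa.
Proof.
(* Chosen so that t d^mu = kappa: by [powR_holder] it suffices that |eta - z|^2 differs from |eta|^2
   by at most [d]. *)
move=> t0 k0; pose d := (kappa / t) `^ mu^-1.
have d0 : 0 < d by rewrite powR_gt0// divr_gt0.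
have l0 : 0 < dotp eta eta + 1 by rewrite ltr_wpDl ?dotp_ge0.
(* Weight in 2 |eta.z| <= q |eta|^2 + |z|^2 / q, small enough that the first term is at most d / 2;
   the radius controls the terms in |z|^2. *)
pose q := d / (2 * (dotp eta eta + 1)).
have q0 : 0 < q by rewrite divr_gt0// mulr_gt0.
have q1 : 0 < 1 + q^-1 by rewrite addr_gt0// invr_gt0.
exists (d / (2 * (1 + q^-1))); first by rewrite divr_gt0// mulr_gt0.
move=> z; rewrite ler_pdivlMr ?mulr_gt0// => hz.
have cs (e : R) : e ^+ 2 = 1 -> 2 * e * dotp eta z <= q * dotp eta eta + dotp z z / q.
  move=> e2; have := dotp_ge0 (q *: eta - e *: z).
  have -> : dotp (q *: eta - e *: z) (q *: eta - e *: z) =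
      q * (q * dotp eta eta - 2 * e * dotp eta z + dotp z z / q).
    rewrite /dotp !mulr_sumr mulr_suml -sumrB -big_split /= mulr_sumr.
    apply: eq_bigr => i _; rewrite !mxE.
    have -> : q * (q * (eta ord0 i * eta ord0 i) - 2 * e * (eta ord0 i * z ord0 i) +
       z ord0 i * z ord0 i / q) = q * (q * (eta ord0 i * eta ord0 i) - 2 * e * (eta ord0 i * z ord0 i)) +
       e ^+ 2 * (z ord0 i * z ord0 i) by rewrite e2; field; rewrite gt_eqF.
    ring.
  by rewrite pmulr_rge0//; lra.
have c1 := cs 1 (expr1n _ _); have c2 := cs (- 1) (etrans (sqrrN 1) (expr1n _ _)).
have ql : q * dotp eta eta <= d / 2.
  rewrite /q mulrAC ler_pdivrMr ?mulr_gt0//.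
  have -> : d / 2 * (2 * (dotp eta eta + 1)) = d * dotp eta eta + d by field.
  by rewrite lerDl ltW.
have zz : dotp z z + dotp z z / q <= d / 2.
  have -> : dotp z z + dotp z z / q = dotp z z * (2 * (1 + q^-1)) / 2 by field; rewrite gt_eqF.
  by rewrite ler_pM2r// invr_gt0.
have hd : `|dotp (eta - z) (eta - z) - dotp eta eta| <= d.
  have -> : dotp (eta - z) (eta - z) - dotp eta eta = dotp z z - 2 * dotp eta z.
    rewrite dotpBl ![dotp _ (eta - z)]dotpC !dotpBl [dotp z eta]dotpC; ring.
  have := dotp_ge0 z; rewrite ler_norml; lra.
apply: le_trans (expRN_lip _ _) _; rewrite ?mulr_ge0 ?powR_ge0 ?(ltW t0)//.
rewrite -mulrBr normrM gtr0_norm// -ler_pdivlMl// mulrC.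
apply: le_trans (powR_holder (dotp_ge0 _) (dotp_ge0 _)) _.
have -> : kappa / t = d `^ mu by rewrite /d -powRrM mulVf ?gt_eqF// powRr1// divr_ge0// ltW.
by apply: ge0_ler_powR; rewrite ?nnegrE// ltW.
Qed.

End fractional_power.

(** * Gaussians as an approximate identity *)

Section gauss_approximate_identity.
Context {R : realType} {n : nat}.
Local Notation m := (lebesgue_rV n).

Lemma gauss_kernel_approx_id (f : 'rV[R]_n -> R) (eta : 'rV[R]_n) :
  measurable_fun setT f -> (forall z, `|f z| <= 1) ->
  (forall kappa, 0 < kappa -> exists2 rho, 0 < rho & forall z, dotp z z <= rho ->
    `|f (eta - z) - f eta| <= kappa) ->
  \int[m]_xi (f xi * gauss_kernel (harmonic k) (eta - xi)) @[k --> \oo] --> f eta.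
Proof.
move=> mf f1 fc.
have hd k : 0 < harmonic k :> R by rewrite /harmonic /= invr_gt0.
have mfe : measurable_fun setT (fun z : 'rV[R]_n => f (eta - z)).
  by apply: (measurableT_comp mf); exact: measurable_rV_sub.
have e k : \int[m]_xi (f xi * gauss_kernel (harmonic k) (eta - xi)) =
    \int[m]_z (gauss_kernel (harmonic k) z * f (eta - z)).
  have [ig _] := gauss_kernel_integ (n := n) (hd k).
  rewrite -(Rint_rV_sub eta) => [|]; last first.
    apply: measurable_funM => //; exact: (integ_meas (integ_rV_sub eta ig)).
  by apply: eq_Rintegral => z _; rewrite mulrC opprB addrC subrK.
under eq_fun do rewrite e.
apply/cvgrPdist_le => eps eps0.
have [rho rho0 hrho] := fc _ (divr_gt0 eps0 (ltr0n _ 2)).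
(* Constant of the tail outside [rho]: a factor 2 from |f| <= 1, the rest from
   [gauss_kernel_tail]. *)
pose C : R := 16 * Num.sqrt 2 ^+ n / rho.
have C0 : 0 < C by rewrite divr_gt0// mulr_gt0// exprn_gt0// sqrtr_gt0.
have /cvgrPdist_le/(_ (eps / 2 / C)) : harmonic @ \oo --> (0 : R) by exact: cvg_harmonic.
rewrite !divr_gt0// => /(_ isT) hk.
near=> k; have hk2 : harmonic k * C <= eps / 2.
  rewrite -ler_pdivlMr//.
  have : `|0 - harmonic k| <= eps / 2 / C by near: k; exact: hk.
  by rewrite sub0r normrN ger0_norm// ltW.
have s0 := hd k; set s := harmonic k in s0 hk2 *.
have [ig Ig] := gauss_kernel_integ (n := n) s0.
have [ig2 Ig2] := gauss_kernel_integ (n := n) (mulr_gt0 (ltr0n _ 2) s0 : 0 < 2 * s).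
have igf : integ m (fun z => gauss_kernel s z * f (eta - z)).
  by apply: (integMr (C := 1)).
rewrite -[f eta]mulr1 -Ig -RintegralZl// distrC -RintegralB//; last exact: integZl.
(* The part near 0 is charged to the kernel at time [s], the tail to the kernel at time [2 * s];
   both have mass 1. *)
apply: (@le_trans _ _ (\int[m]_z (eps / 2 * gauss_kernel s z + (s * C) * gauss_kernel (2 * s) z))).
  apply: norm_Rint_le.
  - by apply: integB => //; exact: integZl.
  - by apply: integD; exact: integZl.
  move=> z; have g0 := gauss_kernel_gt0 z s0.
  have g20 := gauss_kernel_gt0 z (mulr_gt0 (ltr0n _ 2) s0 : 0 < 2 * s).
  rewrite mulrC -mulrBl normrM (gtr0_norm g0).
  have [hz|/ltW hz] := leP (dotp z z) rho.
    apply: ler_wpDr; first by rewrite ltW// mulr_gt0// mulr_gt0.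
    by rewrite ler_pM2r// hrho.
  apply: ler_wpDl; first by rewrite ltW// mulr_gt0// divr_gt0.
  apply: le_trans (_ : 2 * gauss_kernel s z <= _).
    rewrite ler_pM2r// (le_trans (ler_normB _ _))//.
    by have := f1 (eta - z); have := f1 eta; lra.
  rewrite -ler_pdivlMl//; apply: le_trans (gauss_kernel_tail s0 rho0 hz) _.
  by rewrite /C le_eqVlt; apply/orP; left; apply/eqP; field; rewrite gt_eqF.
rewrite RintegralD//; [|exact: integZl..].
rewrite (RintegralZl (eps / 2) measurableT ig) (RintegralZl (s * C) measurableT ig2) Ig Ig2.
lra.
Unshelve. all: by end_near. Qed.

End gauss_approximate_identity.

(** * Fourier inversion, mass and semigroup law *)

Section kernel_inversion.
Context {R : realType} {n : nat}.
Variable mu : R.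
Hypotheses (mu0 : 0 < mu) (mu1 : mu <= 1).
Local Notation m := (@lebesgue_rV R n).
Local Notation K := (@stable_kernel R n mu).
Local Notation e_ := (@stable_symbol R mu n).

Lemma measurable_cos_dotp d (T : measurableType d) (f g : T -> 'rV[R]_n) :
  measurable_fun setT f -> measurable_fun setT g ->
  measurable_fun setT (fun z => cos (dotp (f z) (g z))).
Proof.
move=> mf mg; apply: (measurableT_comp (continuous_measurable_fun (@continuous_cos R))).
exact: measurable_dotp.
Qed.

Lemma measurable_stable_kernel2 :
  measurable_fun [set: R * 'rV[R]_n] (fun z => K z.1 z.2).
Proof.
apply: measurable_funM => //.
apply: (@measurable_Rint2 _ _ _ _ _ m (fun z : (R * 'rV[R]_n) * 'rV[R]_n =>
  e_ z.1.1 z.2 * cos (dotp z.1.2 z.2))).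
have m11 : measurable_fun [set: (R * 'rV[R]_n) * 'rV[R]_n] (fun z => z.1.1).
  exact: (measurableT_comp measurable_fst measurable_fst).
have m12 : measurable_fun [set: (R * 'rV[R]_n) * 'rV[R]_n] (fun z => z.1.2).
  exact: (measurableT_comp measurable_snd measurable_fst).
apply: measurable_funM; last exact: measurable_cos_dotp.
apply: measurableT_comp => //; apply: measurableT_comp => //; apply: measurable_funM => //.
by apply: (measurableT_comp (measurable_powR mu)); exact: measurable_dotp.
Qed.

Lemma measurable_stable_kernel d (T : measurableType d) (f : T -> R) (g : T -> 'rV[R]_n) :
  measurable_fun setT f -> measurable_fun setT g ->
  measurable_fun setT (fun z => K (f z) (g z)).
Proof.
move=> mf mg; apply: (measurableT_comp measurable_stable_kernel2 (g := fun z => (f z, g z))).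
exact: measurable_fun_pair.
Qed.

Lemma measurable_stable_kernel1 t : measurable_fun setT (K t).
Proof. exact: measurable_stable_kernel. Qed.

Lemma stable_kernelN t x : K t (- x) = K t x.
Proof. by congr (_ * _); apply: eq_Rintegral => xi _; rewrite dotpNl cosN. Qed.

Lemma stable_symbolN t xi : e_ t (- xi) = e_ t xi.
Proof. by rewrite /stable_symbol dotpNl dotpNr opprK. Qed.

Lemma stable_symbol01 t xi : 0 < t -> 0 <= e_ t xi <= 1.
Proof.
move=> t0; rewrite expR_ge0 -expR0 ler_expR oppr_le0.
by rewrite mulr_ge0 ?powR_ge0// ltW.
Qed.

Let c0 : 0 < (2 * pi) ^- n :> R.
Proof. by rewrite invr_gt0 exprn_gt0// mulr_gt0// pi_gt0. Qed.

Lemma stable_kernel_le t x : 0 < t -> K t x <= (2 * pi) ^- n * \int[m]_xi e_ t xi.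
Proof.
move=> t0; rewrite ler_pM2l//; have ie := integ_stable_symbol n mu0 t0.
apply: ler_Rint => // [|xi]; first exact: integ_cos_rV.
by rewrite ler_piMr ?expR_ge0// cos_le1.
Qed.

(* The Gaussian factor makes the double integral of the inversion formula
   absolutely convergent. *)
Lemma stable_kernel_damped t s eta : 0 < t -> 0 < s ->
  \int[m]_x (K t x * (expR (- (s * dotp x x)) * cos (dotp eta x))) =
  \int[m]_xi (e_ t xi * gauss_kernel s (eta - xi)).
Proof.
move=> t0 s0; have ie := integ_stable_symbol n mu0 t0; have ig := integ_gauss_rV s0 n.
pose F x xi := expR (- (s * dotp x x)) * e_ t xi * ((2 * pi) ^- n * cos (dotp eta x) * cos (dotp x xi)).
have iF : integ (m \x m)%E (fun z => F z.1 z.2).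
  apply: (integMr (C := (2 * pi) ^- n)) (integ_tensor ig ie).
    apply: measurable_funM; last exact: measurable_cos_dotp.
    by apply: measurable_funM => //; apply: measurable_cos_dotp.
  move=> z; rewrite !normrM (gtr0_norm c0) -mulrA ler_piMr ?(ltW c0)//.
  by rewrite mulr_ile1// cos_max.
transitivity (\int[m]_x \int[m]_xi F x xi).
  apply: eq_Rintegral => x _; rewrite /stable_kernel.
  rewrite mulrAC -RintegralZl//; last exact: integ_cos_rV.
  by apply: eq_Rintegral => xi _; rewrite /F; ring.
rewrite (Rint_fubini iF).
(* The product of cosines is half the sum of the cosines at eta - xi and eta + xi; the two halves
   agree because the symbol is even. *)
transitivity (\int[m]_xi (2^-1 * (e_ t xi * gauss_kernel s (eta - xi)) +
                          2^-1 * (e_ t xi * gauss_kernel s (eta + xi)))).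
  apply: eq_Rintegral => xi _; rewrite -!gauss_kernelE//.
  have i1 := integ_cos_rV (eta - xi) ig; have i2 := integ_cos_rV (eta + xi) ig.
  rewrite !mulrA -!RintegralZl// -RintegralD//; [|exact: integZl..].
  apply: eq_Rintegral => x _; rewrite /F dotpBl dotpDl [dotp x xi]dotpC cosB cosD.
  by move: ((2 * pi) ^- n) => c; field.
have [ig1 _] := gauss_kernel_integ (n := n) s0.
have e1 xi : `|e_ t xi| <= 1.
  by have /andP[h1 h2] := stable_symbol01 xi t0; rewrite ger0_norm.
have j1 : integ m (fun xi => e_ t xi * gauss_kernel s (eta - xi)).
  apply: (@eq_integ _ _ _ m (fun xi => gauss_kernel s (eta - xi) * e_ t xi)) => [xi|]; first by rewrite mulrC.
  apply: (integMr (C := 1)) => //; first exact: (integ_meas ie).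
  exact: integ_rV_sub.
have j2 : integ m (fun xi => e_ t xi * gauss_kernel s (eta + xi)).
  apply: (eq_integ _ (integ_rV_sub 0 j1)) => xi.
  by rewrite sub0r stable_symbolN opprK.
rewrite RintegralD//; [|exact: integZl..].
rewrite !RintegralZl// -(Rint_rV_sub 0 (integ_meas j2)).
under [X in _ + _ * X]eq_Rintegral => xi _ do rewrite sub0r stable_symbolN.
lra.
Qed.

Let hd k : 0 < harmonic k :> R.
Proof. by rewrite /harmonic /= invr_gt0. Qed.

Let eh (y : R) : expR (- (harmonic k * y)) @[k --> \oo] --> (1 : R).
Proof.
rewrite -expR0; apply: continuous_cvg; first exact: continuous_expR.
rewrite -oppr0 -[X in _ --> - X](mul0r y); apply: cvgN; apply: cvgM; last exact: cvg_cst.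
exact: cvg_harmonic.
Qed.

(** Fatou along a vanishing Gaussian damping: each damped integral is an average of the symbol
    against a Gaussian kernel, hence at most 1. *)
Lemma integ_stable_kernel t : 0 < t -> integ m (K t).
Proof.
move=> t0; have K0 (x : 'rV[R]_n) := stable_kernel_ge0 mu0 mu1 x t0.
pose f_ k x := K t x * (expR (- (harmonic k * dotp x x)) * cos (dotp 0 x)).
have fE k x : f_ k x = K t x * expR (- (harmonic k * dotp x x)).
  by rewrite /f_ dotp0l cos0 mulr1.
have [||||//] := @Rint_fatou _ _ _ m f_ (K t) 1.
- move=> k; apply: (@eq_integ _ _ _ m (fun x => expR (- (harmonic k * dotp x x)) * K t x)).
    by move=> x; rewrite fE mulrC.
  apply: (integMr (C := (2 * pi) ^- n * \int[m]_xi e_ t xi)).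
  + exact: measurable_stable_kernel1.
  + by move=> x; rewrite ger0_norm// stable_kernel_le.
  + exact: integ_gauss_rV.
- by move=> k x; rewrite fE mulr_ge0 ?expR_ge0.
- move=> x; rewrite (_ : f_ ^~ x = fun k => K t x * expR (- (harmonic k * dotp x x))); last first.
    by apply/funext => k; exact: fE.
  by rewrite -[X in _ --> X]mulr1; apply: cvgM; [exact: cvg_cst|exact: eh].
move=> k; rewrite /f_ stable_kernel_damped//.
have [ig Ig] := gauss_kernel_integ (n := n) (hd k).
have igs := integ_rV_sub 0 ig.
rewrite -Ig -(Rint_rV_sub 0 (integ_meas ig)); apply: ler_Rint => //.
  apply: (@eq_integ _ _ _ m (fun xi => gauss_kernel (harmonic k) (0 - xi) * e_ t xi)) => [xi|]; first by rewrite mulrC.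
  apply: (integMr (C := 1)) => //; first exact: measurable_stable_symbol.
  by move=> xi; have /andP[h1 h2] := stable_symbol01 xi t0; rewrite ger0_norm.
move=> xi; have /andP[h1 h2] := stable_symbol01 xi t0.
by rewrite ler_piMl// ltW// gauss_kernel_gt0.
Qed.

(** The damping is removed on both sides: on the left by dominated convergence, [K t] being
    integrable, and on the right by the Gaussian approximate identity. *)
Lemma stable_kernel_fourier t eta : 0 < t ->
  \int[m]_x (K t x * cos (dotp eta x)) = e_ t eta.
Proof.
move=> t0; have K0 (x : 'rV[R]_n) := stable_kernel_ge0 mu0 mu1 x t0.
have iK := integ_stable_kernel t0.
have [|||||_ cv] := @Rint_dominatedW _ _ _ m
  (fun k x => K t x * (expR (- (harmonic k * dotp x x)) * cos (dotp eta x)))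
  (fun x => K t x * cos (dotp eta x)) (K t).
- move=> k; apply: measurable_funM; first exact: (integ_meas iK).
  by apply: measurable_funM; [exact: (integ_meas (integ_gauss_rV (hd k) n))|exact: mcos_rV].
- exact: (integ_meas (integ_cos_rV eta iK)).
- move=> x; apply: cvgM; first exact: cvg_cst.
  by rewrite -[X in _ --> X]mul1r; apply: cvgM; [exact: eh|exact: cvg_cst].
- exact: iK.
- move=> k x; rewrite normrM (ger0_norm (K0 x)) ler_piMr// normrM mulr_ile1 ?cos_max//.
  by rewrite ger0_norm ?expR_ge0// -expR0 ler_expR oppr_le0 mulr_ge0 ?dotp_ge0// ltW.
have := @gauss_kernel_approx_id _ _ (e_ t) eta (measurable_stable_symbol mu t) _ _.
move=> cv2; apply: (cvg_unique _ cv) => //=.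
under eq_fun => k do rewrite (stable_kernel_damped eta t0 (hd k)).
apply: cv2.
  by move=> z; have /andP[h1 h2] := stable_symbol01 z t0; rewrite ger0_norm.
by move=> kappa k0; exact: (stable_symbol_continuous mu0 mu1).
Qed.

Lemma stable_kernel_mass t : 0 < t -> \int[m]_x K t x = 1.
Proof.
move=> t0; have := stable_kernel_fourier 0 t0.
under eq_Rintegral => x _ do rewrite dotp0l cos0 mulr1.
by move=> ->; rewrite /stable_symbol dotp0l powR0 ?gt_eqF// mulr0 oppr0 expR0.
Qed.

Lemma stable_kernel_sin t eta : 0 < t -> \int[m]_x (K t x * sin (dotp eta x)) = 0.
Proof.
move=> t0; have ig := integ_sin_rV eta (integ_stable_kernel t0).
have := Rint_rV_sub 0 (integ_meas ig); set I := RHS.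
under eq_Rintegral => y _ do rewrite sub0r stable_kernelN dotpNr sinN mulrN -mulN1r.
by rewrite RintegralZl// -/I; lra.
Qed.

(** With [K t] written as its Fourier integral, Fubini leaves the transform of [K s] inside; its
    sine part vanishes and the two symbols multiply. *)
Lemma stable_kernel_conv0 t s x : 0 < t -> 0 < s ->
  \int[m]_y (K t (x - y) * K s y) = K (t + s) x.
Proof.
move=> t0 s0; have ie := integ_stable_symbol n mu0 t0; have iK := integ_stable_kernel s0.
pose F y xi := K s y * e_ t xi * ((2 * pi) ^- n * cos (dotp (x - y) xi)).
have iF : integ (m \x m)%E (fun z => F z.1 z.2).
  apply: (integMr (C := (2 * pi) ^- n)) (integ_tensor iK ie).
    apply: measurable_funM => //; apply: measurable_cos_dotp => //.
    exact: measurable_rV_sub.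
  by move=> z; rewrite normrM (gtr0_norm c0) ler_piMr ?(ltW c0)// cos_max.
transitivity (\int[m]_y \int[m]_xi F y xi).
  apply: eq_Rintegral => y _; rewrite {1}/stable_kernel.
  rewrite mulrAC -RintegralZl//; last exact: integ_cos_rV.
  by apply: eq_Rintegral => xi _; rewrite /F; ring.
rewrite (Rint_fubini iF) [in RHS]/stable_kernel -RintegralZl//; last first.
  by apply: integ_cos_rV; apply: integ_stable_symbol => //; exact: addr_gt0.
apply: eq_Rintegral => xi _.
have i1 := integ_cos_rV xi iK; have i2 := integ_sin_rV xi iK.
transitivity (\int[m]_y ((2 * pi) ^- n * e_ t xi * cos (dotp x xi) * (K s y * cos (dotp xi y)) +
   (2 * pi) ^- n * e_ t xi * sin (dotp x xi) * (K s y * sin (dotp xi y)))).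
  by apply: eq_Rintegral => y _; rewrite /F dotpBl [dotp y xi]dotpC cosB; ring.
rewrite RintegralD//; [|exact: integZl..].
rewrite !RintegralZl// stable_kernel_fourier// stable_kernel_sin// mulr0 addr0.
rewrite /stable_symbol [(t + s) * _]mulrDl opprD expRD; ring.
Qed.

Lemma stable_kernel_conv t s (x z : 'rV[R]_n) : 0 < t -> 0 < s ->
  \int[m]_y (K t (x - y) * K s (y - z)) = K (t + s) (x - z).
Proof.
move=> t0 s0; have mK u : measurable_fun setT (K u) := measurable_stable_kernel1 u.
rewrite -stable_kernel_conv0// -(@Rint_rV_sub _ _ z); last first.
  apply: measurable_funM; apply: measurable_stable_kernel => //; exact: measurable_rV_sub.
(* Reflections about [z] and about 0 compose to the translation y -> y + z. *)
rewrite -(@Rint_rV_sub _ _ 0); last first.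
  apply: measurable_funM; apply: measurable_stable_kernel => //.
    by apply: measurable_rV_sub => //; exact: measurable_rV_sub.
  by apply: measurable_rV_sub => //; exact: measurable_rV_sub.
apply: eq_Rintegral => y _; congr (K _ _ * _).
  by rewrite sub0r opprK opprD addrA.
by rewrite sub0r opprK addrAC subrr add0r.
Qed.

End kernel_inversion.

(** * Duhamel integrals for Markov kernels *)

Section time_integral.
Context {R : realType}.
Local Notation leb := (@lebesgue_measure R).
Local Notation mR := (measurableTypeR R).

(** An indicator used as a factor: time integrals then range over the whole line, and Fubini applies
    with no moving domain. *)
Definition chi (t s : R) : R := if (0 < s) && (s < t) then 1 else 0.

Lemma chi_ge0 t s : 0 <= chi t s.
Proof. by rewrite /chi; case: ifP. Qed.

Lemma measurable_chi2 : measurable_fun [set: mR * mR] (fun z => chi z.1 z.2).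
Proof.
apply: measurable_fun_ifT => //; apply: measurable_and.
- by apply: measurable_fun_ltr.
- by apply: measurable_fun_ltr.
Qed.

Lemma measurable_chi d (T : measurableType d) (f g : T -> mR) :
  measurable_fun setT f -> measurable_fun setT g ->
  measurable_fun setT (fun z => chi (f z) (g z)).
Proof.
move=> mf mg; apply: (measurableT_comp measurable_chi2 (g := fun z => (f z, g z))).
exact: measurable_fun_pair.
Qed.

Lemma chiE t s : chi t s = \1_(`]0, t[%classic) s.
Proof. by rewrite indicE /chi; case: ifPn => h; [rewrite mem_set//= in_itv/= h|rewrite memNset//= in_itv/=; apply/negP]. Qed.

Lemma integ_chi t : integ leb (chi t) /\ (0 <= t -> \int[leb]_s chi t s = t).
Proof.
have e : chi t = \1_(`]0, t[%classic) by apply/funext => s; exact: chiE.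
rewrite e; split.
  apply/integrableP; split; first by apply/measurable_EFinP; exact: measurable_indic.
  rewrite (_ : (fun x => _) = EFin \o \1_(`]0, t[%classic)); last first.
    by apply/funext => s /=; rewrite ger0_norm.
  rewrite integral_indic// setIT /= lebesgue_measure_itv /=.
  by case: ifP => _; rewrite -?EFinB ltry.
move=> t0; rewrite /Rintegral integral_indic// setIT /= lebesgue_measure_itv /=.
rewrite lte_fin; move: t0; rewrite le_eqVlt => /predU1P[<-|t0]; first by rewrite ltxx.
by rewrite t0 /= oppr0 addr0.
Qed.

Lemma chi_mul_le (t M : R) (h : R -> R) : (forall s, 0 < s < t -> `|h s| <= M) ->
  forall s, `|chi t s * h s| <= M * chi t s.
Proof.
move=> hM s; rewrite /chi; case: ifPn => hs; last by rewrite mul0r normr0 mulr0.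
by rewrite mul1r mulr1 hM.
Qed.

Lemma integ_chiM (t M : R) (h : mR -> R) : measurable_fun setT h ->
  (forall s, 0 < s < t -> `|h s| <= M) -> integ leb (fun s => chi t s * h s).
Proof.
move=> mh hM; apply (@integ_le _ _ _ leb (fun s => M * chi t s)).
- by apply: measurable_funM => //; apply: measurable_chi.
- exact: chi_mul_le.
- by have [ic _] := integ_chi t; exact: (integZl M ic).
Qed.

Lemma measurable_expRN_sub d (T : measurableType d) (b : R) (f g : T -> mR) :
  measurable_fun setT f -> measurable_fun setT g ->
  measurable_fun setT (fun z => expR (- (b * (f z - g z)))).
Proof.
move=> mf mg; apply: measurableT_comp => //; apply: measurableT_comp => //.
by apply: measurable_funM => //; exact: measurable_funB.
Qed.

Lemma Rint_itv_chi (t : R) (h : mR -> R) :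
  \int[leb]_(s in `]0, t[) h s = \int[leb]_s (chi t s * h s).
Proof.
rewrite Rintegral_mkcond; apply: eq_Rintegral => s _; rewrite patchE chiE indicE.
by case: (s \in _); rewrite ?mul1r ?mul0r.
Qed.

Lemma Rint_chi_exp (a t : R) : 0 < a -> 0 < t ->
  \int[leb]_s (chi t s * expR (- (a * (t - s)))) = (1 - expR (- (a * t))) / a.
Proof.
move=> a0 t0; rewrite -Rint_itv_chi.
pose f (s : R) := expR (- (a * (t - s))); pose F (s : R) := a^-1 * f s.
have df s : is_derive s (1 : R) F (f s).
  have d0 : is_derive s (1 : R) (fun z : R => a * z) a.
    by have := is_deriveZ a (is_derive_id s (1:R)); rewrite /GRing.scale/= mulr1.
  have d1 : is_derive s (1 : R) (fun z : R => a * z - a * t) (a - 0).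
    exact: (is_deriveB d0 (is_derive_cst (a * t) s (1 : R))).
  have d2 := @is_derive1_comp _ expR (fun z : R => a * z - a * t) s _ _ (is_derive_expR _) d1.
  have d3 : is_derive s (1 : R) (fun z => a^-1 * expR (a * z - a * t)) _ := is_deriveZ a^-1 d2.
  have -> : F = (fun z => a^-1 * expR (a * z - a * t)).
    by apply/funext => z; rewrite /F /f; congr (_ * expR _); ring.
  apply: (is_derive_eq d3); rewrite /GRing.scale/= subr0 /f.
  by rewrite [_ * a]mulrC mulrA mulVf ?gt_eqF// mul1r; congr expR; ring.
have cf : continuous f.
  move=> s; have -> : f = (fun z => a * F z).
    by apply/funext => z; rewrite /F mulrA mulfV ?gt_eqF// mul1r.
  apply: cvgM; first exact: cvg_cst.
  by have [h _] := df s; apply: differentiable_continuous; apply/derivable1_diffP.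
have mf : measurable_fun [set: R] f := continuous_measurable_fun cf.
have itc : leb.-integrable `[0, t] (EFin \o f).
  by apply: continuous_compact_integrable; [exact: segment_compact|exact: continuous_subspaceT].
have itS (i : interval R) : [set` i] `<=` `[0, t]%classic -> leb.-integrable [set` i] (EFin \o f).
  by move=> i0t; apply (@integrableS _ _ _ leb `[0, t]%classic).
rewrite Rintegral_itv_obnd_cbnd; last by apply: itS; apply: subset_itv; rewrite bnd_simp.
rewrite Rintegral_itv_bndo_bndc; last by apply: itS; apply: subset_itvl; rewrite bnd_simp.
rewrite /Rintegral (@continuous_FTC2 _ f F)//.
- by rewrite /= /F /f subrr subr0 mulr0 oppr0 expR0; field; rewrite gt_eqF.
- exact: continuous_subspaceT.
- split.
  + by move=> s _; have [] := df s.
  + by apply: cvg_at_right_filter; have [h _] := df 0; apply: differentiable_continuous; apply/derivable1_diffP.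
  + by apply: cvg_at_left_filter; have [h _] := df t; apply: differentiable_continuous; apply/derivable1_diffP.
- by move=> s _; rewrite derive1E; have [_ ->] := df s.
Qed.

Lemma Rint_subr (c : R) (f : mR -> R) : measurable_fun setT f ->
  \int[leb]_s f (c - s) = \int[leb]_s f s.
Proof.
move=> mf; have mF : measurable_fun setT (EFin \o f) by exact/measurable_EFinP.
rewrite /Rintegral; congr fine; rewrite integralE [RHS]integralE.
rewrite -(ge0_integral_subr c (measurable_funepos mF))//.
rewrite -(ge0_integral_subr c (measurable_funeneg mF))//.
by congr (_ - _)%E; apply: eq_integral => y _; rewrite ?funeposE ?funenegE.
Qed.

Lemma Rint_addr (c : R) (f : mR -> R) : measurable_fun setT f ->
  \int[leb]_s f (s + c) = \int[leb]_s f s.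
Proof.
move=> mf; rewrite -[RHS](Rint_subr 0 mf).
rewrite -(Rint_subr (- c) (f := fun s => f (0 - s))); last first.
  by apply: (measurableT_comp mf); apply: (measurable_funB _ _).
by apply: eq_Rintegral => s _; congr f; ring.
Qed.

End time_integral.

Section markov_kernel.
Context d (X : measurableType d) {R : realType}.
Variable m : {sigma_finite_measure set X -> \bar R}.
Local Notation leb := (@lebesgue_measure R).
Local Notation mR := (measurableTypeR R).

(** What the fixed-point argument takes from the heat kernel; measurability aside, it concerns
    positive times only. [mk_integ2] allows constants to be moved through the integral of
    [mk_conv]. *)
Record markov_kernel (k : mR -> X -> X -> R) : Prop := MarkovKernel {
  mk_meas : measurable_fun [set: (mR * X) * X] (fun z => k z.1.1 z.1.2 z.2);
  mk_ge0 : forall t x y, 0 < t -> 0 <= k t x y;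
  mk_integ : forall t x, 0 < t -> integ m (k t x);
  mk_mass : forall t x, 0 < t -> \int[m]_y k t x y = 1;
  mk_integ2 : forall t s x z, 0 < t -> 0 < s -> integ m (fun y => k t x y * k s y z);
  mk_conv : forall t s x z, 0 < t -> 0 < s -> \int[m]_y (k t x y * k s y z) = k (t + s) x z }.

Definition bounded_meas (C : R) (f : X -> R) :=
  measurable_fun setT f /\ forall x, `|f x| <= C.

Definition bounded_meas2 (C : R) (g : mR -> X -> R) :=
  measurable_fun [set: mR * X] (fun z => g z.1 z.2) /\ forall s x, `|g s x| <= C.

Lemma bounded_meas2_slice C g s : bounded_meas2 C g -> bounded_meas C (g s).
Proof.
move=> [mg gC]; split; last exact: gC.
exact: (measurableT_comp mg (pair1_measurable s)).
Qed.

Variable k : mR -> X -> X -> R.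
Hypothesis mk : markov_kernel k.

Definition Sg (t : R) (f : X -> R) (x : X) : R := \int[m]_y (k t x y * f y).

Lemma measurable_mk d' (T : measurableType d') (t : T -> mR) (x y : T -> X) :
  measurable_fun setT t -> measurable_fun setT x -> measurable_fun setT y ->
  measurable_fun setT (fun z => k (t z) (x z) (y z)).
Proof.
move=> mt mx my; apply: (measurableT_comp (mk_meas mk) (g := fun z => ((t z, x z), y z))).
by apply: measurable_fun_pair => //; exact: measurable_fun_pair.
Qed.

Lemma measurable_mk1 t x : measurable_fun setT (k t x).
Proof. exact: measurable_mk. Qed.

Lemma measurable_Sg d' (T : measurableType d') (t : T -> mR) (x : T -> X) (g : T -> X -> R) :
  measurable_fun setT t -> measurable_fun setT x ->
  measurable_fun [set: T * X] (fun z => g z.1 z.2) ->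
  measurable_fun setT (fun z => Sg (t z) (g z) (x z)).
Proof.
move=> mt mx mg; apply: (@measurable_Rint2 _ _ _ _ _ m (fun z => k (t z.1) (x z.1) z.2 * g z.1 z.2)).
apply: measurable_funM => //; apply: measurable_mk => //.
  exact: (measurableT_comp mt).
exact: (measurableT_comp mx).
Qed.

Lemma integ_Sg t f C x : 0 < t -> bounded_meas C f -> integ m (fun y => k t x y * f y).
Proof. by move=> t0 [mf fC]; apply: (integMr mf fC); exact: mk_integ. Qed.

Lemma le_Sg t f g C C' x : 0 < t -> bounded_meas C f -> bounded_meas C' g ->
  (forall y, f y <= g y) -> Sg t f x <= Sg t g x.
Proof.
move=> t0 bf bg fg; apply: ler_Rint; [exact: integ_Sg bf|exact: integ_Sg bg|].
by move=> y; rewrite ler_wpM2l// (mk_ge0 mk).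
Qed.

Lemma bounded_cst (c : R) : bounded_meas `|c| (fun=> c).
Proof. by split => // x; rewrite lexx. Qed.

Lemma Sg_cst t c x : 0 < t -> Sg t (fun=> c) x = c.
Proof. by move=> t0; rewrite /Sg RintegralZr ?mk_mass ?mul1r//; exact: mk_integ. Qed.

Lemma Sg_norm_le t f g C C' x : 0 < t -> bounded_meas C f -> bounded_meas C' g ->
  (forall y, `|f y| <= g y) -> `|Sg t f x| <= Sg t g x.
Proof.
move=> t0 bf bg fg; apply: norm_Rint_le; [exact: integ_Sg bf|exact: integ_Sg bg|].
by move=> y; rewrite normrM ger0_norm ?(mk_ge0 mk)// ler_wpM2l// (mk_ge0 mk).
Qed.

Lemma Sg_le t f C x : 0 < t -> bounded_meas C f -> `|Sg t f x| <= C.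
Proof.
move=> t0 bf; have bC : bounded_meas `|C| (fun=> C) by exact: bounded_cst.
by rewrite -[leRHS](Sg_cst C x t0); apply: (Sg_norm_le x t0 bf bC); case: bf.
Qed.

Lemma Sg_ge0 t f x : 0 < t -> (forall y, 0 <= f y) -> 0 <= Sg t f x.
Proof. by move=> t0 f0; apply: Rintegral_ge0 => y _; rewrite mulr_ge0// (mk_ge0 mk). Qed.

Lemma SgZ t c f C x : 0 < t -> bounded_meas C f -> Sg t (fun y => c * f y) x = c * Sg t f x.
Proof.
move=> t0 bf; rewrite /Sg -RintegralZl//; last exact: integ_Sg bf.
by apply: eq_Rintegral => y _; ring.
Qed.

Lemma SgD t f g C C' x : 0 < t -> bounded_meas C f -> bounded_meas C' g ->
  Sg t (fun y => f y + g y) x = Sg t f x + Sg t g x.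
Proof.
move=> t0 bf bg; rewrite /Sg -RintegralD//; [|exact: integ_Sg bf|exact: integ_Sg bg].
by apply: eq_Rintegral => y _; rewrite mulrDr.
Qed.

Lemma Sg_Sg t s f C x : 0 < t -> 0 < s -> bounded_meas C f ->
  Sg t (Sg s f) x = Sg (t + s) f x.
Proof.
move=> t0 s0 bf; have [mf fC] := bf.
pose F y z := k t x y * (k s y z * f z).
have iF : integ (m \x m)%E (fun u => F u.1 u.2).
  apply: (@integ_prod _ _ _ _ _ _ _ _ (fun y => C * k t x y)).
  - apply: measurable_funM; first by apply: measurable_mk.
    by apply: measurable_funM; [exact: measurable_mk|exact: (measurableT_comp mf)].
  - by move=> y; exact: (integZl (k t x y) (integ_Sg y s0 bf)).
  - move=> y; rewrite /F; have k0 := mk_ge0 mk x y t0.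
    under eq_Rintegral => z _ do rewrite normrM (ger0_norm k0).
    rewrite RintegralZl//; last by apply: integ_norm; exact: integ_Sg bf.
    rewrite mulrC ler_wpM2r//.
    have bn : bounded_meas C (fun z => `|f z|).
      by split; [exact: measurableT_comp|move=> z; rewrite normr_id].
    apply: le_trans (le_trans (ler_norm _) (Sg_le y s0 bn)).
    rewrite le_eqVlt; apply/orP; left; apply/eqP; apply: eq_Rintegral => z _.
    by rewrite normrM ger0_norm// (mk_ge0 mk).
  - exact: (integZl C (mk_integ mk x t0)).
transitivity (\int[m]_y \int[m]_z F y z).
  by apply: eq_Rintegral => y _; rewrite /F RintegralZl//; exact: integ_Sg bf.
rewrite (Rint_fubini iF); apply: eq_Rintegral => z _.
rewrite -(mk_conv mk)// -RintegralZr//; last exact: mk_integ2.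
by apply: eq_Rintegral => y _; rewrite /F mulrA.
Qed.

(* Duhamel integral for the semigroup killed at rate b. *)
Definition Dh (b : R) (g : mR -> X -> R) (t : R) (x : X) : R :=
  \int[leb]_s (chi t s * (expR (- (b * (t - s))) * Sg (t - s) (g s) x)).

Section Dh_basic.
Variables (b : R) (b0 : 0 <= b).

Lemma Dh_integrand_meas C g (t c : R) x : bounded_meas2 C g ->
  measurable_fun [set: mR] (fun s => expR (- (b * (t - s))) * Sg (c - s) (g s) x).
Proof.
move=> [mg _]; apply: measurable_funM; first by apply: measurable_expRN_sub.
by apply: measurable_Sg => //; exact: measurable_funB.
Qed.

Lemma expRNb_le1 (u : R) : 0 <= u -> expR (- (b * u)) <= 1.
Proof. by move=> u0; rewrite -expR0 ler_expR oppr_le0 mulr_ge0. Qed.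

Lemma Dh_integrand_le C g (t c : R) x s : bounded_meas2 C g -> s < t -> s < c ->
  `|expR (- (b * (t - s))) * Sg (c - s) (g s) x| <= C.
Proof.
move=> bg st sc; have bgs := bounded_meas2_slice s bg.
rewrite normrM -[leRHS]mul1r; apply: ler_pM => //.
  by rewrite ger0_norm ?expR_ge0// expRNb_le1// subr_ge0 ltW.
by apply: (Sg_le _ _ bgs); rewrite subr_gt0.
Qed.

(** The damping runs up to [t], the semigroup up to [c >= t]: this covers the integrands that arise
    after applying a further [Sg]. *)
Lemma integ_Dh C g t c x : t <= c -> bounded_meas2 C g ->
  integ leb (fun s => chi t s * (expR (- (b * (t - s))) * Sg (c - s) (g s) x)).
Proof.
move=> tc bg; apply: (@integ_chiM _ t C); first exact: (Dh_integrand_meas _ _ _ bg).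
by move=> s /andP[_ st]; apply: (Dh_integrand_le _ bg) => //; exact: lt_le_trans tc.
Qed.

Lemma measurable_Dh C g : bounded_meas2 C g ->
  measurable_fun [set: mR * X] (fun z => Dh b g z.1 z.2).
Proof.
move=> [mg _].
apply: (@measurable_Rint2 _ _ _ _ _ (leb : {sigma_finite_measure set mR -> \bar R})
  (fun z : (mR * X) * mR => chi z.1.1 z.2 * (expR (- (b * (z.1.1 - z.2))) * Sg (z.1.1 - z.2) (g z.2) z.1.2))).
have m11 : measurable_fun [set: (mR * X) * mR] (fun z => z.1.1).
  exact: (measurableT_comp measurable_fst measurable_fst).
have m12 : measurable_fun [set: (mR * X) * mR] (fun z => z.1.2).
  exact: (measurableT_comp measurable_snd measurable_fst).
apply: measurable_funM; first exact: measurable_chi.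
apply: measurable_funM; first exact: measurable_expRN_sub.
apply: (measurable_Sg (g := fun z : (mR * X) * mR => g z.2)) => //.
  exact: measurable_funB.
apply: (measurableT_comp mg (g := fun z : ((mR * X) * mR) * X => (z.1.2, z.2))).
apply: measurable_fun_pair => //.
exact: (measurableT_comp measurable_snd measurable_fst).
Qed.

Lemma Dh_norm_le C g t x (gam : mR -> R) M : bounded_meas2 C g ->
  measurable_fun setT gam -> (forall s, 0 < s < t -> `|gam s| <= M) ->
  (forall s y, 0 < s < t -> `|g s y| <= gam s) ->
  `|Dh b g t x| <= \int[leb]_s (chi t s * (expR (- (b * (t - s))) * gam s)).
Proof.
move=> bg mgam gM ggam; apply: norm_Rint_le.
- exact: integ_Dh bg.
- apply: (@integ_chiM _ t M).
    by apply: measurable_funM => //; exact: measurable_expRN_sub.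
  move=> s h; have /andP[s0 st] := h; rewrite normrM -[leRHS]mul1r; apply: ler_pM => //.
    by rewrite ger0_norm ?expR_ge0// expRNb_le1// subr_ge0 ltW.
  exact: gM.
- move=> s; rewrite /chi; case: ifPn => h; last by rewrite !mul0r normr0.
  have /andP[s0 st] := h; rewrite !mul1r normrM ger0_norm ?expR_ge0// ler_wpM2l ?expR_ge0//.
  have [mgs _] := bounded_meas2_slice s bg.
  by apply: (@Sg_le _ _ (gam s)); [rewrite subr_gt0|split => // y; exact: ggam].
Qed.

Lemma Dh_le_mono C C' g g' t x : bounded_meas2 C g -> bounded_meas2 C' g' ->
  (forall s y, `|g s y| <= g' s y) -> `|Dh b g t x| <= Dh b g' t x.
Proof.
move=> bg bg' gg'; apply: norm_Rint_le; [exact: integ_Dh bg|exact: integ_Dh bg'|].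
move=> s; rewrite /chi; case: ifPn => h; last by rewrite !mul0r normr0.
have /andP[s0 st] := h; rewrite !mul1r normrM ger0_norm ?expR_ge0// ler_wpM2l ?expR_ge0//.
apply: (Sg_norm_le _ _ (bounded_meas2_slice s bg) (bounded_meas2_slice s bg')) => //.
by rewrite subr_gt0.
Qed.

Lemma DhD C C' g g' t x : bounded_meas2 C g -> bounded_meas2 C' g' ->
  Dh b (fun s y => g s y + g' s y) t x = Dh b g t x + Dh b g' t x.
Proof.
move=> bg bg'; rewrite /Dh -RintegralD//; [|exact: integ_Dh bg|exact: integ_Dh bg'].
apply: eq_Rintegral => s _; rewrite /chi; case: ifPn => h; last by rewrite !mul0r addr0.
have /andP[s0 st] := h; rewrite !mul1r -mulrDr; congr (_ * _).
by apply: (SgD _ _ (bounded_meas2_slice s bg) (bounded_meas2_slice s bg')); rewrite subr_gt0.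
Qed.

Lemma DhZ C g c t x : bounded_meas2 C g ->
  Dh b (fun s y => c * g s y) t x = c * Dh b g t x.
Proof.
move=> bg; rewrite /Dh -RintegralZl//; last exact: integ_Dh bg.
apply: eq_Rintegral => s _; rewrite /chi; case: ifPn => h; last by rewrite !mul0r mulr0.
have /andP[s0 st] := h; rewrite !mul1r mulrCA; congr (_ * _).
by apply: (SgZ _ _ _ (bounded_meas2_slice s bg)); rewrite subr_gt0.
Qed.

(** Fubini and the semigroup law; the extra time goes to the semigroup and not to the damping. *)
Lemma Sg_Dh C g tau t x : 0 < tau -> 0 < t -> bounded_meas2 C g ->
  Sg tau (Dh b g t) x =
  \int[leb]_s (chi t s * (expR (- (b * (t - s))) * Sg (tau + t - s) (g s) x)).
Proof.
move=> tau0 t0 bg; have [mg gC] := bg.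
have C0 : 0 <= C by apply: le_trans (gC 0 x).
pose F y s := k tau x y * (chi t s * (expR (- (b * (t - s))) * Sg (t - s) (g s) y)).
have iF : integ (m \x leb)%E (fun u => F u.1 u.2).
  apply: (@integ_prod _ _ _ _ _ m leb _ (fun y => (C * t) * k tau x y)).
  - apply: measurable_funM; first by apply: measurable_mk.
    apply: measurable_funM; first exact: measurable_chi.
    apply: measurable_funM; first exact: measurable_expRN_sub.
    apply: (measurable_Sg (g := fun z : X * mR => g z.2)) => //; first exact: measurable_funB.
    apply: (measurableT_comp mg (g := fun z : (X * mR) * X => (z.1.2, z.2))).
    apply: measurable_fun_pair => //.
    exact: (measurableT_comp measurable_snd measurable_fst).
  - by move=> y; exact: (integZl (k tau x y) (integ_Dh y (lexx t) bg)).
  - move=> y; rewrite /F; have k0 := mk_ge0 mk x y tau0.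
    under eq_Rintegral => s _ do rewrite normrM (ger0_norm k0).
    rewrite RintegralZl//; last exact: (integ_norm (integ_Dh _ (lexx t) bg)).
    rewrite mulrC ler_wpM2r//; have [ic It] := integ_chi t.
    rewrite -[X in _ <= C * X](It (ltW t0)) -RintegralZl//; apply: ler_Rint.
    + exact: (integ_norm (integ_Dh _ (lexx t) bg)).
    + exact: (integZl C ic).
    + apply: chi_mul_le => s /andP[_ st]; exact: (Dh_integrand_le _ bg).
  - exact: (integZl (C * t) (mk_integ mk x tau0)).
transitivity (\int[m]_y \int[leb]_s F y s).
  by apply: eq_Rintegral => y _; rewrite /F (RintegralZl _ measurableT (integ_Dh _ (lexx t) bg)).
rewrite (Rint_fubini iF); apply: eq_Rintegral => s _; rewrite /F /chi.
case: ifPn => h; last first.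
  under eq_Rintegral do rewrite mul0r mulr0.
  by rewrite Rintegral_cst// !mul0r.
have /andP[s0 st] := h; have ts0 : 0 < t - s by rewrite subr_gt0.
have bgs := bounded_meas2_slice s bg.
rewrite mul1r -addrA -(Sg_Sg _ tau0 ts0 bgs).
have bS : bounded_meas C (Sg (t - s) (g s)).
  split; last by move=> y; exact: Sg_le.
  apply: measurable_Sg => //.
  exact: (measurableT_comp bgs.1 (@measurable_snd _ _ _ _)).
rewrite -(SgZ _ _ tau0 bS); apply: eq_Rintegral => y _; by rewrite mul1r.
Qed.

End Dh_basic.
End markov_kernel.

(** * Resolvent identities between the damped and undamped equations *)

Section resolvent.
Context d (X : measurableType d) {R : realType}.
Variable m : {sigma_finite_measure set X -> \bar R}.
Local Notation leb := (@lebesgue_measure R).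
Local Notation mR := (measurableTypeR R).
Variable k : mR -> X -> X -> R.
Hypothesis mk : markov_kernel m k.
Local Notation Sg := (Sg m k).
Local Notation Dh := (Dh m k).
Variable a : R.
Hypothesis a0 : 0 < a.

Lemma Dh_nonpos b g t x : t <= 0 -> Dh b g t x = 0.
Proof.
move=> t0; rewrite /Dh; under eq_Rintegral => s _.
  rewrite /chi (_ : (0 < s) && (s < t) = false); last first.
    by apply/negbTE/negP => /andP[s0 st]; have := lt_le_trans (lt_trans s0 st) t0; rewrite ltxx.
  rewrite mul0r; over.
by rewrite Rintegral_cst// mul0r.
Qed.

Lemma Rint_chi_expC (c t : R) : 0 < t ->
  \int[leb]_s (chi t s * (expR (- (a * (t - s))) * c)) = (1 - expR (- (a * t))) / a * c.
Proof.
move=> t0; rewrite -(Rint_chi_exp a0 t0) -RintegralZr//; last first.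
  apply: (@integ_chiM _ t 1); first exact: measurable_expRN_sub.
  move=> s /andP[_ st]; rewrite ger0_norm ?expR_ge0//.
  by apply: expRNb_le1; [exact: ltW|rewrite subr_ge0 ltW].
by apply: eq_Rintegral => s _; rewrite mulrA.
Qed.

Lemma Dh_le C g t x : 0 < t -> bounded_meas2 C g ->
  `|Dh a g t x| <= (1 - expR (- (a * t))) / a * C.
Proof.
move=> t0 bg; rewrite -Rint_chi_expC//; have [_ gC] := bg.
have C0 : 0 <= C by apply: le_trans (gC 0 x).
apply: (Dh_norm_le mk (ltW a0) (gam := fun=> C) (M := C) _ bg) => //.
by move=> s _; rewrite ger0_norm.
Qed.

Lemma bounded_Dh C g : bounded_meas2 C g -> bounded_meas2 (C / a) (Dh a g).
Proof.
move=> bg; have [_ gC] := bg; split; first exact: (measurable_Dh mk _ bg).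
move=> t x; have C0 : 0 <= C by apply: le_trans (gC 0 x).
have [t0|t0] := leP t 0.
  by rewrite Dh_nonpos// normr0 divr_ge0// ltW.
apply: le_trans (Dh_le _ t0 bg) _; rewrite mulrAC ler_wpM2r ?invr_ge0 ?(ltW a0)//.
by rewrite ler_piMl// gerBl expR_ge0.
Qed.

(* For fixed r < t, integrate e^{-a(s-r)} over r < s < t. *)
Lemma Dh_resolvent C g t x : 0 < t -> bounded_meas2 C g ->
  a * Dh 0 (Dh a g) t x = Dh 0 g t x - Dh a g t x.
Proof.
move=> t0 bg; have [mg gC] := bg.
have C0 : 0 <= C by apply: le_trans (gC 0 x).
have bD := bounded_Dh bg.
pose h r := Sg (t - r) (g r) x.
have mh : measurable_fun [set: mR] h.
  have := Dh_integrand_meas mk 0 t t x bg.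
  under eq_fun do rewrite mul0r oppr0 expR0 mul1r.
  by [].
have hC r : r < t -> `|h r| <= C.
  move=> rt; apply: (Sg_le mk _ _ (bounded_meas2_slice r bg)).
  by rewrite subr_gt0.
pose F s r := chi t s * (chi s r * (expR (- (a * (s - r))) * (chi t r * h r))).
have iF : integ (leb \x leb)%E (fun u => F u.1 u.2).
  apply: (@integ_le _ _ _ _ (fun u : mR * mR => C * (chi t u.1 * chi t u.2))).
  - apply: measurable_funM; first exact: measurable_chi.
    apply: measurable_funM; first exact: measurable_chi.
    apply: measurable_funM; first exact: measurable_expRN_sub.
    apply: measurable_funM; first exact: measurable_chi.
    exact: (measurableT_comp mh).
  - move=> [s r]; rewrite /F /chi /=; case: (ifP (_ && (s < t))) => h1; last by rewrite !mul0r mulr0 normr0.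
    case: (ifP (_ && (r < s))) => h2; last by rewrite !mul0r mulr0 normr0 mulr_ge0//; case: ifP.
    case: (ifP (_ && (r < t))) => h3; last by rewrite !mul0r !mulr0 normr0.
    rewrite !mul1r !mulr1 normrM -[leRHS]mul1r; apply: ler_pM => //.
      rewrite ger0_norm ?expR_ge0//; apply: expRNb_le1; first exact: ltW.
      by rewrite subr_ge0 ltW//; case/andP: h2.
    by apply: hC; case/andP: h3.
  - have [ic _] := integ_chi t; apply: (integZl C); exact: (integ_tensor ic ic).
have inner1 s : chi t s * (expR (- (0 * (t - s))) * Sg (t - s) (Dh a g s) x) = \int[leb]_r F s r.
  rewrite mul0r oppr0 expR0 mul1r /F /chi; case: ifPn => h1; last first.
    under eq_Rintegral do rewrite mul0r.
    by rewrite Rintegral_cst// !mul0r.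
  have /andP[s0 st] := h1.
  rewrite mul1r (Sg_Dh mk (ltW a0) _ _ s0 bg) ?subr_gt0//.
  apply: eq_Rintegral => r _; rewrite mul1r subrK /chi; case: ifPn => h2; last by rewrite !mul0r.
  have /andP[r0 rs] := h2.
  by rewrite r0 (lt_trans rs st) /= !mul1r.
have inner2 r : \int[leb]_s F s r = a^-1 * (chi t r * (1 - expR (- (a * (t - r)))) * h r).
  have [h1|h1] := boolP ((0 < r) && (r < t)); last first.
    under eq_Rintegral => s _ do rewrite /F {3}/chi (negbTE h1) mul0r !mulr0.
    by rewrite Rintegral_cst// mul0r /chi (negbTE h1) !mul0r mulr0.
  have /andP[r0 rt] := h1.
  have tr0 : 0 < t - r by rewrite subr_gt0.
  transitivity (\int[leb]_s (chi (t - r) s * (expR (- (a * ((t - r) - s))) * h r))); last first.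
    by rewrite Rint_chi_expC// /chi h1 mul1r; ring.
  rewrite -(Rint_subr t); last first.
    by rewrite /F; apply: measurable_funM; [exact: measurable_chi|
      apply: measurable_funM; [exact: measurable_chi|
      apply: measurable_funM => //; exact: measurable_expRN_sub]].
  apply: eq_Rintegral => s _; rewrite /F {3}/chi h1 mul1r mulrA; congr (_ * (expR _ * _)).
    rewrite /chi; have -> : (0 < t - s) && (t - s < t) = (0 < s) && (s < t) by apply/andP/andP => -[? ?]; split; lra.
    have -> : (0 < r) && (r < t - s) = (s < t - r) by rewrite r0 /=; apply/idP/idP => ?; lra.
    have [s1|s1] := boolP ((0 < s) && (s < t)).
      by case/andP: s1 => -> _ /=; rewrite mul1r.
    rewrite mul0r; case: ifP => // /andP[u1 u2]; move: s1; rewrite u1 /=.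
    by rewrite (_ : s < t)//; lra.
  ring.
have i1 := integ_Dh mk (lexx 0) x (lexx t) bg.
have i2 := integ_Dh mk (ltW a0) x (lexx t) bg.
have e3 r : chi t r * (expR (- (0 * (t - r))) * Sg (t - r) (g r) x) -
    chi t r * (expR (- (a * (t - r))) * Sg (t - r) (g r) x) =
    chi t r * (1 - expR (- (a * (t - r)))) * h r.
  by rewrite mul0r oppr0 expR0 /h; ring.
rewrite /Dh; under [X in a * X]eq_Rintegral => s _ do rewrite inner1.
rewrite (Rint_fubini iF); under [X in a * X]eq_Rintegral => r _ do rewrite inner2.
have i3 : integ leb (fun r => chi t r * (1 - expR (- (a * (t - r)))) * h r).
  apply (@eq_integ _ _ _ leb _ _ e3); exact: (integB i1 i2).
rewrite -RintegralB// [X in a * X]RintegralZl//.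
rewrite mulrA mulfV ?gt_eqF// mul1r.
by apply: eq_Rintegral => r _; rewrite e3.
Qed.

(** The free part of the damped equation, set to 0 at nonpositive times so that it is bounded on the
    whole line. *)
Definition Eh (u0 : X -> R) (t : R) (x : X) : R :=
  if 0 < t then expR (- (a * t)) * Sg t u0 x else 0.

Lemma measurable_Eh C u0 : bounded_meas C u0 ->
  measurable_fun [set: mR * X] (fun z => Eh u0 z.1 z.2).
Proof.
move=> [mu0 _]; apply: measurable_fun_ifT => //; first exact: measurable_fun_ltr.
apply: measurable_funM.
  by apply: measurableT_comp => //; apply: measurableT_comp => //; apply: measurable_funM.
apply: (measurable_Sg mk (g := fun _ : mR * X => u0)) => //.
exact: (measurableT_comp mu0).
Qed.

Lemma Eh_le C u0 t x : 0 < t -> bounded_meas C u0 -> `|Eh u0 t x| <= expR (- (a * t)) * C.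
Proof.
move=> t0 bu; rewrite /Eh t0 normrM ger0_norm ?expR_ge0// ler_wpM2l ?expR_ge0//.
exact: (Sg_le mk).
Qed.

Lemma bounded_Eh C u0 : bounded_meas C u0 -> bounded_meas2 C (Eh u0).
Proof.
move=> bu; split; first exact: measurable_Eh bu.
move=> t x; have C0 : 0 <= C by have [_ /(_ x)] := bu; apply: le_trans.
have [t0|t0] := ltP 0 t; last by rewrite /Eh ltNge t0 normr0.
apply: le_trans (Eh_le x t0 bu) _; rewrite ler_piMl//.
by rewrite expRNb_le1// ltW.
Qed.

(** For 0 < s < t, S(t-s) S(s) u0 = S(t) u0 does not depend on s, so only e^(-as) is integrated. *)
Lemma Eh_resolvent C u0 t x : 0 < t -> bounded_meas C u0 ->
  a * Dh 0 (Eh u0) t x = Sg t u0 x - Eh u0 t x.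
Proof.
move=> t0 bu; rewrite /Eh t0 /Dh.
transitivity (a * \int[leb]_s (chi t s * expR (- (a * s)) * Sg t u0 x)).
  congr (_ * _); apply: eq_Rintegral => s _; rewrite /chi; case: ifPn => h; last by rewrite !mul0r.
  have /andP[s0 st] := h; rewrite s0 mul0r oppr0 expR0 !mul1r.
  have bS : bounded_meas C (Sg s u0).
    split; last by move=> y; exact: (Sg_le mk).
    apply: (measurable_Sg mk) => //.
    exact: (measurableT_comp bu.1 (@measurable_snd _ _ _ _)).
  rewrite (SgZ mk _ _ _ bS) ?subr_gt0//.
  by rewrite (Sg_Sg mk _ _ _ bu) ?subr_gt0// subrK.
rewrite -(Rint_subr t); last first.
  apply: measurable_funM => //; apply: measurable_funM; first exact: measurable_chi.
  by apply: measurableT_comp => //; apply: measurableT_comp => //; apply: measurable_funM.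
have e s : chi t (t - s) * expR (- (a * (t - s))) * Sg t u0 x =
    chi t s * (expR (- (a * (t - s))) * Sg t u0 x).
  rewrite mulrA; congr (_ * _ * _); rewrite /chi.
  by rewrite (_ : (0 < t - s) && (t - s < t) = (0 < s) && (s < t))//; apply/andP/andP => -[? ?]; split; lra.
under eq_Rintegral => s _ do rewrite e.
by rewrite Rint_chi_expC//; field; rewrite gt_eqF.
Qed.

End resolvent.

(** * The damped fixed point *)

Section damped_solution.
Context d (X : measurableType d) {R : realType}.
Variable m : {sigma_finite_measure set X -> \bar R}.
Local Notation leb := (@lebesgue_measure R).
Local Notation mR := (measurableTypeR R).
Variable k : mR -> X -> X -> R.
Hypothesis mk : markov_kernel m k.
Local Notation Sg := (Sg m k).
Local Notation Dh := (Dh m k).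
Variable a : R.
Hypothesis a0 : 0 < a.
Local Notation Eh := (Eh m k a).
Variable W : X -> R.
Hypotheses (mW : measurable_fun setT W) (W0 : forall y, 0 <= W y) (Wa : forall y, W y <= a).

Implicit Types (v w : mR -> X -> R) (C : R).

Lemma bounded_meas2B C C' v w : bounded_meas2 C v -> bounded_meas2 C' w ->
  bounded_meas2 (C + C') (fun s y => v s y - w s y).
Proof.
move=> [mv vC] [mw wC]; split; first exact: measurable_funB.
by move=> s y; rewrite (le_trans (ler_normB _ _))// lerD.
Qed.

Lemma bounded_meas2N C v : bounded_meas2 C v -> bounded_meas2 C (fun s y => - v s y).
Proof.
by move=> [mv vC]; split; [exact: measurableT_comp|move=> s y; rewrite normrN].
Qed.

Lemma DhB b C C' v w t x : 0 <= b -> bounded_meas2 C v -> bounded_meas2 C' w ->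
  Dh b (fun s y => v s y - w s y) t x = Dh b v t x - Dh b w t x.
Proof.
move=> b0 bv bw; rewrite -mulN1r -(DhZ mk b0 _ _ _ bw).
have bN : bounded_meas2 C' (fun s y => -1 * w s y).
  have [mN NC] := bounded_meas2N bw; split; first by apply: measurable_funM => //; case: bw.
  by move=> s y; rewrite mulN1r.
rewrite -(DhD mk b0 _ _ bv bN); congr (Dh _ _ t x).
by apply/funext => s; apply/funext => y; rewrite mulN1r.
Qed.

Definition wmul v (s : mR) (y : X) : R := W y * v s y.

Lemma bounded_wmul C v : bounded_meas2 C v -> bounded_meas2 (a * C) (wmul v).
Proof.
move=> [mv vC]; split.
  by apply: measurable_funM => //; exact: (measurableT_comp mW).
by move=> s y; rewrite normrM; apply: ler_pM => //; rewrite ger0_norm.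
Qed.

Definition Phi u0 v (t : mR) (x : X) : R := Eh u0 t x + Dh a (wmul v) t x.

(** Bounds the norm of the Duhamel operator up to time [t]. It is below 1 at each [t] but tends to
    1, so the contraction is used time by time, through powers of [q t]. *)
Let q (t : R) := 1 - expR (- (a * t)).

Let q_ge0 t : 0 < t -> 0 <= q t.
Proof. by move=> t0; rewrite subr_ge0 -expR0 ler_expR oppr_le0 mulr_ge0// ltW. Qed.

Let q_lt1 t : q t < 1.
Proof. by rewrite gtrBl expR_gt0. Qed.

Let q_mono s t : s <= t -> q s <= q t.
Proof. by move=> st; rewrite lerD2l lerN2 ler_expR lerN2 ler_pM2l. Qed.

(** [q] is increasing, so the bound at [s < t] is at most the one at [t]; the integral of a
    e^(-a(t-s)) supplies the new factor. *)
Lemma Dh_contraction C w j : bounded_meas2 C w ->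
  (forall s y, 0 < s -> `|w s y| <= C * q s ^+ j) ->
  forall t x, 0 < t -> `|Dh a (wmul w) t x| <= C * q t ^+ j.+1.
Proof.
move=> bw wq t x t0; have [_ wC] := bw.
have C0 : 0 <= C by apply: le_trans (wC 0 x).
have qt0 := q_ge0 t0.
have -> : C * q t ^+ j.+1 = (1 - expR (- (a * t))) / a * (a * (C * q t ^+ j)).
  by rewrite exprS /q; field; rewrite gt_eqF.
rewrite -Rint_chi_expC//.
apply: (Dh_norm_le mk (ltW a0) (gam := fun=> a * (C * q t ^+ j))
  (M := a * (C * q t ^+ j)) _ (bounded_wmul bw)) => //.
  by move=> s _; rewrite ger0_norm// !mulr_ge0// ?exprn_ge0// ltW.
move=> s y /andP[s0 st]; rewrite normrM; apply: ler_pM => //.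
  by rewrite ger0_norm.
apply: le_trans (wq s y s0) _; rewrite ler_wpM2l//.
by apply: lerXn2r; rewrite ?nnegrE ?q_ge0// q_mono// ltW.
Qed.

Lemma cvg_q C t : 0 < t -> C * q t ^+ j @[j --> \oo] --> 0.
Proof.
move=> t0; rewrite -[X in _ --> X](mulr0 C); apply: cvgM; first exact: cvg_cst.
by apply: cvg_expr; rewrite ger0_norm ?q_ge0 ?q_lt1.
Qed.

Lemma Dh_homogeneous_eq0 C w : bounded_meas2 C w ->
  (forall t x, 0 < t -> w t x = Dh a (wmul w) t x) ->
  forall t x, 0 < t -> w t x = 0.
Proof.
move=> bw weq t x t0; have wq j : forall t x, 0 < t -> `|w t x| <= C * q t ^+ j.
  elim: j => [|j IH] {t0 x}t x t0; first by rewrite expr0 mulr1; case: bw.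
  by rewrite weq//; exact: Dh_contraction.
apply/eqP; rewrite -normr_le0.
apply: (ler_cvg_to (cvg_cst `|w t x|) (cvg_q C t0)).
by apply: nearW => j; exact: wq.
Qed.

Lemma Phi_uniq C C' u0 v w : bounded_meas2 C v -> bounded_meas2 C' w ->
  (forall t x, 0 < t -> v t x = Phi u0 v t x) ->
  (forall t x, 0 < t -> w t x = Phi u0 w t x) ->
  forall t x, 0 < t -> v t x = w t x.
Proof.
move=> bv bw ve we t x t0; apply/eqP; rewrite -subr_eq0; apply/eqP.
apply: (Dh_homogeneous_eq0 (bounded_meas2B bv bw)) => // {t0 x}t x t0.
rewrite ve// we// /Phi opprD addrACA subrr add0r.
rewrite -(DhB _ _ (ltW a0) (bounded_wmul bv) (bounded_wmul bw)).
by congr (Dh _ _ t x); apply/funext => s; apply/funext => y; rewrite /wmul mulrBr.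
Qed.

(** The bound [C] is kept exactly: e^(-at) C from the free part and (1 - e^(-at)) C from the Duhamel
    part. *)
Lemma bounded_Phi C u0 v : bounded_meas C u0 -> bounded_meas2 C v ->
  bounded_meas2 C (Phi u0 v).
Proof.
move=> bu bv; have bw := bounded_wmul bv; split.
  apply: measurable_funD; [exact: (measurable_Eh mk _ bu)|exact: (measurable_Dh mk _ bw)].
move=> t x; have C0 : 0 <= C by have [_ /(_ x)] := bu; apply: le_trans.
have [t0|t0] := ltP 0 t; last by rewrite /Phi /Eh ltNge t0 Dh_nonpos// addr0 normr0.
apply: le_trans (ler_normD _ _) _.
apply: le_trans (lerD (Eh_le mk a x t0 bu) (Dh_le mk a0 x t0 bw)) _.
by rewrite le_eqVlt; apply/orP; left; apply/eqP; field; rewrite gt_eqF.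
Qed.

Definition Uit u0 (n : nat) : mR -> X -> R := iter n (Phi u0) (fun _ _ => 0).

Lemma bounded_Uit C u0 n : bounded_meas C u0 -> bounded_meas2 C (Uit u0 n).
Proof.
move=> bu; elim: n => [|n IH]; last exact: bounded_Phi.
split; first exact: measurable_cst.
by move=> s y; rewrite normr0; have [_ /(_ y)] := bu; apply: le_trans.
Qed.

Lemma Uit_nonpos u0 n t x : t <= 0 -> Uit u0 n t x = 0.
Proof.
by move=> t0; case: n => // n; rewrite /Uit /= /Phi /Eh ltNge t0 Dh_nonpos// addr0.
Qed.

Lemma Uit_diff C u0 n t x : bounded_meas C u0 -> 0 < t ->
  `|Uit u0 n.+1 t x - Uit u0 n t x| <= (C + C) * q t ^+ n.
Proof.
move=> bu; elim: n t x => [|n IH] t x t0.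
  by rewrite expr0 mulr1; have [_] := bounded_meas2B (bounded_Uit 1 bu) (bounded_Uit 0 bu); exact.
have b1 := bounded_Uit n.+1 bu; have b2 := bounded_Uit n bu.
have -> : Uit u0 n.+2 t x - Uit u0 n.+1 t x =
    Dh a (wmul (fun s y => Uit u0 n.+1 s y - Uit u0 n s y)) t x.
  rewrite {1}/Uit /= -/(Uit u0 n.+1) [X in _ - X]/(Phi u0 (Uit u0 n) t x) /Phi opprD addrACA subrr add0r.
  rewrite -(DhB _ _ (ltW a0) (bounded_wmul b1) (bounded_wmul b2)).
  by congr (Dh _ _ t x); apply/funext => s; apply/funext => y; rewrite /wmul mulrBr.
by apply: Dh_contraction => //; exact: bounded_meas2B.
Qed.

Lemma is_cvg_Uit C u0 t x : bounded_meas C u0 -> cvgn (fun n => Uit u0 n t x).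
Proof.
move=> bu; have [t0|t0] := ltP 0 t; last first.
  rewrite (_ : (fun n => Uit u0 n t x) = fun=> 0); first exact: is_cvg_cst.
  by apply/funext => n; exact: Uit_nonpos.
have C0 : 0 <= C by have [_ /(_ x)] := bu; apply: le_trans.
have cs : cvgn (series (telescope (fun n => Uit u0 n t x))).
  apply: normed_cvg; apply: (@series_le_cvg _ _ (geometric (C + C) (q t))) => //=.
  - by move=> n; rewrite mulr_ge0 ?exprn_ge0 ?q_ge0// addr_ge0.
  - by move=> n; exact: Uit_diff.
  - by apply: is_cvg_geometric_series; rewrite ger0_norm ?q_ge0 ?q_lt1.
rewrite telescopeK in cs.
by rewrite (_ : (fun n => Uit u0 n t x) = [sequence Uit u0 n t x - Uit u0 0%N t x]_n)//; apply/funext => n; rewrite /= subr0.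
Qed.

Definition sol u0 (t : mR) (x : X) : R := limn (fun n => Uit u0 n t x).

Lemma cvg_sol C u0 t x : bounded_meas C u0 -> Uit u0 n t x @[n --> \oo] --> sol u0 t x.
Proof. by move=> bu; rewrite /sol; exact: (@is_cvg_Uit C u0 t x bu). Qed.
Arguments cvg_sol {C u0} t x _.

Lemma sol_nonpos C u0 t x : bounded_meas C u0 -> t <= 0 -> sol u0 t x = 0.
Proof.
move=> bu t0; apply/cvg_lim => //; rewrite (_ : (fun n => Uit u0 n t x) = fun=> 0); first exact: cvg_cst.
by apply/funext => n; exact: Uit_nonpos.
Qed.

Lemma bounded_sol C u0 : bounded_meas C u0 -> bounded_meas2 C (sol u0).
Proof.
move=> bu; split.
  apply: (@measurable_fun_cvg _ _ _ _ (fun n z => Uit u0 n z.1 z.2)).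
    by move=> n; have [] := bounded_Uit n bu.
  by move=> z _; exact: (cvg_sol _ _ bu).
move=> t x; apply: (ler_cvg_to (cvg_norm (cvg_sol t x bu)) (cvg_cst C)).
by apply: nearW => n; have [_] := bounded_Uit n bu; exact.
Qed.

(** Dominated convergence twice, in space and then in time, with the bound [a * C] common to all
    iterates. *)
Lemma sol_eq C u0 t x : bounded_meas C u0 -> sol u0 t x = Phi u0 (sol u0) t x.
Proof.
move=> bu; have [t0|t0] := ltP 0 t; last first.
  by rewrite (sol_nonpos _ bu)// /Phi /Eh ltNge t0 Dh_nonpos// addr0.
have C0 : 0 <= C by have [_ /(_ x)] := bu; apply: le_trans.
have bs := bounded_sol bu; have bws := bounded_wmul bs.
have aC0 : 0 <= a * C by rewrite mulr_ge0// ltW.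
have cS s y : 0 < s < t -> Sg (t - s) (wmul (Uit u0 n) s) y @[n --> \oo] --> Sg (t - s) (wmul (sol u0) s) y.
  move=> /andP[s0 st]; have ts : 0 < t - s by rewrite subr_gt0.
  have [|||||_] // := @Rint_dominatedW _ _ _ m (fun n z => k (t - s) y z * wmul (Uit u0 n) s z)
    (fun z => k (t - s) y z * wmul (sol u0) s z) (fun z => (a * C) * k (t - s) y z).
  - move=> n; apply: measurable_funM; first exact: (measurable_mk1 mk).
    by have [] := bounded_meas2_slice s (bounded_wmul (bounded_Uit n bu)).
  - apply: measurable_funM; first exact: (measurable_mk1 mk).
    by have [] := bounded_meas2_slice s bws.
  - move=> z; apply: cvgM; first exact: cvg_cst.
    by apply: cvgM; [exact: cvg_cst|exact: (cvg_sol _ _ bu)].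
  - exact: (integZl (a * C) (mk_integ mk y ts)).
  - move=> n z; rewrite normrM ger0_norm ?(mk_ge0 mk)// mulrC ler_wpM2r ?(mk_ge0 mk)//.
    by have [_] := bounded_wmul (bounded_Uit n bu); exact.
have cD : Dh a (wmul (Uit u0 n)) t x @[n --> \oo] --> Dh a (wmul (sol u0)) t x.
  have h1 n := integ_meas (integ_Dh mk (ltW a0) x (lexx t) (bounded_wmul (bounded_Uit n bu))).
  have h2 := integ_meas (integ_Dh mk (ltW a0) x (lexx t) bws).
  have h3 (s : R) : chi t s * (expR (- (a * (t - s))) * Sg (t - s) (wmul (Uit u0 n) s) x) @[n --> \oo] -->
      chi t s * (expR (- (a * (t - s))) * Sg (t - s) (wmul (sol u0) s) x).
    rewrite /chi; case: ifPn => h; last by under eq_fun do rewrite mul0r; rewrite mul0r; exact: cvg_cst.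
    by apply: cvgM; [exact: cvg_cst|apply: cvgM; [exact: cvg_cst|exact: cS]].
  have [ic _] := integ_chi t.
  have h5 n (s : R) : `|chi t s * (expR (- (a * (t - s))) * Sg (t - s) (wmul (Uit u0 n) s) x)| <= (a * C) * chi t s.
    rewrite /chi; case: ifPn => [/andP[_ st]|_]; last by rewrite mul0r normr0 mulr0.
    rewrite mul1r mulr1.
    exact: (Dh_integrand_le mk (ltW a0) _ (bounded_wmul (bounded_Uit n bu))).
  by have [] := @Rint_dominatedW _ _ _ leb _ _ _ h1 h2 h3 (integZl (a * C) ic) h5.
have c1 : Uit u0 n.+1 t x @[n --> \oo] --> Phi u0 (sol u0) t x.
  by apply: cvgD; [exact: cvg_cst|exact: cD].
have c2 : Uit u0 n.+1 t x @[n --> \oo] --> sol u0 t x.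
  by have := cvg_sol t x bu; rewrite -(cvg_shiftS (fun n => Uit u0 n t x)).
exact: (cvg_unique _ c2 c1).
Qed.

(** The kernel and [W] are nonnegative, so domination by [C] times the iterate issued from 1
    survives each step. *)
Lemma Uit_norm_le C u0 n t x : bounded_meas C u0 ->
  `|Uit u0 n t x| <= C * Uit (fun=> 1) n t x.
Proof.
move=> bu; have b1 := @bounded_cst _ X R 1.
elim: n t x => [|n IH] t x; first by rewrite /= normr0 mulr0.
have [t0|t0] := ltP 0 t; last by rewrite !Uit_nonpos// normr0 mulr0.
rewrite -[Uit u0 n.+1]/(Phi u0 (Uit u0 n)) -[Uit (fun=> 1) n.+1]/(Phi (fun=> 1) (Uit (fun=> 1) n)) /Phi mulrDr; apply: le_trans (ler_normD _ _) _; apply: lerD.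
  by apply: le_trans (Eh_le mk a x t0 bu) _; rewrite /Eh t0 (Sg_cst mk)// mulr1 mulrC.
have bw := bounded_wmul (bounded_Uit n bu); have bw1 := bounded_wmul (bounded_Uit n b1).
rewrite -(DhZ mk (ltW a0) _ _ _ bw1).
have bw2 : bounded_meas2 (`|C| * (a * `|1 : R|)) (fun s y => C * wmul (Uit (fun=> 1) n) s y).
  have [m1 h1] := bw1; split; first by apply: measurable_funM.
  by move=> s y; rewrite normrM ler_wpM2l.
apply: (Dh_le_mono mk (ltW a0) _ _ bw bw2) => s y.
by rewrite normrM ger0_norm// mulrCA ler_wpM2l.
Qed.

Lemma sol_norm_le C u0 t x : bounded_meas C u0 -> `|sol u0 t x| <= C * sol (fun=> 1) t x.
Proof.
move=> bu; have b1 := @bounded_cst _ X R 1.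
have c1 : C * Uit (fun=> 1) n t x @[n --> \oo] --> C * sol (fun=> 1) t x.
  by apply: cvgM; [exact: cvg_cst|exact: (cvg_sol _ _ b1)].
apply: (ler_cvg_to (cvg_norm (cvg_sol t x bu)) c1).
by apply: nearW => n; exact: Uit_norm_le.
Qed.

Lemma sol1_ge0 t x : 0 <= sol (fun=> 1) t x.
Proof.
have b1 := @bounded_cst _ X R 1.
have := sol_norm_le t x b1; rewrite normr1 mul1r.
by apply: le_trans.
Qed.

Lemma sol1_ge t x : 0 < t -> expR (- (a * t)) <= sol (fun=> 1) t x.
Proof.
move=> t0; have b1 := @bounded_cst _ X R 1.
rewrite (sol_eq t x b1) /Phi /Eh t0 (Sg_cst mk)// mulr1 lerDl.
apply: Rintegral_ge0 => s _; rewrite /chi; case: ifPn => h; last by rewrite mul0r.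
have /andP[s0 st] := h; rewrite mul1r mulr_ge0 ?expR_ge0//.
apply: (Sg_ge0 mk); first by rewrite subr_gt0.
by move=> y; rewrite mulr_ge0// sol1_ge0.
Qed.

(** Applying [a * Dh 0] to the fixed-point equation, the two resolvent identities cancel the damped
    terms; [W - a] is the original potential. *)
Lemma sol_potential C u0 t x : bounded_meas C u0 -> 0 < t ->
  sol u0 t x = Sg t u0 x + Dh 0 (fun s y => (W y - a) * sol u0 s y) t x.
Proof.
move=> bu t0; have bs := bounded_sol bu; have bws := bounded_wmul bs.
have bE := bounded_Eh mk a0 bu; have bD := bounded_Dh mk a0 bws.
have -> : (fun s y => (W y - a) * sol u0 s y) = (fun s y => wmul (sol u0) s y - a * sol u0 s y).
  by apply/funext => s; apply/funext => y; rewrite mulrBl.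
have bas : bounded_meas2 (a * C) (fun s y => a * sol u0 s y).
  have [ms sC] := bs; split; first by apply: measurable_funM.
  by move=> s y; rewrite normrM gtr0_norm// ler_pM2l.
rewrite (DhB _ _ (lexx 0) bws bas) (DhZ mk (lexx 0) _ _ _ bs).
have -> : Dh 0 (sol u0) t x = Dh 0 (fun s y => Eh u0 s y + Dh a (wmul (sol u0)) s y) t x.
  by congr (Dh _ _ t x); apply/funext => s; apply/funext => y; exact: (sol_eq _ _ bu).
rewrite (DhD mk (lexx 0) _ _ bE bD) mulrDr.
rewrite (Eh_resolvent mk a0 x t0 bu) (Dh_resolvent mk a0 x t0 bws).
rewrite {1}(sol_eq t x bu) /Phi.
by move: (Eh _ _ _) (Dh _ _ _ _) (Dh _ _ _ _) (Sg _ _ _) => A B D E; ring.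
Qed.

(** Splitting the Duhamel integral at [tau] shows that the shifted solution satisfies the
    fixed-point equation with initial value [sol u0 tau]; uniqueness concludes. *)
Lemma sol_shift C u0 tau t x : bounded_meas C u0 -> 0 < tau -> 0 < t ->
  sol u0 (t + tau) x = sol (sol u0 tau) t x.
Proof.
move=> bu tau0 t0; have bs := bounded_sol bu; have bws := bounded_wmul bs.
have bst := bounded_meas2_slice tau bs.
pose v (s : mR) y := sol u0 (s + tau) y.
have bv : bounded_meas2 C v.
  have [ms sC] := bs; split; last by move=> s y; exact: sC.
  apply: (measurableT_comp ms (g := fun z : mR * X => (z.1 + tau, z.2))).
  apply: measurable_fun_pair => //.
  by apply: measurable_funD.
apply: (Phi_uniq bv (bounded_sol bst) _ _ x t0); last by move=> r y _; exact: (sol_eq r y bst).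
move=> {t0}{}t {}x t0.
have tt0 : 0 < t + tau by rewrite addr_gt0.
rewrite [LHS](sol_eq (t + tau) x bu) /Phi /Eh t0 tt0.
have -> : Sg t (sol u0 tau) x = expR (- (a * tau)) * Sg (t + tau) u0 x +
  \int[leb]_s (chi tau s * (expR (- (a * (tau - s))) * Sg (t + tau - s) (wmul (sol u0) s) x)).
  rewrite -(Sg_Dh mk (ltW a0) _ t0 tau0 bws) -(Sg_Sg mk _ t0 tau0 bu).
  have bS : bounded_meas C (Sg tau u0).
    split; last by move=> y; exact: (Sg_le mk).
    apply: (measurable_Sg mk) => //.
    exact: (measurableT_comp bu.1 (@measurable_snd _ _ _ _)).
  have bES : bounded_meas C (fun y => expR (- (a * tau)) * Sg tau u0 y).
    have [h1 h2] := bounded_meas2_slice tau (bounded_Eh mk a0 bu); split.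
      by apply: measurable_funM => //; case: bS.
    by move=> y; have := h2 y; rewrite /Eh tau0.
  rewrite -(SgZ mk _ _ t0 bS) -(SgD mk _ t0 bES (bounded_meas2_slice tau (bounded_Dh mk a0 bws))).
  by congr (Sg t _ x); apply/funext => y; rewrite [LHS](sol_eq tau y bu) /Phi /Eh tau0.
(* The intervals of [chi] are open, so splitting loses the point [tau]; it is recorded here and
   later ignored as a null set. *)
have es (s : R) : chi (t + tau) s = chi tau s + chi t (s - tau) + (s == tau)%:R :> R.
  rewrite /chi subr_gt0 ltrBlDr; have [st|ts|->] := ltgtP s tau.
  - by rewrite addr0 andbT (lt_trans st) ?ltrDr// andbT addr0.
  - by rewrite andbF add0r (lt_trans tau0 ts) addr0.
  - by rewrite andbF tau0 ltrDr t0 !add0r.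
set T := t + tau.
pose F (s : mR) := expR (- (a * (T - s))) * Sg (T - s) (wmul (sol u0) s) x.
have tT : tau <= T by rewrite lerDr ltW.
have mF : measurable_fun [set: mR] F by exact: (Dh_integrand_meas mk a T T x bws).
have Fb (s : R) : s < T -> `|F s| <= a * C by move=> sT; exact: (Dh_integrand_le mk (ltW a0) x bws).
have i1 : integ leb (fun s => chi tau s * F s).
  by apply: (@integ_chiM _ tau (a * C)) => // s /andP[_ st]; apply: Fb; exact: lt_le_trans tT.
have mG : measurable_fun [set: mR] (fun s : mR => chi t (s - tau) * F s).
  by apply: measurable_funM => //; apply: measurable_chi => //; exact: measurable_funB.
have i2 : integ leb (fun s => chi t (s - tau) * F s).
  have [ic _] := integ_chi T.
  apply: (@integ_le _ _ _ leb _ _ mG _ (integZl (a * C) ic)).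
  move=> s; rewrite /chi; case: ifPn => [/andP[]|_]; last first.
    rewrite mul0r normr0 mulr_ge0//; last by case: ifP.
    by apply: le_trans (Fb 0 _) => //; rewrite addr_gt0.
  rewrite subr_gt0 ltrBlDr => st sT; rewrite (lt_trans tau0 st) sT mul1r mulr1.
  exact: Fb.
have D1 : Dh a (wmul (sol u0)) T x = \int[leb]_s (chi tau s * F s) + \int[leb]_s (chi t (s - tau) * F s).
  rewrite -RintegralD//; apply: Rint_ae_eq.
  - apply: measurable_funM => //; exact: measurable_chi.
  - by apply: measurable_funD => //; apply: measurable_funM => //; exact: measurable_chi.
  - exists [set tau]; split; [exact: measurable_set1|exact: lebesgue_measure_set1|].
    move=> s /= h; apply: contrapT => st; apply: h.
    by rewrite es -/T (introF eqP st) addr0 mulrDl.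
set I1 := \int[leb]_s (chi tau s * (_ * _)).
have e1 : expR (- (a * T)) * Sg T u0 x = expR (- (a * t)) * (expR (- (a * tau)) * Sg T u0 x).
  by rewrite [RHS]mulrA -expRD; congr (expR _ * _); rewrite /T; ring.
have e2 : \int[leb]_s (chi tau s * F s) = expR (- (a * t)) * I1.
  rewrite -RintegralZl//; last exact: (integ_Dh mk (ltW a0) x tT bws).
  apply: eq_Rintegral => s _; rewrite [RHS]mulrCA; congr (_ * _).
  by rewrite [RHS]mulrA -expRD; congr (expR _ * _); rewrite /T; ring.
have e3 : \int[leb]_s (chi t (s - tau) * F s) = Dh a (wmul v) t x.
  rewrite -(Rint_addr tau mG); apply: eq_Rintegral => s _.
  by rewrite /F addrK /v /T opprD addrACA subrr addr0.
rewrite D1 e1 e2 e3 {e2}; move: I1 (Sg T u0 x) (Dh a _ _ _) => I1 S1 D2.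
by rewrite mulrDr addrA.
Qed.

(** The strict inequality leaves a positive time [t - tau] for [sol_shift] at each step. *)
Lemma sol_decay_pow C u0 tau q0 j t x : bounded_meas C u0 -> 0 < tau -> 0 <= q0 ->
  (forall y, sol (fun=> 1) tau y <= q0) -> j%:R * tau < t -> `|sol u0 t x| <= C * q0 ^+ j.
Proof.
move=> bu tau0 q00 hq; elim: j C u0 t x bu => [|j IH] C u0 t x bu jt.
  by rewrite expr0 mulr1; case: (bounded_sol bu).
have C0 : 0 <= C by have [_ /(_ x)] := bu; apply: le_trans.
have jt' : j%:R * tau < t - tau by move: jt; rewrite -natr1 mulrDl mul1r; lra.
have tt0 : 0 < t - tau by apply: le_lt_trans jt'; rewrite mulr_ge0// ltW.
have bst : bounded_meas (C * q0) (sol u0 tau).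
  split; first by case: (bounded_meas2_slice tau (bounded_sol bu)).
  by move=> y; apply: le_trans (sol_norm_le tau y bu) _; rewrite ler_wpM2l.
rewrite -[t](subrK tau) (sol_shift x bu tau0 tt0) exprS mulrA.
exact: IH.
Qed.

Lemma sol1_le theta tau x : theta < 1 -> 0 < tau -> a * tau = theta ->
  sol (fun=> 1) tau x <=
  1 - (1 - theta) * \int[leb]_s (chi tau s * Sg s (fun y => a - W y) x).
Proof.
move=> theta1 tau0 etau; have b1 := @bounded_cst _ X R 1.
have bs := bounded_sol b1.
have bW : bounded_meas2 a (fun _ y => a - W y).
  split; first by apply: measurable_funB => //; exact: (measurableT_comp mW).
  by move=> s y; rewrite ger0_norm ?subr_ge0// gerBl.
have mg : measurable_fun [set: mR] (fun s => chi tau s * Sg s (fun y => a - W y) x).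
  apply: measurable_funM; first by apply: measurable_chi.
  apply: (measurable_Sg mk (g := fun=> fun y => a - W y)) => //.
  by case: bW.
(* Time reversal s -> tau - s turns the integral of Psi into a Duhamel integral. *)
have -> : \int[leb]_s (chi tau s * Sg s (fun y => a - W y) x) = Dh 0 (fun _ y => a - W y) tau x.
  rewrite -(Rint_subr tau mg); apply: eq_Rintegral => s _.
  rewrite mul0r oppr0 expR0 mul1r; congr (_ * _).
  by rewrite /chi subr_gt0 gtrBl andbC.
rewrite (sol_potential x b1 tau0) (Sg_cst mk)// lerD2l -mulNr.
rewrite -(DhZ mk (lexx 0) _ _ _ bW); apply: ler_Rint.
- have [ms sC] := bs.
  have bWs : bounded_meas2 (a * `|1|) (fun s y => (W y - a) * sol (fun=> 1) s y).
    split; last first.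
      have [_ h] := bW; move=> s y; rewrite normrM; apply: ler_pM => //; rewrite distrC; exact: (h s y).
    by apply: measurable_funM => //; apply: measurable_funB => //; exact: (measurableT_comp mW).
  exact: (integ_Dh mk (lexx 0) x (lexx tau) bWs).
- have bWs : bounded_meas2 (`|- (1 - theta)| * a) (fun s y => - (1 - theta) * (a - W y)).
    have [ms sC] := bW; split; first by apply: measurable_funM.
    by move=> s y; rewrite normrM ler_wpM2l//; exact: (sC s y).
  exact: (integ_Dh mk (lexx 0) x (lexx tau) bWs).
move=> s; rewrite /chi; case: ifPn => [/andP[s0 st]|_]; last by rewrite !mul0r.
rewrite !mul1r mul0r oppr0 expR0 !mul1r.
have [ms sC] := bounded_meas2_slice s bs; have [mWs WC] := bounded_meas2_slice s bW.
apply: (@le_Sg _ _ _ _ _ mk _ _ _ (a * `|1|) (`|- (1 - theta)| * a)).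
- by rewrite subr_gt0.
- split; first by apply: measurable_funM => //; apply: measurable_funB.
  by move=> y; rewrite normrM; apply: ler_pM => //; rewrite distrC; exact: (WC y).
- split; first by apply: measurable_funM.
  by move=> y; rewrite normrM ler_wpM2l//; exact: (WC y).
(* For s < tau: sol >= e^(-as) >= 1 - as >= 1 - theta, while W - a <= 0. *)
- move=> y; have h := sol1_ge y s0; have := expR_ge1Dx (- (a * s)).
  have : a * s <= theta by rewrite -etau ler_pM2l ?ltW//.
  have := Wa y; rewrite -subr_ge0; move: h.
  move: (a * s) (W y) (sol _ _ _) (expR _) => w Wy S E; nra.
Qed.

End damped_solution.

(** * Continuity in time *)

Section stable_markov.
Context {R : realType} {n : nat}.
Variable mu : R.
Hypotheses (mu0 : 0 < mu) (mu1 : mu <= 1).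
Local Notation m := (@lebesgue_rV R n).
Local Notation K := (@stable_kernel R n mu).
Local Notation e_ := (@stable_symbol R mu n).
Local Notation mR := (measurableTypeR R).

Definition stable_conv (t : mR) (x y : 'rV[R]_n) : R := K t (x - y).

Lemma markov_stable_conv : markov_kernel m stable_conv.
Proof.
have mK t x : measurable_fun setT (stable_conv t x).
  by apply: measurable_stable_kernel => //; exact: measurable_rV_sub.
have iK t x : 0 < t -> integ m (stable_conv t x).
  by move=> t0; exact: integ_rV_sub (integ_stable_kernel mu0 mu1 t0).
split => //.
- apply: measurable_stable_kernel; last apply: measurable_rV_sub => //.
  + exact: (measurableT_comp measurable_fst measurable_fst).
  + exact: (measurableT_comp measurable_snd measurable_fst).
- by move=> t x y t0; exact: stable_kernel_ge0.
- move=> t x t0; rewrite -(stable_kernel_mass (n := n) mu0 mu1 t0).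
  exact: Rint_rV_sub (measurable_stable_kernel1 mu t).
- move=> t s x z t0 s0.
  apply: (integMr (C := (2 * pi) ^- n * \int[m]_xi e_ s xi) _ _ (iK t x t0)).
    by apply: measurable_stable_kernel => //; exact: measurable_rV_sub.
  move=> y; rewrite ger0_norm; last exact: stable_kernel_ge0.
  exact: stable_kernel_le.
- by move=> t s x z t0 s0; exact: stable_kernel_conv.
Qed.

(** The L^1 distance of two kernels, which bounds S(s) f - S(t) f uniformly in space for bounded
    f. *)
Definition kernel_dist (s t : R) : R := \int[m]_y `|K s y - K t y|.

Lemma measurable_kernel_dist d (T : measurableType d) (f g : T -> mR) :
  measurable_fun setT f -> measurable_fun setT g ->
  measurable_fun setT (fun z => kernel_dist (f z) (g z)).
Proof.
move=> mf mg.
apply: (@measurable_Rint2 _ _ _ _ _ m (fun z => `|K (f z.1) z.2 - K (g z.1) z.2|)).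
apply: measurableT_comp => //; apply: measurable_funB; apply: measurable_stable_kernel => //.
  exact: (measurableT_comp mf).
exact: (measurableT_comp mg).
Qed.

Lemma kernel_distE s t x :
  \int[m]_y `|stable_conv s x y - stable_conv t x y| = kernel_dist s t.
Proof.
apply: (Rint_rV_sub x (f := fun y => `|K s y - K t y|)).
by apply: measurableT_comp => //; apply: measurable_funB; exact: measurable_stable_kernel1.
Qed.

Lemma kernel_dist_ge0 s t : 0 <= kernel_dist s t.
Proof. by apply: Rintegral_ge0. Qed.

Lemma kernel_dist_le2 s t : 0 < s -> 0 < t -> kernel_dist s t <= 2.
Proof.
move=> s0 t0; have is_ := integ_stable_kernel (n := n) mu0 mu1 s0.
have it_ := integ_stable_kernel (n := n) mu0 mu1 t0.
have -> : 2 = \int[m]_y (K s y + K t y) by rewrite RintegralD// !stable_kernel_mass.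
apply: ler_Rint; [exact: integ_norm (integB is_ it_)|exact: integD|].
move=> y; apply: le_trans (ler_normB _ _) _.
by rewrite !ger0_norm// stable_kernel_ge0.
Qed.

Lemma stable_kernel_cvg (t : R) (t_ : nat -> R) x : 0 < t -> (forall k, t / 2 <= t_ k) ->
  t_ k @[k --> \oo] --> t -> K (t_ k) x @[k --> \oo] --> K t x.
Proof.
move=> t0 t_ge t_t; apply: cvgM; first exact: cvg_cst.
have t20 : 0 < t / 2 by rewrite divr_gt0.
have [|||||_] // := @Rint_dominatedW _ _ _ m (fun k xi => e_ (t_ k) xi * cos (dotp x xi))
  (fun xi => e_ t xi * cos (dotp x xi)) (e_ (t / 2)).
- by move=> k; apply: measurable_funM; [exact: measurable_stable_symbol|exact: measurable_cos_dotp].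
- by apply: measurable_funM; [exact: measurable_stable_symbol|exact: measurable_cos_dotp].
- move=> xi; apply: cvgM; last exact: cvg_cst.
  apply: continuous_cvg; first exact: continuous_expR.
  by apply: cvgN; apply: cvgM => //; exact: cvg_cst.
- exact: integ_stable_symbol.
- move=> k xi; rewrite normrM ger0_norm ?expR_ge0// -[leRHS]mulr1.
  apply: ler_pM; rewrite ?expR_ge0//; last by rewrite ler_norml cos_geN1 cos_le1.
  by rewrite ler_expR lerN2 ler_wpM2r ?powR_ge0.
Qed.

(** Scheffe: pointwise convergence and equal masses. Cutting the times off below at [t / 2] gives
    the domination asked by [stable_kernel_cvg] and changes finitely many terms only. *)
Lemma kernel_dist_cvg (t : R) (t_ : nat -> R) : 0 < t ->
  t_ k @[k --> \oo] --> t -> kernel_dist (t_ k) t @[k --> \oo] --> 0.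
Proof.
move=> t0 t_t; pose s_ k := Num.max (t_ k) (t / 2).
have ts : {near \oo, t_ =1 s_}.
  move/cvgrPdist_lt : (t_t) => /(_ (t / 2)); rewrite divr_gt0// => /(_ isT).
  by apply: filterS => k; rewrite ltr_distlC /s_ => /andP[h _]; rewrite max_l//; lra.
have s_t : s_ k @[k --> \oo] --> t by apply: cvg_trans t_t; exact: near_eq_cvg.
have s_ge k : t / 2 <= s_ k by rewrite le_max lexx orbT.
have s_gt0 k : 0 < s_ k by apply: lt_le_trans (s_ge k); rewrite divr_gt0.
have h : kernel_dist (s_ k) t @[k --> \oo] --> 0.
  apply: scheffe.
  - by move=> k; exact: integ_stable_kernel.
  - exact: integ_stable_kernel.
  - by move=> k x; exact: stable_kernel_ge0.
  - by move=> x; exact: stable_kernel_ge0.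
  - by apply: aeW => x; exact: stable_kernel_cvg.
  - rewrite stable_kernel_mass//; under eq_fun do rewrite stable_kernel_mass//.
    exact: cvg_cst.
apply: cvg_trans h; apply: near_eq_cvg.
by apply: filterS ts => k <-.
Qed.

End stable_markov.

(** * The L^oo norm and bounded representatives *)

Section Linfty_norm.
Context {R : realType} {n : nat}.
Local Notation m := (@lebesgue_rV R n).
Implicit Types f g : Linfty R n.

(** Finiteness is included because [fine] would send an infinite norm to 0. The premise [0 <= D]
    also settles the convention of norm 0 on a null space. *)
Lemma Linfty_normP (h : 'rV[R]_n -> R) (D : R) : 0 <= D ->
  (\forall x \ae m, `|h x| <= D) ->
  'N[m]_+oo[EFin \o h]%E \is a fin_num /\ Linfty_norm h <= D.
Proof.
move=> D0 hD.
have N0 : (0 <= 'N[m]_+oo[EFin \o h])%E by exact: Lnorm_ge0.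
have ND : ('N[m]_+oo[EFin \o h] <= D%:E)%E.
  rewrite unlock; case: ifPn => _; last by rewrite lee_fin.
  by apply/ess_supP; apply: filterS hD => x; rewrite /= lee_fin.
have fN : 'N[m]_+oo[EFin \o h]%E \is a fin_num by rewrite ge0_fin_numE// (le_lt_trans ND)// ltry.
by split => //; rewrite /Linfty_norm -lee_fin fineK.
Qed.

Lemma Linfty_norm_le (h : 'rV[R]_n -> R) (D : R) : 0 <= D ->
  (\forall x \ae m, `|h x| <= D) -> Linfty_norm h <= D.
Proof. by move=> D0 hD; have [] := Linfty_normP D0 hD. Qed.

Lemma Linfty_norm_ge0 (h : 'rV[R]_n -> R) : 0 <= Linfty_norm h.
Proof. by apply: fine_ge0; exact: Lnorm_ge0. Qed.

Lemma Linfty_norm_ae f : \forall x \ae m, `|f x| <= Linfty_norm f.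
Proof.
have fN : 'N[m]_+oo[EFin \o f]%E \is a fin_num.
  by rewrite ge0_fin_numE ?Lnorm_ge0//; exact: Lfunction_finite.
have : ('N[m]_+oo[EFin \o f] <= (Linfty_norm f)%:E)%E by rewrite /Linfty_norm fineK.
rewrite unlock; case: ifPn => [_ /ess_supP|m0 _].
  by apply: filterS => x; rewrite /= lee_fin.
exists setT; split => //; apply/eqP; rewrite eq_le measure_ge0 andbT leNgt.
exact: m0.
Qed.

(** A representative bounded everywhere, as [bounded_meas] demands, changed on a null set only. *)
Definition Linfty_rep f (y : 'rV[R]_n) : R := if `|f y| <= Linfty_norm f then f y else 0.

Lemma bounded_Linfty_rep f : bounded_meas (Linfty_norm f) (Linfty_rep f).
Proof.
split; last by move=> x; rewrite /Linfty_rep; case: ifP => // _; rewrite normr0 Linfty_norm_ge0.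
apply: measurable_fun_ifT => //; apply: measurable_fun_ler => //.
exact: measurableT_comp.
Qed.

Lemma Linfty_rep_ae f : \forall x \ae m, f x = Linfty_rep f x.
Proof. by apply: filterS (Linfty_norm_ae f) => x h; rewrite /Linfty_rep h. Qed.

Lemma bounded_Lfun C (h : 'rV[R]_n -> R) : bounded_meas C h -> h \in Lfun m +oo%E.
Proof.
move=> [mh hC]; have C0 : 0 <= C by apply: le_trans (hC 0).
have hC' : \forall x \ae m, `|h x| <= C by exact: aeW.
have [fN _] := Linfty_normP C0 hC'.
by rewrite inE/=; apply/andP; split; rewrite inE//= /finite_norm ltey_eq fN.
Qed.

Definition Linfty_of C h (bh : bounded_meas C h) : Linfty R n :=
  Lfun_Sub (leey 1) (bounded_Lfun bh).

End Linfty_norm.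

(** * The heat semigroup as a Markov semigroup and its time regularity *)

Section heat_sg.
Context {R : realType} {n : nat}.
Variable mu : R.
Local Notation m := (@lebesgue_rV R n).

Lemma Re_mulC (a : R) (z : R[i]%C) : complex.Re (real_complex R a * z) = a * complex.Re z.
Proof. by case: z => u v /=; rewrite mul0r subr0. Qed.

Lemma heat_integrandE t (x xi : 'rV[R]_n) :
  complex.Re (cexp (complex.Complex (- (t * enorm xi `^ (2 * mu))) (dotp x xi))) =
  stable_symbol mu t xi * cos (dotp x xi).
Proof.
transitivity (expR (- (t * enorm xi `^ (2 * mu))) * cos (dotp x xi)); first by [].
suff -> : enorm xi `^ (2 * mu) = dotp xi xi `^ mu by [].
by rewrite /enorm -powR12_sqrt ?dotp_ge0// -powRrM mulrA mulVf// mul1r.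
Qed.

Lemma heat_kernelE t (x : 'rV[R]_n) : heat_kernel mu t x = stable_kernel mu t x.
Proof.
rewrite /heat_kernel /heat_kernelC /stable_kernel Re_mulC.
apply: (f_equal (fun I => _ * I)).
transitivity (\int[m]_xi complex.Re (cexp (complex.Complex (- (t * enorm xi `^ (2 * mu))) (dotp x xi)))).
  exact: erefl.
by apply: eq_Rintegral => xi _; rewrite heat_integrandE.
Qed.

Lemma heat_sgE t f (x : 'rV[R]_n) : 0 < t -> heat_sg mu t f x = Sg m (stable_conv mu) t f x.
Proof.
move=> t0; rewrite /heat_sg gt_eqF//; apply: eq_Rintegral => y _.
by rewrite heat_kernelE.
Qed.

Hypotheses (mu0 : 0 < mu) (mu1 : mu <= 1).
Local Notation leb := (@lebesgue_measure R).
Local Notation mR := (measurableTypeR R).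
Local Notation k := (@stable_conv R n mu).
Local Notation Sg := (Sg m k).
Local Notation Dh := (Dh m k).
Local Notation kd := (@kernel_dist R n mu).
Let mk : markov_kernel m k := markov_stable_conv mu0 mu1.
Implicit Types (C t s : R) (x : 'rV[R]_n) (f : 'rV[R]_n -> R).

Lemma Sg_dist C f s t x : 0 < s -> 0 < t -> bounded_meas C f ->
  `|Sg s f x - Sg t f x| <= C * kd s t.
Proof.
move=> s0 t0 bf; have [mf fC] := bf.
have iks := mk_integ mk x s0; have ikt := mk_integ mk x t0.
have id1 := integB iks ikt.
rewrite /Sg -RintegralB//; [|exact: (integ_Sg mk _ s0 bf)|exact: (integ_Sg mk _ t0 bf)].
rewrite -(kernel_distE mu s t x) -RintegralZl//; last exact: (integ_norm id1).
apply: norm_Rint_le.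
- apply: integB; [exact: (integ_Sg mk _ s0 bf)|exact: (integ_Sg mk _ t0 bf)].
- exact: (integZl C (integ_norm id1)).
- by move=> y; rewrite -mulrBl normrM mulrC ler_wpM2r.
Qed.

Lemma Sg_ae_eq t f (g : 'rV[R]_n -> R) x : measurable_fun setT f -> measurable_fun setT g ->
  (\forall y \ae m, f y = g y) -> Sg t f x = Sg t g x.
Proof.
move=> mf mg fg; apply: Rint_ae_eq.
- by apply: measurable_funM => //; exact: (measurable_mk1 mk).
- by apply: measurable_funM => //; exact: (measurable_mk1 mk).
- by apply: filterS fg => y ->.
Qed.

Lemma Sg_ae_le t f C x : 0 < t -> measurable_fun setT f -> 0 <= C ->
  (\forall y \ae m, `|f y| <= C) -> `|Sg t f x| <= C.
Proof.
move=> t0 mf C0 fC; pose g y := if `|f y| <= C then f y else 0.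
have bg : bounded_meas C g.
  split; last by move=> y; rewrite /g; case: ifP => // _; rewrite normr0.
  apply: measurable_fun_ifT => //; apply: measurable_fun_ler => //.
  exact: measurableT_comp.
rewrite (@Sg_ae_eq _ _ g)//; first exact: (Sg_le mk).
  by case: bg.
by apply: filterS fC => y h; rewrite /g h.
Qed.

Lemma SgB_ae t f g C C' x : 0 < t -> bounded_meas C f -> bounded_meas C' g ->
  Sg t (fun y => f y - g y) x = Sg t f x - Sg t g x.
Proof.
move=> t0 bf bg; rewrite /Sg -RintegralB//; [|exact: integ_Sg bf|exact: integ_Sg bg].
by apply: eq_Rintegral => y _; rewrite mulrBr.
Qed.

(* The times s < min(t', t) contribute kd (t' - s) (t - s); DCT in s. *)
Lemma Dh0_equicontinuous M (g : mR -> 'rV[R]_n -> R) t (t_ : nat -> R) : 0 < t ->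
  bounded_meas2 M g -> t_ j @[j --> \oo] --> t ->
  exists2 e : nat -> R, e j @[j --> \oo] --> 0 &
    forall j x, 0 < t_ j -> `|Dh 0 g (t_ j) x - Dh 0 g t x| <= M * e j.
Proof.
move=> t0 bg t_t; have [mg gM] := bg.
have M0 : 0 <= M by apply: le_trans (gM 0 0).
(* The last term accounts for the times lying in only one of the two intervals, where the single
   remaining integrand is at most [M]. *)
pose h (r : R) (s : R) := chi r s * chi t s * kd (r - s) (t - s) + `|chi r s - chi t s|.
have mh r : measurable_fun [set: mR] (h r).
  apply: measurable_funD.
    apply: measurable_funM; first by apply: measurable_funM; apply: measurable_chi.
    by apply: measurable_kernel_dist; apply: measurable_funB.
  by apply: measurableT_comp => //; apply: measurable_funB; apply: measurable_chi.
have h_le r b s : r <= b -> `|h r s| <= 2 * (chi b s + chi t s).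
  move=> rb; have crb : chi r s <= chi b s.
    rewrite /chi; case: ifPn => [/andP[s0 sr]|_]; last by case: ifP.
    by rewrite s0 (lt_le_trans sr rb).
  have := chi_ge0 b s; rewrite ger0_norm; last first.
    by rewrite addr_ge0// mulr_ge0 ?kernel_dist_ge0// mulr_ge0// chi_ge0.
  move: crb; rewrite /h [chi r s]/chi [chi t s]/chi.
  case: ifPn => [/andP[s0 sr]|_]; case: ifPn => [/andP[_ st]|_].
  - rewrite !mul1r subrr normr0.
    have : kd (r - s) (t - s) <= 2 by apply: kernel_dist_le2; rewrite ?subr_gt0.
    lra.
  - by rewrite mul1r mul0r subr0 normr1; lra.
  - by rewrite !mul0r sub0r normrN normr1; lra.
  - by rewrite !mul0r subr0 normr0; lra.
have i2 b : integ leb (fun s => 2 * (chi b s + chi t s)).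
  have [i3 _] := integ_chi b; have [i4 _] := integ_chi t.
  exact: (integZl 2 (integD i3 i4)).
have ih r : integ leb (h r).
  apply: (@integ_le _ _ _ leb _ _ (mh r) _ (i2 r)).
  by move=> s; exact: h_le.
exists (fun j => \int[leb]_s h (t_ j) s).
  (* A convergent sequence is bounded, so one interval []0, B[] serves in the domination of all
     terms. *)
  have [B tB] : exists B, forall j, t_ j <= B.
    have ct : cvgn t_ by apply/cvg_ex; exists t.
    have [B [_ hB]] := cvg_seq_bounded ct.
    exists (B + 1) => j; apply: le_trans (ler_norm _) _.
    by apply: (hB (B + 1) _ j) => //; rewrite ltrDl.
  have h0 : \forall s \ae leb, h (t_ j) s @[j --> \oo] --> (fun=> 0 : R) s.
    exists [set t]; split; [exact: measurable_set1|exact: lebesgue_measure_set1|].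
    move=> s /= hs; apply: contrapT => /eqP st; apply: hs.
    have [s0|s0] := leP s 0.
      have e0 r : h r s = 0 by rewrite /h /chi ltNge s0 /= subrr normr0 !mul0r addr0.
      by under eq_fun do rewrite e0; exact: cvg_cst.
    have [lt_st|lt_ts|/eqP] := ltgtP s t; last by rewrite (negbTE st).
      have t_s : t_ j - s @[j --> \oo] --> t - s by apply: cvgB => //; exact: cvg_cst.
      have ts0 : 0 < t - s by rewrite subr_gt0.
      apply: cvg_trans (kernel_dist_cvg mu0 mu1 ts0 t_s); apply: near_eq_cvg.
      near=> j; have sj : s < t_ j by near: j; exact: (cvgr_gt _ t_t _ lt_st).
      by rewrite /h /chi s0 sj lt_st /= subrr normr0 !mul1r addr0.
    apply: cvg_near_cst.
    near=> j; have sj : t_ j < s by near: j; exact: (cvgr_lt _ t_t _ lt_ts).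
    by rewrite /h /chi s0 /= !ltNge (ltW sj) (ltW lt_ts) /= subrr normr0 !mul0r addr0.
  have m0 : measurable_fun [set: mR] (fun=> 0 : R) by [].
  have hB j (s : R) : `|h (t_ j) s| <= 2 * (chi B s + chi t s) by exact: h_le.
  have [_] := @Rint_dominated _ _ _ leb _ _ _ (fun j => mh (t_ j)) m0 h0 (i2 B) hB.
  by rewrite Rintegral_cst// mul0r.
move=> j x tj0; rewrite -(RintegralZl _ measurableT (ih _)).
have i1 := integ_Dh mk (lexx 0) x (lexx (t_ j)) bg; have i3 := integ_Dh mk (lexx 0) x (lexx t) bg.
have -> : Dh 0 g (t_ j) x - Dh 0 g t x = \int[leb]_s (
    chi (t_ j) s * (expR (- (0 * (t_ j - s))) * Sg (t_ j - s) (g s) x) -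
    chi t s * (expR (- (0 * (t - s))) * Sg (t - s) (g s) x)).
  by rewrite (RintegralB measurableT i1 i3).
apply: (norm_Rint_le (integB i1 i3) (integZl M (ih _))).
move=> s; have e0 r : expR (- (0 * r)) = 1 :> R by rewrite mul0r oppr0 expR0.
have S1 r : s < r -> `|Sg (r - s) (g s) x| <= M.
  by move=> sr; apply: (Sg_le mk); [rewrite subr_gt0|exact: bounded_meas2_slice bg].
have S2 : s < t_ j -> s < t -> `|Sg (t_ j - s) (g s) x - Sg (t - s) (g s) x| <= M * kd (t_ j - s) (t - s).
  by move=> st1 st2; apply: (Sg_dist x _ _ (bounded_meas2_slice s bg)); rewrite subr_gt0.
move: (S1 (t_ j)) (S1 t) S2; rewrite (e0 (t_ j - s)) (e0 (t - s)) /h.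
move: (Sg (t_ j - s) (g s) x) (Sg (t - s) (g s) x) (kd (t_ j - s) (t - s)) => A D r A1 D1 AD.
rewrite /chi; case: ifPn => [/andP[s0 st]|_]; case: ifPn => [/andP[s1 st1]|_].
- by rewrite !mul1r subrr normr0 addr0; exact: AD.
- by rewrite mul0r subr0 !mul1r mul0r add0r subr0 normr1 mulr1; exact: A1.
- by rewrite !mul0r !mul1r !sub0r add0r !normrN normr1 mulr1; exact: D1.
- by rewrite !mul0r subrr normr0 add0r mulr0.
Unshelve. all: by end_near. Qed.

End heat_sg.

(** * Mild solutions *)

Section potential_representative.
Context {R : realType} {n : nat}.
Variable mu : R.
Hypotheses (mu0 : 0 < mu) (mu1 : mu <= 1).
Local Notation m := (@lebesgue_rV R n).
Local Notation leb := (@lebesgue_measure R).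
Local Notation mR := (measurableTypeR R).
Local Notation k := (@stable_conv R n mu).
Local Notation Sg := (Sg m k).
Local Notation Dh := (Dh m k).
Local Notation kd := (@kernel_dist R n mu).
Let mk : markov_kernel m k := markov_stable_conv mu0 mu1.
Variable V : Linfty R n.
Local Notation a := (Linfty_norm V).
Hypotheses (a0 : 0 < a) (Vle0 : \forall x \ae m, V x <= 0).
Implicit Types (C t s : R) (x : 'rV[R]_n) (f : 'rV[R]_n -> R).

(** Values outside [-a, 0] occur on a null set; replacing them makes [damp] lie in [0, a]
    everywhere. *)
Definition Vrep (y : 'rV[R]_n) : R := if (- a <= V y) && (V y <= 0) then V y else 0.

Lemma Vrep_ae : \forall y \ae m, V y = Vrep y.
Proof.
move: Vle0 (Linfty_norm_ae V); apply: filterS2 => y y0.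
by rewrite ler_norml /Vrep y0 andbT => /andP[->].
Qed.

Lemma measurable_Vrep : measurable_fun setT Vrep.
Proof.
apply: measurable_fun_ifT => //; apply: measurable_and; exact: measurable_fun_ler.
Qed.

Lemma Vrep_le0 y : Vrep y <= 0.
Proof. by rewrite /Vrep; case: ifP => // /andP[]. Qed.

Lemma Vrep_ge y : - a <= Vrep y.
Proof. by rewrite /Vrep; case: ifP => [/andP[]//|_]; rewrite oppr_le0 ltW. Qed.

Lemma bounded_Vrep : bounded_meas a Vrep.
Proof.
split; first exact: measurable_Vrep.
by move=> y; rewrite ler_norml Vrep_ge (le_trans (Vrep_le0 y))// ltW.
Qed.

Definition damp (y : 'rV[R]_n) : R := Vrep y + a.

Lemma measurable_damp : measurable_fun setT damp.
Proof. by apply: measurable_funD => //; exact: measurable_Vrep. Qed.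

Lemma damp_ge0 y : 0 <= damp y.
Proof. by have := Vrep_ge y; rewrite /damp; lra. Qed.

Lemma damp_le y : damp y <= a.
Proof. by have := Vrep_le0 y; rewrite /damp; lra. Qed.

Lemma bounded_Vmul C f : bounded_meas C f -> bounded_meas (a * C) (fun y => Vrep y * f y).
Proof.
move=> [mf fC]; have [mV Va] := bounded_Vrep; split; first exact: measurable_funM.
by move=> y; rewrite normrM ler_pM.
Qed.

Definition Vpart (u : R -> Linfty R n) t x s : R :=
  Sg (t - s) (fun y => Vrep y * Linfty_rep (u s) y) x.

Lemma VpartB (u w : Linfty R n) r x (B : R) : 0 < r -> 0 <= B ->
  (\forall y \ae m, `|u y - w y| <= B) ->
  `|Sg r (fun y => Vrep y * Linfty_rep u y) x - Sg r (fun y => Vrep y * Linfty_rep w y) x| <= a * B.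
Proof.
move=> r0 B0 uw; have bu := bounded_Vmul (bounded_Linfty_rep u).
have bw := bounded_Vmul (bounded_Linfty_rep w).
rewrite -(SgB_ae mu0 mu1 x r0 bu bw); apply: Sg_ae_le => //.
- by apply: measurable_funB; [case: bu|case: bw].
- by rewrite mulr_ge0// ltW.
- move: (Linfty_rep_ae u) (Linfty_rep_ae w) uw; apply: filterS3 => y <- <- h.
  by rewrite -mulrBr normrM ler_pM//; case: bounded_Vrep => _; exact.
Qed.

Lemma Vpart_le (u : R -> Linfty R n) t x s M : s < t -> Linfty_norm (u s) <= M ->
  `|Vpart u t x s| <= a * M.
Proof.
move=> st uM; have ts : 0 < t - s by rewrite subr_gt0.
apply: le_trans (Sg_le mk x ts (bounded_Vmul (bounded_Linfty_rep (u s)))) _.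
by rewrite ler_wpM2l// ltW.
Qed.

(** No joint measurability of [u] is available, so measurability of the Duhamel integrand in [s]
    comes from this continuity. The increment splits into a change of [u] and a change of kernel. *)
Lemma Vpart_cvg (u : R -> Linfty R n) t x s (s_ : nat -> R) M : 0 < s < t ->
  (forall r, 0 < r <= t -> Linfty_norm (u r) <= M) ->
  (forall r, 0 < r -> Linfty_norm (u q - u r) @[q --> r] --> 0) ->
  s_ j @[j --> \oo] --> s -> Vpart u t x (s_ j) @[j --> \oo] --> Vpart u t x s.
Proof.
move=> /andP[s0 st] uM uc s_s; have ts : 0 < t - s by rewrite subr_gt0.
have M0 : 0 <= M by apply: le_trans (Linfty_norm_ge0 (u s)) _; rewrite uM// s0 ltW.
have c1 : Linfty_norm (u (s_ j) - u s) @[j --> \oo] --> 0.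
  exact: (cvg_comp _ _ s_s (uc s s0)).
have ts_ : t - s_ j @[j --> \oo] --> t - s by apply: cvgB => //; exact: cvg_cst.
have c2 := kernel_dist_cvg (n := n) mu0 mu1 ts ts_.
have c3 : a * Linfty_norm (u (s_ j) - u s) + a * M * kd (t - s_ j) (t - s) @[j --> \oo] --> (0 : R).
  rewrite -[X in _ --> X]addr0 -[X in _ --> X + _](mulr0 a) -[X in _ --> _ + X](mulr0 (a * M)).
  by apply: cvgD; apply: cvgM => //; exact: cvg_cst.
apply/cvgrPdist_le => e e0.
near=> j.
have sjt : s_ j < t by near: j; exact: (cvgr_lt _ s_s _ st).
have sj0 : 0 < s_ j by near: j; exact: (cvgr_gt _ s_s _ s0).
have : a * Linfty_norm (u (s_ j) - u s) + a * M * kd (t - s_ j) (t - s) < e.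
  by near: j; exact: (cvgr_lt _ c3 _ e0).
move=> /ltW; apply: le_trans; rewrite distrC.
have tsj : 0 < t - s_ j by rewrite subr_gt0.
have e1 := VpartB x tsj (Linfty_norm_ge0 _) (Linfty_norm_ae (u (s_ j) - u s)).
have bs := bounded_Vmul (bounded_Linfty_rep (u s)).
have e2 := Sg_dist mu0 mu1 x tsj ts bs.
have e3 : a * Linfty_norm (u s) * kd (t - s_ j) (t - s) <= a * M * kd (t - s_ j) (t - s).
  apply: ler_wpM2r; first exact: kernel_dist_ge0.
  by rewrite ler_pM2l//; apply: uM; rewrite s0 ltW.
apply: le_trans (ler_distD (Sg (t - s_ j) (fun y => Vrep y * Linfty_rep (u s) y) x) _ _) _.
apply: lerD; first exact: e1.
exact: le_trans e2 e3.
Unshelve. all: by end_near. Qed.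

End potential_representative.

(** * Uniqueness of mild solutions *)

Section mild_uniqueness.
Context {R : realType} {n : nat}.
Variable mu : R.
Hypotheses (mu0 : 0 < mu) (mu1 : mu <= 1).
Local Notation m := (@lebesgue_rV R n).
Local Notation leb := (@lebesgue_measure R).
Local Notation mR := (measurableTypeR R).
Local Notation k := (@stable_conv R n mu).
Local Notation Sg := (Sg m k).
Local Notation Dh := (Dh m k).
Local Notation kd := (@kernel_dist R n mu).
Let mk : markov_kernel m k := markov_stable_conv mu0 mu1.
Variable V : Linfty R n.
Local Notation a := (Linfty_norm V).
Hypotheses (a0 : 0 < a) (Vle0 : \forall x \ae m, V x <= 0).
Implicit Types (C t s : R) (x : 'rV[R]_n) (f : 'rV[R]_n -> R).
Local Notation Vrep := (Vrep V).
Local Notation Vpart := (Vpart mu V).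
Local Notation damp := (damp V).

Lemma measurable_Vpart (u : R -> Linfty R n) t x M :
  (forall r, 0 < r <= t -> Linfty_norm (u r) <= M) ->
  (forall r, 0 < r -> Linfty_norm (u q - u r) @[q --> r] --> 0) ->
  measurable_fun [set: mR] (fun s : mR => chi t s * Vpart u t x s).
Proof.
move=> uM uc; pose D : set R := `]0, t[%classic.
have mD : measurable (D : set mR) by exact: measurable_itv.
have -> : (fun s : mR => chi t s * Vpart u t x s) = (Vpart u t x) \_ D.
  apply/funext => s; rewrite patchE chiE indicE.
  by case: (s \in _); rewrite ?mul1r ?mul0r.
apply/(measurable_restrictT _ mD).
apply: open_continuous_measurable_fun; first exact: interval_open.
move=> s /set_mem; rewrite /D /= in_itv/= => st.
apply/(@cvg_nbhsP _ R^o) => s_ s_s.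
by apply: (Vpart_cvg mu0 mu1 a0 (x := x) st uM uc); exact: s_s.
Qed.

Lemma integ_Vpart (u : R -> Linfty R n) t x M :
  (forall r, 0 < r <= t -> Linfty_norm (u r) <= M) ->
  (forall r, 0 < r -> Linfty_norm (u q - u r) @[q --> r] --> 0) ->
  integ leb (fun s => chi t s * Vpart u t x s).
Proof.
move=> uM uc; have [ic _] := integ_chi t.
apply: (@integ_le _ _ _ leb _ _ (measurable_Vpart x uM uc) _ (integZl (a * M) ic)).
apply: chi_mul_le => s /andP[s0 st].
by apply: (Vpart_le mu0 mu1 a0 x st); apply: uM; rewrite s0 ltW.
Qed.

Lemma heat_sg_rep u0 t x : 0 < t -> heat_sg mu t (u0 : Linfty R n) x = Sg t (Linfty_rep u0) x.
Proof.
move=> t0; rewrite (heat_sgE mu u0 x t0).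
apply: (Sg_ae_eq mu0 mu1) => //; last exact: Linfty_rep_ae.
by case: (bounded_Linfty_rep u0).
Qed.

Lemma heat_sg_Vmul (w : Linfty R n) t x : 0 < t ->
  heat_sg mu t (V \* w) x = Sg t (fun y => Vrep y * Linfty_rep w y) x.
Proof.
move=> t0; rewrite (heat_sgE mu _ x t0).
apply: (Sg_ae_eq mu0 mu1) => //.
- by case: (bounded_Vmul a0 (bounded_Linfty_rep w)).
- by move: (Vrep_ae Vle0) (Linfty_rep_ae w); apply: filterS2 => y /= -> ->.
Qed.

Lemma mild_solutionE (u0 : Linfty R n) (u : R -> Linfty R n) t x : 0 < t ->
  heat_sg mu t u0 x + \int[leb]_(s in `]0, t[) heat_sg mu (t - s) (V \* u s) x =
  Sg t (Linfty_rep u0) x + \int[leb]_s (chi t s * Vpart u t x s).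
Proof.
move=> t0; rewrite heat_sg_rep// Rint_itv_chi; congr (_ + _).
apply: eq_Rintegral => s _; rewrite /chi; case: ifPn => [/andP[_ st]|_].
  by rewrite heat_sg_Vmul ?subr_gt0.
by rewrite !mul0r.
Qed.

(* Measuring the difference against e^(2at) makes the Volterra operator a
   contraction of ratio 1/2. *)
Lemma mild_diff (u0 : Linfty R n) (u w : R -> Linfty R n) T :
  mild_solution mu V u0 u -> mild_solution mu V u0 w -> 0 < T ->
  exists2 B, 0 <= B & forall j t, 0 < t <= T ->
    \forall x \ae m, `|u t x - w t x| <= B * (2^-1 ^+ j * expR (2 * a * t)).
Proof.
move=> [uc ub ue] [wc wb we] T0.
have [Mu uM] := ub T T0; have [Mw wM] := wb T T0.
have Mu0 : 0 <= Mu by apply: le_trans (Linfty_norm_ge0 (u T)) _; rewrite uM// T0 lexx.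
have Mw0 : 0 <= Mw by apply: le_trans (Linfty_norm_ge0 (w T)) _; rewrite wM// T0 lexx.
have B0 : 0 <= Mu + Mw by rewrite addr_ge0.
exists (Mu + Mw) => //; elim=> [|j IH] t /andP[t0 tT].
  rewrite expr0 mul1r.
  move: (Linfty_norm_ae (u t)) (Linfty_norm_ae (w t)); apply: filterS2 => x h1 h2.
  apply: le_trans (ler_normB _ _) _.
  apply: (@le_trans _ _ (Mu + Mw)).
    by apply: lerD; [apply: le_trans h1 _; apply: uM|apply: le_trans h2 _; apply: wM]; rewrite t0.
  by rewrite ler_peMr// -[leLHS]expR0 ler_expR !mulr_ge0// ltW.
have uMt r : 0 < r <= t -> Linfty_norm (u r) <= Mu.
  by move=> /andP[r0 rt]; apply: uM; rewrite r0 (le_trans rt).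
have wMt r : 0 < r <= t -> Linfty_norm (w r) <= Mw.
  by move=> /andP[r0 rt]; apply: wM; rewrite r0 (le_trans rt).
move: (ue t t0) (we t t0); apply: filterS2 => x.
rewrite (mild_solutionE _ _ _ t0) (mild_solutionE _ _ _ t0) => -> ->.
have iu := integ_Vpart x uMt uc; have iw := integ_Vpart x wMt wc.
rewrite opprD addrACA subrr add0r -(RintegralB measurableT iu iw).
pose c := (Mu + Mw) * 2^-1 ^+ j * expR (2 * a * t) * a.
have a20 : 0 < 2 * a by rewrite mulr_gt0.
have me : measurable_fun [set: mR] (fun s : mR => expR (- (2 * a * (t - s)))) by exact: measurable_expRN_sub.
have ie : integ leb (fun s => chi t s * expR (- (2 * a * (t - s)))).
  apply: (@integ_chiM _ t 1 _ me) => s /andP[_ st].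
  by rewrite ger0_norm ?expR_ge0// -[leRHS]expR0 ler_expR oppr_le0 mulr_ge0// ?subr_ge0 ltW.
have key s : `|chi t s * Vpart u t x s - chi t s * Vpart w t x s| <=
    c * (chi t s * expR (- (2 * a * (t - s)))).
  rewrite /chi; case: ifPn => [/andP[s0 st]|_]; last by rewrite !mul0r subrr normr0 mulr0.
  rewrite !mul1r.
  have sT : 0 < s <= T by rewrite s0 (le_trans (ltW st)).
  have ts : 0 < t - s by rewrite subr_gt0.
  have Bj0 : 0 <= (Mu + Mw) * (2^-1 ^+ j * expR (2 * a * s)).
    by rewrite mulr_ge0// mulr_ge0 ?expR_ge0// exprn_ge0.
  apply: le_trans (VpartB mu0 mu1 a0 x ts Bj0 (IH s sT)) _.
  rewrite /c le_eqVlt; apply/orP; left; apply/eqP.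
  have -> : expR (2 * a * s) = expR (2 * a * t) * expR (- (2 * a * (t - s))).
    by rewrite -expRD; congr expR; ring.
  ring.
apply: le_trans (norm_Rint_le (integB iu iw) (integZl c ie) key) _.
rewrite (RintegralZl _ measurableT ie) Rint_chi_exp//.
have c0 : 0 <= c / (2 * a).
  apply: divr_ge0; last exact: ltW.
  apply: mulr_ge0; last exact: ltW.
  apply: mulr_ge0; last exact: expR_ge0.
  by apply: mulr_ge0 => //; apply: exprn_ge0.
(* The bound [a] on the potential, inside [c], meets the integral of e^(-2a(t-s)), at most 1/(2a):
   this is the gained factor 1/2. *)
have -> : (Mu + Mw) * (2^-1 ^+ j.+1 * expR (2 * a * t)) = c / (2 * a).
  by rewrite /c exprS; field; rewrite gt_eqF.
rewrite mulrCA mulrC ler_piMr// gerBl expR_ge0//.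
Qed.

End mild_uniqueness.

(** * Existence of mild solutions and transfer of bounds *)

Section mild_existence.
Context {R : realType} {n : nat}.
Variable mu : R.
Hypotheses (mu0 : 0 < mu) (mu1 : mu <= 1).
Local Notation m := (@lebesgue_rV R n).
Local Notation leb := (@lebesgue_measure R).
Local Notation mR := (measurableTypeR R).
Local Notation k := (@stable_conv R n mu).
Local Notation Sg := (Sg m k).
Local Notation Dh := (Dh m k).
Local Notation kd := (@kernel_dist R n mu).
Let mk : markov_kernel m k := markov_stable_conv mu0 mu1.
Variable V : Linfty R n.
Local Notation a := (Linfty_norm V).
Hypotheses (a0 : 0 < a) (Vle0 : \forall x \ae m, V x <= 0).
Implicit Types (C t s : R) (x : 'rV[R]_n) (f : 'rV[R]_n -> R).
Local Notation Vrep := (Vrep V).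
Local Notation Vpart := (Vpart mu V).
Local Notation damp := (damp V).

Variable u0 : Linfty R n.
Local Notation u0r := (Linfty_rep u0).
Local Notation v := (sol m k a damp u0r).

Let bounded_v : bounded_meas2 (Linfty_norm u0) v.
Proof.
apply: (bounded_sol mk a0 (measurable_damp V)).
- exact: damp_ge0 a0.
- exact: damp_le.
- exact: bounded_Linfty_rep.
Qed.

Definition damped_sol (t : R) : Linfty R n := Linfty_of (bounded_meas2_slice t bounded_v).

Let bounded_Vv : bounded_meas2 (a * Linfty_norm u0) (fun s y => Vrep y * v s y).
Proof.
have [mv vC] := bounded_v; have [mV Va] := bounded_Vrep a0; split.
  by apply: measurable_funM => //; exact: (measurableT_comp mV).
by move=> s y; rewrite normrM ler_pM.
Qed.

Lemma damped_solE t x : 0 < t ->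
  v t x = Sg t u0r x + Dh 0 (fun s y => Vrep y * v s y) t x.
Proof.
move=> t0; have br := bounded_Linfty_rep u0.
rewrite (sol_potential mk a0 (measurable_damp V) (damp_ge0 a0) (@damp_le _ _ V) x br t0).
congr (_ + Dh 0 _ t x); apply/funext => s; apply/funext => y.
by rewrite /damp addrK.
Qed.

(** Continuity in time is uniform in space: [kernel_dist] controls the free part,
    [Dh0_equicontinuous] the Duhamel part. The equation holds at every point; only the
    representatives inside it are compared almost everywhere. *)
Lemma mild_damped_sol : mild_solution mu V u0 damped_sol.
Proof.
have [mv vC] := bounded_v; split.
- move=> t t0; apply: (@cvg_nbhsP _ R^o _ _ _).2 => t_ t_t.
  have [e e0 he] := Dh0_equicontinuous mu0 mu1 t0 bounded_Vv t_t.
  have br := bounded_Linfty_rep u0.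
  have c2 := kernel_dist_cvg (n := n) mu0 mu1 t0 t_t.
  have c3 : Linfty_norm u0 * kd (t_ j) t + a * Linfty_norm u0 * e j @[j --> \oo] --> (0 : R).
    rewrite -[X in _ --> X]addr0 -[X in _ --> X + _](mulr0 (Linfty_norm u0)).
    rewrite -[X in _ --> _ + X](mulr0 (a * Linfty_norm u0)).
    by apply: cvgD; apply: cvgM => //; exact: cvg_cst.
  apply: (squeeze_cvgr _ (cvg_cst 0) c3); near=> j.
  have tj0 : 0 < t_ j by near: j; exact: (cvgr_gt _ t_t _ t0).
  rewrite Linfty_norm_ge0 /=.
  have h x : `|v (t_ j) x - v t x| <= Linfty_norm u0 * kd (t_ j) t + a * Linfty_norm u0 * e j.
    rewrite damped_solE// damped_solE// opprD addrACA.
    apply: le_trans (ler_normD _ _) _; apply: lerD; last exact: he.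
    exact: Sg_dist.
  apply: Linfty_norm_le; first by apply: le_trans (h 0).
  by apply: aeW => x; exact: h.
- move=> T T0; exists (Linfty_norm u0) => t _.
  by apply: Linfty_norm_le; [exact: Linfty_norm_ge0|apply: aeW => x; exact: vC].
- move=> t t0; apply: aeW => x.
  rewrite (mild_solutionE mu0 mu1 a0 Vle0 u0 damped_sol x t0).
  transitivity (Sg t u0r x + Dh 0 (fun s y => Vrep y * v s y) t x); first exact: damped_solE.
  congr (_ + _); apply: eq_Rintegral => s _.
  rewrite mul0r oppr0 expR0 mul1r; congr (_ * _).
  have bs := bounded_meas2_slice s bounded_Vv.
  have br := bounded_Vmul a0 (bounded_Linfty_rep (damped_sol s)).
  apply: (Sg_ae_eq mu0 mu1); [by case: bs|by case: br|].
  by apply: filterS (Linfty_rep_ae (damped_sol s)) => y <-.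
Unshelve. all: by end_near. Qed.

(** [xget] returns an unknown mild solution, which [mild_diff] compares with [damped_sol] at time
    [t]. The limit in [j] is taken on norms, so the exceptional null sets may depend on [j]. *)
Lemma perturbed_sg_le t (D : R) : 0 < t -> (forall x, `|v t x| <= D) ->
  Linfty_norm (perturbed_sg mu V t u0) <= D.
Proof.
move=> t0 vD; rewrite /perturbed_sg gt_eqF//.
set u := xget _ _.
have mu_u : mild_solution mu V u0 u.
  by apply: (@xgetPex _ (fun=> u0) [set u | mild_solution mu V u0 u]); exists damped_sol; exact: mild_damped_sol.
have [B B0 hB] := mild_diff mu0 mu1 a0 Vle0 mu_u mild_damped_sol t0.
have D0 : 0 <= D by apply: le_trans (vD 0).
have hj j : Linfty_norm (u t) <= D + B * (2^-1 ^+ j * expR (2 * a * t)).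
  apply: Linfty_norm_le.
    by rewrite addr_ge0// mulr_ge0// mulr_ge0 ?expR_ge0// exprn_ge0.
  have htt : 0 < t <= t by rewrite t0 lexx.
  apply: filterS (hB j t htt) => x h.
  rewrite -[u t x](subrK (damped_sol t x)) addrC.
  by apply: le_trans (ler_normD _ _) _; apply: lerD => //; exact: vD.
have c : D + B * (2^-1 ^+ j * expR (2 * a * t)) @[j --> \oo] --> D.
  have e : D = D + B * (0 * expR (2 * a * t)) by rewrite mul0r mulr0 addr0.
  rewrite [X in _ --> X]e.
  apply: cvgD; first exact: cvg_cst.
  apply: cvgM; first exact: cvg_cst.
  by apply: cvgM; [apply: cvg_expr; rewrite ger0_norm// invf_lt1//; lra|exact: cvg_cst].
apply: (ler_cvg_to (cvg_cst (Linfty_norm (u t))) c).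
by apply: nearW => j; exact: hj.
Qed.

End mild_existence.

(** * The Arendt-Batty condition *)

Section arendt_batty_ball.
Context {R : realType} {n : nat}.
Local Notation m := (@lebesgue_rV R n).
Implicit Types (x y : 'rV[R]_n).

Lemma continuous_sqdotp_sub x : continuous (fun y => dotp (y - x) (y - x)).
Proof.
have cs (s : seq 'I_n) : continuous (fun y => \sum_(i <- s) (y - x) ord0 i * (y - x) ord0 i).
  elim: s => [|i s IH] y.
    rewrite (_ : (fun y => _) = cst 0); first exact: cst_continuous.
    by apply/funext => z; rewrite big_nil.
  rewrite (_ : (fun y => _) = (fun y => (y - x) ord0 i * (y - x) ord0 i +
    \sum_(i <- s) (y - x) ord0 i * (y - x) ord0 i)); last by apply/funext => z; rewrite big_cons.
  have ci : {for y, continuous (fun y : 'rV[R]_n => (y - x) ord0 i)}.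
    rewrite (_ : (fun y : 'rV[R]_n => (y - x) ord0 i) = (fun y : 'rV[R]_n => y ord0 i - x ord0 i)).
      exact: (@continuousB _ _ _ (fun y : 'rV[R]_n => y ord0 i) (cst (x ord0 i)) y (@coord_continuous R 1 n ord0 i y) (@cst_continuous _ _ _ y)).
    by apply/funext => z; rewrite !mxE.
  exact: (@continuousD _ _ _ (fun y : 'rV[R]_n => (y - x) ord0 i * (y - x) ord0 i) _ y (continuousM ci ci) (IH y)).
exact: cs.
Qed.

Lemma eballE x r : 0 < r -> eball x r = [set y | dotp (y - x) (y - x) < r ^+ 2].
Proof.
move=> r0; apply/funext => y; rewrite /eball /enorm /=; apply/propext.
rewrite -(@ltr_pXn2r _ 2) ?nnegrE ?sqrtr_ge0// ?ltW//.
by rewrite sqr_sqrtr ?dotp_ge0.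
Qed.

Lemma open_eball x r : 0 < r -> open (eball x r).
Proof.
move=> r0; rewrite eballE//.
apply: (open_comp (f := fun y => dotp (y - x) (y - x)) (D := [set z : R | z < r ^+ 2])).
  by move=> y _; exact: continuous_sqdotp_sub.
exact: open_lt.
Qed.

Lemma measurable_eball x r : 0 < r -> measurable (eball x r).
Proof.
move=> r0; rewrite eballE//.
have mf : measurable_fun setT (fun y : 'rV[R]_n => dotp (y - x) (y - x)).
  by apply: measurable_dotp; apply: measurable_rV_sub.
rewrite -[X in measurable X]setTI.
rewrite (_ : [set y | _] = (fun y : 'rV[R]_n => dotp (y - x) (y - x)) @^-1` `]-oo, r ^+ 2[).
  exact: mf.
by apply/seteqP; split=> y /=; rewrite in_itv/=.
Qed.

(** If the norm were 0, the integral of V over the whole space would be 0 and not -oo. *)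
Lemma arendt_batty_norm_gt0 (V : Linfty R n) : arendt_batty V -> 0 < Linfty_norm V.
Proof.
move=> ab; rewrite lt_neqAle Linfty_norm_ge0 andbT eq_sym; apply/negP => /eqP V0.
have : large_open [set: 'rV[R]_n] by split; [exact: openT|move=> r _; exists 0].
move=> /ab; rewrite (@ae_eq_integral _ _ _ _ _ (cst 0%E))//.
- by rewrite integral0.
- exact/measurable_EFinP.
- apply: filterS (Linfty_norm_ae V) => x; rewrite V0 normr_le0 => /eqP Vx _.
  by rewrite Vx.
Qed.

(** The union of balls built here is measurable as well as open, so the hypothesis is asked of
    measurable sets only, on which V may be exchanged for [Vrep]. *)
Lemma arendt_batty_ball (f : 'rV[R]_n -> R) : measurable_fun setT f ->
  (forall y, 0 <= f y) ->
  (forall G, large_open G -> measurable G -> (\int[m]_(y in G) (- f y)%:E = -oo)%E) ->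
  exists2 r : R, 0 < r & exists2 delta : R, 0 < delta &
    forall x, (delta%:E <= \int[m]_(y in eball x r) (f y)%:E)%E.
Proof.
move=> mf f0 ab; apply: contrapT => nex.
have ex_x k : exists x, (\int[m]_(y in eball x k.+1%:R) (f y)%:E <= (1 / (2 ^ k.+1)%:R)%:E)%E.
  apply: contrapT => nx; apply: nex; exists k.+1%:R; first exact: ltr0Sn.
  exists (1 / (2 ^ k.+1)%:R); first by rewrite divr_gt0// ltr0n expn_gt0.
  by move=> x; rewrite leNgt; apply/negP => h; apply: nx; exists x; exact: ltW.
have [c hc] := choice ex_x.
pose B k := eball (c k) k.+1%:R; pose G := \bigcup_k B k.
have mB k : measurable (B k) by apply: measurable_eball; exact: ltr0Sn.
have mfE D : measurable_fun D (EFin \o f).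
  by apply: measurable_funTS; exact/measurable_EFinP.
have lG : large_open G.
  split; first by apply: bigcup_open => k _; apply: open_eball; exact: ltr0Sn.
  (* With k the integer part of [r], the ball of index k has radius k+1 > r. *)
  move=> r r0; pose k := Num.truncn r; exists (c k) => y yr; exists k => //.
  apply: (lt_trans yr); exact: real_truncnS_gt (num_real r).
have := ab _ lG (bigcupT_measurable _ mB).
rewrite (_ : (fun x => (- f x)%:E) = (fun x => - (f x)%:E)%E)//.
rewrite integral_ge0N; last by move=> y _; rewrite lee_fin.
move/eqP; rewrite eqe_oppLR /= => /eqP Goo.
have : (\int[m]_(x in G) (f x)%:E <= 1)%E.
  (* The balls may overlap; once they are made disjoint, their masses are at most 2^(-(k+1)) and sum
     to at most 1. *)
  rewrite /G seqDU_bigcup_eq ge0_integral_bigcup//=.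
  - apply: (@le_trans _ _ (\sum_(0 <= k <oo) (1 / (2 ^ k.+1)%:R)%:E)%E); last exact: epsilon_trick0.
    apply: lee_nneseries => k _.
      by move=> _; apply: integral_ge0 => y _; rewrite lee_fin.
    apply: le_trans (hc k); apply: ge0_subset_integral => //.
    + exact: seqDU_measurable.
    + exact: (mB k).
    + by move=> y _; rewrite lee_fin.
    + exact: subset_seqDU.
  - exact: seqDU_measurable.
  - by move=> y _; rewrite lee_fin.
by rewrite Goo.
Qed.

End arendt_batty_ball.

(** * Bounds on Psi *)

Section Psi_bounds.
Context {R : realType} {n : nat}.
Variable mu : R.
Hypotheses (mu0 : 0 < mu) (mu1 : mu <= 1).
Local Notation m := (@lebesgue_rV R n).
Local Notation leb := (@lebesgue_measure R).
Local Notation mR := (measurableTypeR R).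
Local Notation k := (@stable_conv R n mu).
Local Notation Sg := (Sg m k).
Let mk : markov_kernel m k := markov_stable_conv mu0 mu1.
Implicit Types (x y : 'rV[R]_n).

(** By translation invariance the kernel bound on the ball about the origin serves at every [x]; it
    is uniform for times bounded and bounded away from 0. *)
Lemma Sg_ball_ge C (f : 'rV[R]_n -> R) (r s1 s2 delta : R) :
  bounded_meas C f -> (forall y, 0 <= f y) -> 0 < r -> 0 < s1 -> 0 < delta ->
  (forall x, (delta%:E <= \int[m]_(y in eball x r) (f y)%:E)%E) ->
  exists2 e : R, 0 < e & forall s x, s1 <= s <= s2 -> e <= Sg s f x.
Proof.
move=> bf f0 r0 s10 d0 hd; have [mf fC] := bf.
have [kappa kappa0 hk] := @stable_kernel_locally_gt0 R n mu mu0 mu1 (r ^+ 2) s1 s2 s10.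
exists (kappa * delta); first exact: mulr_gt0.
move=> s x s12; have s0 : 0 < s by case/andP: s12 => h _; exact: lt_le_trans h.
have mB := measurable_eball x r0.
have iS := integ_Sg mk x s0 bf.
have mfE D : measurable_fun D (EFin \o f) by apply: measurable_funTS; exact/measurable_EFinP.
have mkf D : measurable_fun D (fun y => (k s x y * f y)%:E).
  by apply: measurable_funTS; case/integrableP : iS.
have kf0 y : (0 <= (k s x y * f y)%:E)%E.
  by rewrite lee_fin mulr_ge0//; exact: (mk_ge0 mk).
rewrite -lee_fin /Sg (EFin_Rintegral iS).
apply: (@le_trans _ _ (kappa%:E * \int[m]_(y in eball x r) (f y)%:E)%E).
  by rewrite EFinM; apply: lee_wpmul2l; [rewrite lee_fin ltW|exact: hd].
rewrite -ge0_integralZl//; last 2 first.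
  by move=> y _; rewrite lee_fin.
  by rewrite lee_fin ltW.
apply: (@le_trans _ _ (\int[m]_(y in eball x r) (k s x y * f y)%:E)%E).
  apply: ge0_le_integral => //.
  - by move=> y _; rewrite -EFinM lee_fin mulr_ge0// ltW.
  - by apply: measurable_funeM.
  - move=> y; rewrite (eballE _ r0) /= => yr; rewrite -EFinM lee_fin ler_wpM2r//.
    by apply: hk => //; rewrite -opprB dotpNl dotpNr opprK ltW.
by apply: ge0_subset_integral.
Qed.

Section chi_Sg.
Variables (C : R) (f : 'rV[R]_n -> R).
Hypotheses (bf : bounded_meas C f) (f0 : forall y, 0 <= f y).

Lemma measurable_chi_Sg t x : measurable_fun [set: mR] (fun s => chi t s * Sg s f x).
Proof.
apply: measurable_funM; first by apply: measurable_chi.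
apply: (measurable_Sg mk (g := fun=> f)) => //.
by case: bf => mf _; exact: (measurableT_comp mf).
Qed.

Lemma integ_chi_Sg t x : integ leb (fun s => chi t s * Sg s f x).
Proof.
have [ic _] := integ_chi t.
apply: (@integ_le _ _ _ leb _ _ (measurable_chi_Sg t x) _ (integZl C ic)).
by apply: chi_mul_le => s /andP[s0 _]; exact: (Sg_le mk).
Qed.

Lemma chi_Sg_le t x : 0 <= t -> \int[leb]_s (chi t s * Sg s f x) <= C * t.
Proof.
move=> t0; have [ic It] := integ_chi t.
rewrite -[X in C * X](It t0) -(RintegralZl _ measurableT ic).
apply: ler_Rint; [exact: integ_chi_Sg|exact: (integZl C ic)|].
move=> s; rewrite /chi; case: ifPn => [/andP[s0 _]|_]; last by rewrite mul0r mulr0.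
by rewrite mul1r mulr1; apply: le_trans (ler_norm _) _; exact: (Sg_le mk).
Qed.

(** Times below [t / 2] are discarded, [Sg s f x] being only known to be nonnegative there. *)
Lemma chi_Sg_ge (e t : R) x : 0 < t -> (forall s, t / 2 <= s <= t -> e <= Sg s f x) ->
  e * (t / 2) <= \int[leb]_s (chi t s * Sg s f x).
Proof.
move=> t0 he; have [ic It] := integ_chi t; have [ic2 It2] := integ_chi (t / 2).
have t20 : 0 <= t / 2 by rewrite divr_ge0// ltW.
have -> : t / 2 = \int[leb]_s (chi t s - chi (t / 2) s).
  by rewrite (RintegralB measurableT ic ic2) (It (ltW t0)) (It2 t20); lra.
rewrite -(RintegralZl _ measurableT (integB ic ic2)).
apply: ler_Rint; [exact: (integZl e (integB ic ic2))|exact: integ_chi_Sg|].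
move=> s; rewrite /chi; case: ifPn => [/andP[s0 st]|h]; last first.
  rewrite ifF ?subrr ?mulr0 ?mul0r//; apply/negbTE; apply: contra h => /andP[-> h] /=.
  by apply: lt_le_trans h _; lra.
rewrite mul1r s0 /=; case: ltP => h; last by rewrite subr0 mulr1 he// h ltW.
by rewrite subrr mulr0; exact: (Sg_ge0 mk).
Qed.

End chi_Sg.

Variable V : Linfty R n.
Hypotheses (a0 : 0 < Linfty_norm V) (Vle0 : \forall x \ae m, V x <= 0).

Let bN : bounded_meas (Linfty_norm V) (fun y => - Vrep V y).
Proof.
have [mV Va] := bounded_Vrep a0; split; first exact: measurableT_comp.
by move=> y; rewrite normrN.
Qed.

(** At [s = 0], [heat_sg] is the identity by definition and not an integral; the endpoints are null,
    so the closed interval is exchanged for the open one. *)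
Lemma PsiE theta x : 0 < theta ->
  Psi mu theta V x = \int[leb]_s (chi (theta / Linfty_norm V) s * Sg s (fun y => - Vrep V y) x).
Proof.
move=> theta0; set tau := theta / _.
have e (s : R) : 0 < s -> heat_sg mu s (fun y => `|V y|) x = Sg s (fun y => - Vrep V y) x.
  move=> s0; rewrite heat_sgE//; apply: (Sg_ae_eq mu0 mu1).
  - exact: measurableT_comp.
  - by case: bN.
  - apply: filterS (Vrep_ae Vle0) => y ->.
    by rewrite ler0_norm// Vrep_le0.
rewrite /Psi -/tau.
have mS : measurable_fun [set: mR] (fun s : mR => Sg s (fun y => - Vrep V y) x).
  apply: (measurable_Sg mk (g := fun=> fun y => - Vrep V y)) => //.
  by case: bN => mf _; exact: (measurableT_comp mf).
have me (D : set R) : (forall s, D s -> 0 < s) ->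
    measurable_fun (D : set mR) (fun s : mR => (heat_sg mu s (fun y => `|V y|) x)%:E).
  move=> D0; apply/measurable_EFinP.
  apply: (eq_measurable_fun (fun s : mR => Sg s (fun y => - Vrep V y) x)).
    by move=> s /set_mem /D0 s0; rewrite e.
  exact: measurable_funTS.
rewrite -Rint_itv_chi; transitivity (\int[leb]_(s in `]0, tau[) heat_sg mu s (fun y => `|V y|) x).
  rewrite /Rintegral; congr fine.
  rewrite -integral_itv_obnd_cbnd; last by apply: me => s; rewrite /= in_itv/= => /andP[].
  by rewrite -integral_itv_bndo_bndc//; apply: me => s; rewrite /= in_itv/= => /andP[].
apply: eq_Rintegral => s /set_mem; rewrite /= in_itv/= => /andP[s0 _].
exact: e.
Qed.

Lemma Psi_le theta x : 0 < theta -> Psi mu theta V x <= theta.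
Proof.
move=> theta0; rewrite PsiE//; have N0 y : 0 <= - Vrep V y by rewrite oppr_ge0 Vrep_le0.
apply: le_trans (chi_Sg_le bN _ _) _; first by rewrite divr_ge0// ltW.
by rewrite mulrCA divff ?mulr1// gt_eqF.
Qed.

Lemma Psi_lower theta : 0 < theta -> arendt_batty V ->
  exists2 e : R, 0 < e & forall x, e <= Psi mu theta V x.
Proof.
move=> theta0 ab; have N0 y : 0 <= - Vrep V y by rewrite oppr_ge0 Vrep_le0.
have tau0 : 0 < theta / Linfty_norm V by rewrite divr_gt0.
have ab' G : large_open G -> measurable G -> (\int[m]_(y in G) (- - Vrep V y)%:E = -oo)%E.
  move=> lG mG; rewrite -(ab G lG); apply: ae_eq_integral => //.
  - apply/measurable_EFinP; apply: measurable_funTS; apply: measurableT_comp => //.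
    by case: bN.
  - by apply/measurable_EFinP; exact: measurable_funTS.
  - by apply: filterS (Vrep_ae Vle0) => y -> _; rewrite opprK.
have [r r0 [delta d0 hd]] := arendt_batty_ball bN.1 N0 ab'.
have s10 : 0 < theta / Linfty_norm V / 2 by rewrite divr_gt0.
have [e e0 he] := Sg_ball_ge (theta / Linfty_norm V) bN N0 r0 s10 d0 hd.
exists (e * (theta / Linfty_norm V / 2)); first exact: mulr_gt0.
move=> x; rewrite PsiE//; apply: (chi_Sg_ge bN N0 tau0) => s hs.
exact: he.
Qed.

End Psi_bounds.

(** * Exponential decay *)

Section decay.
Context {R : realType} {n : nat}.
Variable mu : R.
Hypotheses (mu0 : 0 < mu) (mu1 : mu <= 1).
Local Notation m := (@lebesgue_rV R n).
Local Notation k := (@stable_conv R n mu).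
Let mk : markov_kernel m k := markov_stable_conv mu0 mu1.
Variable V : Linfty R n.
Local Notation a := (Linfty_norm V).
Hypotheses (a0 : 0 < a) (Vle0 : \forall x \ae m, V x <= 0).

(** Equality is allowed on the right only: decay over [j] steps needs [j * tau < t] strictly. *)
Lemma ex_natmul_itv (z : R) : 0 < z -> exists j : nat, j%:R < z <= j.+1%:R.
Proof.
move=> z0; have /andP[h1 h2] := truncn_itv (ltW z0).
move: h1; rewrite le_eqVlt => /orP[/eqP h|h]; last first.
  by exists (Num.truncn z); rewrite h ltW.
case: (Num.truncn z) h => [|j] h; first by rewrite -h ltxx in z0.
by exists j; rewrite -h lexx ltr_nat ltnSn.
Qed.

(** As t / tau <= j+1, q^j = q^(j+1) / q is at most q^(t / tau) / q; this division by q is the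
    origin of [C0]. *)
Lemma perturbed_sg_decay theta (e : R) (u0 : Linfty R n) t :
  0 < theta < 1 -> 0 < e < 1 -> (forall x, e <= Psi mu theta V x) -> 0 < t ->
  Linfty_norm (perturbed_sg mu V t u0) <= Linfty_norm u0 *
    ((1 - (1 - theta) * e)^-1 * expR (ln (1 - (1 - theta) * e) * (t / (theta / a)))).
Proof.
move=> /andP[theta0 theta1] /andP[e0 e1] he t0; set q := 1 - _.
have tau0 : 0 < theta / a by rewrite divr_gt0.
have q0 : 0 < q by rewrite /q; nra.
have q1 : q < 1 by rewrite /q; nra.
have br := bounded_Linfty_rep u0.
have hq y : sol m k a (damp V) (fun=> 1) (theta / a) y <= q.
  have atau : a * (theta / a) = theta by rewrite mulrCA divff ?mulr1// gt_eqF.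
  apply: le_trans (sol1_le mk a0 (measurable_damp V) (damp_ge0 a0) (@damp_le _ _ V) y theta1 tau0 atau) _.
  rewrite /q lerD2l lerN2 ler_pM2l ?subr_gt0//.
  apply: le_trans (he y) _; rewrite (PsiE mu0 mu1 a0 Vle0 y theta0).
  rewrite (_ : (fun y => a - damp V y) = (fun y => - Vrep V y))//.
  by apply/funext => z; rewrite /damp opprD addrCA subrr addr0.
have [j /andP[jt tj]] := ex_natmul_itv (divr_gt0 t0 tau0).
have jtau : j%:R * (theta / a) < t by rewrite -ltr_pdivlMr.
apply: (perturbed_sg_le mu0 mu1 a0 Vle0 t0) => x.
apply: le_trans (sol_decay_pow mk a0 (measurable_damp V) (damp_ge0 a0) (@damp_le _ _ V) x br tau0 (ltW q0) hq jtau) _.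
rewrite ler_wpM2l ?Linfty_norm_ge0// ler_pdivlMl// -exprS.
have -> : q ^+ j.+1 = expR (ln q * j.+1%:R) by rewrite expRM_natr lnK// posrE.
by rewrite ler_expR ler_nM2l// ln_lt0// q0.
Qed.

End decay.

Theorem proposition7p5 (R : realType) (N : nat) (mu : R) (V : Linfty R N) :
  (0 < N)%N ->
  0 < mu <= 1 ->
  (\forall x \ae lebesgue_rV N, V x <= 0) ->
  arendt_batty V ->
  forall theta : R, 0 < theta < 1 ->
  let Psi_inf := inf (range (Psi mu theta V)) in
  let c := - theta^-1 * ln (1 - (1 - theta) * Psi_inf) in
  let C0 := (1 - (1 - theta) * Psi_inf)^-1 in
  let omega0 := c * Linfty_norm V in
  [/\ 0 < Psi_inf,
      forall x, Psi_inf <= Psi mu theta V x <= theta,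
      0 < c,
      1 < C0 &
      forall t : R, 0 <= t ->
        (Linfty_opnorm (perturbed_sg mu V t) <=
          (C0 * expR (- (omega0 * t)))%:E)%E].
Proof.
move=> _ /andP[mu0 mu1] Vle0 ab theta th; have /andP[theta0 theta1] := th.
have a0 := arendt_batty_norm_gt0 ab.
have [e e0 he] := Psi_lower mu0 mu1 a0 Vle0 theta0 ab.
have hle x : Psi mu theta V x <= theta := Psi_le mu0 mu1 a0 Vle0 x theta0.
have lbP : lbound (range (Psi mu theta V)) e by move=> _ [x _ <-]; exact: he.
move=> Psi_inf c C0 omega0.
have Pe : e <= Psi_inf by apply: lb_le_inf => //; exists (Psi mu theta V 0); exists 0.
have P0 : 0 < Psi_inf by exact: lt_le_trans Pe.
have Ple x : Psi_inf <= Psi mu theta V x by apply: ge_inf; [exists e|exists x].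
(* Hence [Psi_inf < 1], and the argument of the logarithm lies in ]0, 1[. *)
have Pth : Psi_inf <= theta by apply: le_trans (Ple 0) (hle 0).
have q0 : 0 < 1 - (1 - theta) * Psi_inf by nra.
have q1 : 1 - (1 - theta) * Psi_inf < 1 by nra.
have C1 : 1 < C0 by rewrite /C0 invf_gt1.
split=> //.
- by move=> x; rewrite Ple hle.
- by rewrite /c nmulr_rgt0 ?oppr_lt0 ?invr_gt0// ln_lt0// q0.
move=> t; rewrite le_eqVlt => /orP[/eqP <-|t0]; apply: ub_ereal_sup => _ [f /= f1 <-]; rewrite lee_fin.
  (* At t = 0 the operator is the identity and the bound reads 1 <= [C0]. *)
  by rewrite mulr0 oppr0 expR0 mulr1 /perturbed_sg eqxx (le_trans f1)// ltW.
have P01 : 0 < Psi_inf < 1 by rewrite P0 (le_lt_trans Pth).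
apply: le_trans (perturbed_sg_decay mu0 mu1 a0 Vle0 f th P01 Ple t0) _.
(* With tau = theta / a, [omega0] is - ln q / tau: a factor q for each time step tau. *)
have -> : - (omega0 * t) = ln (1 - (1 - theta) * Psi_inf) * (t / (theta / Linfty_norm V)).
  by rewrite /omega0 /c; field; rewrite !gt_eqF.
by rewrite ler_piMl// mulr_ge0 ?expR_ge0// invr_ge0 ltW.
Qed.
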